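(* Let $X,Y\subset\mathbb{R}^N$ be closed semialgebraic sets with $0\in X\cap Y$. Put $r=r(X)+r(Y)$ and $d=\max\{\kappa(X),\kappa(Y)\}$, and assume $d\ge 1$. Then there exist a neighbourhood $U\subset\mathbb{R}^N$ of $0$ and a positive constant $C$ such that $$\operatorname{dist}(x,X)+\operatorname{dist}(x,Y)\ge C\,\operatorname{dist}(x,X\cap Y)^{d(6d-3)^{N+r-1}}\quad\text{for } x\in U.$$ If, additionally, $0$ is an isolated point of $X\cap Y$, then for some neighbourhood $U\subset\mathbb{R}^N$ of $0$ and some positive constant $C$, $$\operatorname{dist}(x,X)+\operatorname{dist}(x,Y)\ge C|x|^{\frac{(2d-1)^{N+r}+1}{2}}\quad\text{for } x\in U.$$
   Context: $|\cdot|$ is the Euclidean norm and $\operatorname{dist}$ the Euclidean distance to a set. Complexity numbers. Every closed semialgebraic set $X\subset\mathbb{R}^N$ has a decomposition $X=X_1\cup\dots\cup X_k$ into closed basic semialgebraic sets $$X_i=\{x\in\mathbb{R}^N: g_{i,1}(x)\ge 0,\dots,g_{i,r_i}(x)\ge 0,\ h_{i,1}(x)=\dots=h_{i,l_i}(x)=0\},\quad i=1,\dots,k,$$ with $g_{i,j},h_{i,s}\in\mathbb{R}[x_1,\dots,x_N]$, where $r_i$ is taken to be the smallest possible number of inequalities in the definition of $X_i$. The number $r(X)$ is the minimum of $\max\{r_1,\dots,r_k\}$ over all such decompositions of $X$ (so $r(X)=0$ if and only if $X$ is algebraic). The number $\kappa(X)$ is the minimum of the maximal degree of all the polynomials $g_{i,j},h_{i,s}$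 over all such decompositions (descriptions) of $X$ that satisfy $r_i\le r(X)$ for all $i$. *)

(* Defs.v *)
From HB Require Import structures.
From mathcomp Require Import all_boot all_order all_algebra.
From mathcomp Require Import all_classical all_reals all_analysis.
(* The notations of mpoly clash with those of mathcomp-analysis. *)
From mathcomp Require Import (coercions, canonicals) mpoly.

Set Implicit Arguments.
Unset Strict Implicit.
Unset Printing Implicit Defensive.

Import Order.TTheory GRing.Theory Num.Theory.
Import numFieldNormedType.Exports.

Local Open Scope classical_set_scope.
Local Open Scope ring_scope.

(* The norm `|x| of mathcomp-analysis on 'rV[R]_N is the sup norm; it induces
   the same topology, but metric statements must use the Euclidean norm. *)
Definition enorm (R : realType) (N : nat) (x : 'rV[R]_N) : R :=
  Num.sqrt (\sum_(i < N) x ord0 i ^+ 2).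

Definition dist (R : realType) (N : nat) (x : 'rV[R]_N) (A : set 'rV[R]_N) : R :=
  inf [set enorm (x - a) | a in A].

Definition peval (R : realType) (N : nat) (p : mpoly.mpoly N R)
  (x : 'rV[R]_N) : R := mpoly.meval (fun i => x ord0 i) p.

(* mpoly.msize is the total degree plus one, and 0 for the zero polynomial;
   the zero polynomial is thus given degree 0. *)
Definition pdeg (R : realType) (N : nat) (p : mpoly.mpoly N R) : nat :=
  (mpoly.msize p).-1.

(* The smallest class of sets containing all {p > 0} and stable under the
   Boolean operations; {p = 0} is ~` ({p > 0} `|` {- p > 0}). *)
Inductive semialgebraic (R : realType) (N : nat) : set 'rV[R]_N -> Prop :=
| semialgebraic_pos (p : mpoly.mpoly N R) :
    semialgebraic [set x | 0 < peval p x]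
| semialgebraic_setU (A B : set 'rV[R]_N) :
    semialgebraic A -> semialgebraic B -> semialgebraic (A `|` B)
| semialgebraic_setI (A B : set 'rV[R]_N) :
    semialgebraic A -> semialgebraic B -> semialgebraic (A `&` B)
| semialgebraic_setC (A : set 'rV[R]_N) :
    semialgebraic A -> semialgebraic (~` A).

Record description (R : realType) (N : nat) := Description {
  ineqs : seq (mpoly.mpoly N R);
  eqns : seq (mpoly.mpoly N R) }.

Definition basic_set (R : realType) (N : nat) (D : description R N) :
    set 'rV[R]_N :=
  [set x | all (fun g => 0 <= peval g x) (ineqs D) &&
           all (fun h => peval h x == 0) (eqns D)].

(* D uses the smallest possible number of inequalities among all the
   descriptions of the same basic set. *)
Definition minimal_description (R : realType) (N : nat)
    (D : description R N) : Prop :=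
  forall D' : description R N, basic_set D' = basic_set D ->
    (size (ineqs D) <= size (ineqs D'))%N.

(* The pieces are indexed from 0 to k - 1 (k = 0 only describes set0, which is
   also described by the single equation 1 = 0). *)
Definition decomposition (R : realType) (N : nat) (X : set 'rV[R]_N) (k : nat)
    (D : 'I_k -> description R N) : Prop :=
  (forall i, minimal_description (D i)) /\
  X = [set x | exists i, basic_set (D i) x].

(* The least element of A if A is nonempty, and 0 otherwise. *)
Definition nat_min (A : set nat) : nat :=
  xget 0%N [set n | A n /\ forall m, A m -> (n <= m)%N].

Definition ineq_number (R : realType) (N : nat) (X : set 'rV[R]_N) : nat :=
  nat_min [set n | exists (k : nat) (D : 'I_k -> description R N),
    decomposition X D /\ n = (\max_(i < k) size (ineqs (D i)))%N].

Definition kappa (R : realType) (N : nat) (X : set 'rV[R]_N) : nat :=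
  nat_min [set n | exists (k : nat) (D : 'I_k -> description R N),
    [/\ decomposition X D,
        forall i, (size (ineqs (D i)) <= ineq_number X)%N &
        n = (\max_(i < k) \max_(p <- ineqs (D i) ++ eqns (D i)) pdeg p)%N]].

(* Main.v *)
(* Let A and B be basic pieces of X and Y containing 0, let d >= 2 bound the degrees
   and let n = N + r. Adding a variable per inequality, x in A and y in B are lifted to
   w = (x, (sqrt (g_k x))_k, (sqrt (g'_l y))_l), and A and B to the zeros of
     f = sum_k (g_k - t_k^2)^2 + sum_l (g'_l - s_l^2)^2 + (sum of the squared equations),
   a nonnegative polynomial of degree at most 2 d with f(w) <= C |x - y|^2, whose zeros
   project into A `&` B. The theorem thus follows from lower bounds of a polynomial
   f >= 0 of degree at most D in n variables near a zero z:
     f(a) >= c |a - z|^((D - 1)^n + 1) if z is an isolated zero,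
     f(a) >= c dist(a, {f = 0})^L with L = D (3 D - 3)^(n - 1) in general.
   For the first, a minimiser of f + u x_k near z is an algebraic function of u, of
   degree at most (D - 1)^n. For the second, a gradient inequality
   |grad f| >= c f^(1 - 1/L) suffices; it comes from a curve of minimisers x(t) of
   |grad f|^2 - t w f on a ball, on which f(x(t)) is bounded by integrating f' along
   the curve, given that x_k(t) is algebraic of small degree in t (or, for n = 2, in
   f(x(t))). The weight w keeps the minimisers inside the ball (n >= 3) or makes a
   Jacobian nonzero (n = 2). For d = 1 the pieces are polyhedra and the exponent is 1. *)
Require Import Defs.
From HB Require Import structures.
From mathcomp Require Import all_boot all_order all_algebra.
From mathcomp Require Import all_classical all_reals all_analysis.
From mathcomp Require Import (coercions, canonicals) mpoly.
From mathcomp Require Import ring lra zify.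
From mathcomp Require ordered_qelim qe_rcf.

Set Implicit Arguments.
Unset Strict Implicit.
Unset Printing Implicit Defensive.

Import Order.TTheory GRing.Theory Num.Theory.
Import numFieldNormedType.Exports.

Local Open Scope classical_set_scope.
Local Open Scope ring_scope.


(** * Elimination *)

(** In the gradient inequality put [L = k + 2]. The minimisers satisfy [|grad f|^2 <= 2 t f], whence
    [f <= B t |x - x0|^2] along the curve with limit [x0]; together with [|x_i - x0_i|^k <= C t]
    this gives [f^k <= C' t^(k+2)], which is what the comparison with a point where [f = s^(k+2)]
    needs for [t] of order [s^k]. Elimination yields [k = (2 D - 3)^n]. This is at most
    [D (3 D - 3)^(n-1) - 2] for [n >= 3] and [D >= 4], but not for [n = 2] and large [D]. Hence the
    separate argument in the plane: the coordinates are related to the value of [f] instead of [t],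
    and eliminating between [f] and a Jacobian of degree [3 D - 3] gives [|x_i - x0_i|^(k+2) <= C f]
    with [k + 2 = D (3 D - 3)], which implies the same bound on [f^k]. The curves come from
    quantifier elimination: a definable function of one variable is algebraic, and near 0 it is
    differentiable and monotone. With [D = 2 d] the factor [3 D - 3] is the [6 d - 3] of the
    theorem. *)

Section Elimination.
Variables (R : idomainType) (n m : nat) (k : 'I_n).
Variables (a b : 'I_n -> mpoly.mpoly n R).
Hypothesis m_gt0 : (0 < m)%N.
Hypothesis size_a : forall i, (mpoly.msize (a i) <= m.+1)%N.
Hypothesis size_b : forall i, (mpoly.msize (b i) <= m.+1)%N.

(** [M] bounds the number of monomials with all exponents below [m]. Degree at most [M] leaves room
    for the powers [1, x_k, ..., x_k^M], one more than the reduced monomials. *)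
Let M := (m ^ n)%N.
Let T : finType := mpoly.bmultinom n M.+1.
Let mon (t : T) : mpoly.multinom n := mpoly.bmnm t.

Let reduced (t : T) : bool := [forall i, (mon t i < m)%N].

Let shift_mon (t : T) (i : 'I_n) : mpoly.multinom n :=
  mpoly.mnm_sub (mon t) (mpoly.mnm_muln (mpoly.mnm1 i) m).

Let red_poly (t : T) (i : 'I_n) (c : 'I_n -> mpoly.mpoly n R) :=
  mpoly.mpolyX R (shift_mon t i) * c i.

(** A monomial divisible by [x_i^m] is rewritten by the [i]-th equation,
    [eta x_i^m = - (a_i + u b_i)]; the rows of reduced monomials are 0. The variable of the entries
    is [u], and [eta] is the variable of the characteristic polynomial. *)
Let redmx : 'M[{poly R}]_(#|T|) := \matrix_(r, c)
  if [pick i | m <= mon (enum_val r) i]%N is Some i then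
    - ((mpoly.mcoeff (mon (enum_val c)) (red_poly (enum_val r) i a))%:P
       + (mpoly.mcoeff (mon (enum_val c)) (red_poly (enum_val r) i b)) *: 'X)
  else 0.

Let ev (eta u : R) (p : {poly {poly R}}) : R := p.[eta%:P].[u].

Let evM eta u : {morph ev eta u : p q / p * q}.
Proof. by move=> p q; rewrite /ev !hornerM. Qed.
Let evD eta u : {morph ev eta u : p q / p + q}.
Proof. by move=> p q; rewrite /ev !hornerD. Qed.
Let ev0 eta u : ev eta u 0 = 0.
Proof. by rewrite /ev !horner0. Qed.
Let ev_sum eta u I (r : seq I) (P : pred I) F :
  ev eta u (\sum_(i <- r | P i) F i) = \sum_(i <- r | P i) ev eta u (F i).
Proof. exact: (big_morph _ (evD eta u) (ev0 eta u)). Qed.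

Let monval (x : 'I_n -> R) (t : T) : R := mpoly.meval x (mpoly.mpolyX R (mon t)).

(** Rewriting does not raise the degree, since [x_i^m] gives way to polynomials of degree at most
    [m]: monomials of degree at most [M] suffice. *)
Let size_red_poly (t : T) i c : (m <= mon t i)%N ->
  (mpoly.msize (c i) <= m.+1)%N -> (mpoly.msize (red_poly t i c) <= M.+1)%N.
Proof.
move=> mt sc; rewrite /red_poly.
have [->|c0] := eqVneq (c i) 0; first by rewrite mulr0 mpoly.mmeasure0.
have tM : (mpoly.mdeg (mon t) <= M)%N by rewrite -ltnS; exact: mpoly.bmdeg.
have tE : mon t = mpoly.mnm_add (shift_mon t i) (mpoly.mnm_muln (mpoly.mnm1 i) m).
  apply/mpoly.mnmP => j; rewrite mpoly.mnmDE mpoly.mnmBE mpoly.mulmnE mpoly.mnm1E.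
  have [<-|ij] := eqVneq i j; first by rewrite mul1n subnK.
  by rewrite mul0n subn0 addn0.
move: tM; rewrite tE mpoly.mdegD mpoly.mdegMn mpoly.mdeg1 mul1n => tM.
rewrite mpoly.msizeM //; last by rewrite -mpoly.msize_poly_eq0 mpoly.msizeX.
rewrite mpoly.msizeX addSn /=.
apply: (@leq_trans (mpoly.mdeg (shift_mon t i) + m.+1)); first by rewrite leq_add2l.
by rewrite addnS ltnS.
Qed.

Let meval_monval x p : (mpoly.msize p <= M.+1)%N ->
  mpoly.meval x p = \sum_(c : T) mpoly.mcoeff (mon c) p * monval x c.
Proof.
move=> sp; rewrite {1}(mpoly.mpolywE sp) raddf_sum /=.
by apply: eq_bigr => c _; rewrite mpoly.mevalZ.
Qed.

Let row_eq eta u x :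
  (forall i, mpoly.meval x (a i) + u * mpoly.meval x (b i) + eta * x i ^+ m = 0) ->
  forall r, \sum_c ev eta u (char_poly_mx redmx r c) * monval x (enum_val c) =
            if reduced (enum_val r) then eta * monval x (enum_val r) else 0.
Proof.
move=> sys r.
have evE c : ev eta u (char_poly_mx redmx r c) =
    eta *+ (r == c) - (redmx r c).[u].
  rewrite /ev /char_poly_mx !mxE hornerD hornerN hornerC hornerMn hornerX.
  by rewrite hornerD hornerN hornerMn hornerC.
under eq_bigr do rewrite evE mulrBl.
rewrite sumrB (bigD1 r) //= eqxx mulr1n big1 ?addr0; last first.
  by move=> c; rewrite eq_sym => /negPf ->; rewrite mulr0n mul0r.
have -> : reduced (enum_val r) = ([pick i | m <= mon (enum_val r) i]%N == None).
  case: pickP => [i mi|no] /=; last by apply/forallP => i; rewrite ltnNge no.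
  by apply/negbTE/forallPn; exists i; rewrite -leqNgt.
under eq_bigr do rewrite mxE.
case: pickP => [i mi|no] /=; last first.
  by rewrite big1 ?subr0 // => c _; rewrite horner0 mul0r.
under eq_bigr do rewrite hornerN hornerD hornerC hornerZ hornerX mulNr mulrDl.
rewrite sumrN opprK big_split /=.
have big_mon p : (mpoly.msize p <= M.+1)%N ->
    \sum_(c < #|T|) mpoly.mcoeff (mon (enum_val c)) p * monval x (enum_val c) =
    mpoly.meval x p.
  move=> sp; rewrite (meval_monval x sp) -(big_enum_val (fun c : T =>
    mpoly.mcoeff (mon c) p * monval x c)) /=.
  by apply: eq_bigl.
rewrite big_mon ?size_red_poly //.
under eq_bigr do rewrite mulrAC mulrC.
rewrite -mulr_sumr big_mon ?size_red_poly // !mpoly.mevalM.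
have -> : monval x (enum_val r) =
    mpoly.meval x (mpoly.mpolyX R (shift_mon (enum_val r) i)) * x i ^+ m.
  rewrite /monval.
  have {1}-> : mon (enum_val r) = mpoly.mnm_add (shift_mon (enum_val r) i)
      (mpoly.mnm_muln (mpoly.mnm1 i) m).
    apply/mpoly.mnmP => j; rewrite mpoly.mnmDE mpoly.mnmBE mpoly.mulmnE mpoly.mnm1E.
    have [<-|ij] := eqVneq i j; first by rewrite mul1n subnK.
    by rewrite mul0n subn0 addn0.
  rewrite mpoly.mpolyXD mpoly.mevalM; congr (_ * _).
  rewrite mpoly.mevalX (bigD1 i) //= big1 => [|j ji]; last first.
    by rewrite mpoly.mulmnE mpoly.mnm1E eq_sym (negPf ji) mul0n expr0.
  by rewrite mulr1 mpoly.mulmnE mpoly.mnm1E eqxx mul1n.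
rewrite -[RHS](mulr0 (mpoly.meval x (mpoly.mpolyX R (shift_mon (enum_val r) i)))).
by rewrite -(sys i); ring.
Qed.

Let B : {set T} := [set t | reduced t]%SET.

Let card_B : (#|B| <= M)%N.
Proof.
case: (posnP m) m_gt0 => // _ _.
pose g (t : T) : {ffun 'I_n -> 'I_m.-1.+1} := [ffun i => inord (mon t i)].
suff /leq_card_in : {in B &, injective g}.
  by rewrite card_ffun !card_ord prednK.
move=> s t; rewrite !inE => /forallP rs /forallP rt /ffunP st.
apply/val_inj/mpoly.mnmP => i; move: (st i); rewrite !ffunE => /(congr1 (@nat_of_ord _)).
by rewrite !inordK // prednK // ?rs ?rt.
Qed.

Let pow_mon (j : 'I_M.+1) : mpoly.multinom n := mpoly.mnm_muln (mpoly.mnm1 k) j.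
Let pow_monP j : (mpoly.mdeg (pow_mon j) < M.+1)%N.
Proof. by rewrite mpoly.mdegMn mpoly.mdeg1 mul1n. Qed.
Let pw j : T := mpoly.BMultinom (pow_monP j).

(** One column per reduced monomial, padded with zero columns to a square matrix, so that a
    dependency between the [M + 1] rows comes from a zero determinant. The factor ['X], evaluated at
    [eta], is the one on the right of [row_eq]. *)
Let W : 'M[{poly {poly R}}]_(M.+1) := \matrix_(j, c)
  if insub (val c) : option 'I_#|B| is Some c' then
    \adj (char_poly_mx redmx) (enum_rank (pw j)) (enum_rank (enum_val c')) * 'X
  else 0.

(* [eta%:M - redmx] kills the vector of monomials of degree at most [M], up to the entries
   of the [m ^ n] reduced ones. By its adjugate, [char_poly redmx] times any of the
   [M.+1] powers of [x k] is a combination of the reduced monomials, hence a dependency. *)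
Lemma perturbed_elimination : exists P : {poly {poly {poly R}}},
  [/\ P != 0, (size P <= M.+1)%N & forall eta u x,
  (forall i, mpoly.meval x (a i) + u * mpoly.meval x (b i) + eta * x i ^+ m = 0) ->
  P.[(x k)%:P%:P].[eta%:P].[u] = 0].
Proof.
have /det0P[v v0 vW] : \det W == 0.
  apply/eqP; rewrite (expand_det_col _ ord_max) big1 // => i _.
  by rewrite mxE insubN ?mul0r //= -leqNgt card_B.
(* The characteristic polynomial is monic in [eta], so multiplying by it cannot turn the dependency
   [v] into the zero polynomial. *)
have chi0 : char_poly redmx != 0 by rewrite monic_neq0 // char_poly_monic.
pose P := \poly_(j < M.+1) (v 0 (inord j) * char_poly redmx).
exists P; split.
- apply: contraNneq v0 => P0; apply/eqP/matrixP => i j; rewrite ord1 mxE.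
  have /eqP : P`_j = 0 by rewrite P0 coef0.
  rewrite coef_poly ltn_ord inord_val mulf_eq0 (negPf chi0) orbF => /eqP ->//.
- exact: size_poly.
move=> eta u x sys; rewrite -[LHS]/(ev eta u _).
rewrite horner_poly ev_sum.
(* Cramer's rule: row [q] of the adjugate is applied to both sides of [row_eq]. *)
have chiE (j : 'I_M.+1) : ev eta u (char_poly redmx) * x k ^+ j =
   \sum_(s in B) ev eta u (\adj (char_poly_mx redmx) (enum_rank (pw j))
      (enum_rank s) * 'X) * monval x s.
  set q := enum_rank (pw j).
  have -> : x k ^+ j = monval x (enum_val q).
    rewrite /q enum_rankK /monval mpoly.mevalX (bigD1 k) //= big1 => [|i ik].
      by rewrite mulr1 mpoly.mulmnE mpoly.mnm1E eqxx mul1n.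
    by rewrite mpoly.mulmnE mpoly.mnm1E eq_sym (negPf ik) mul0n expr0.
  transitivity (\sum_r ev eta u (\adj (char_poly_mx redmx) q r) *
      \sum_c ev eta u (char_poly_mx redmx r c) * monval x (enum_val c)).
    under eq_bigr do rewrite mulr_sumr.
    rewrite exchange_big (bigD1 q) //= [X in _ + X]big1 => [|c cq].
      rewrite addr0.
      under eq_bigr do rewrite mulrA -evM.
      rewrite -mulr_suml -ev_sum; congr (ev _ _ _ * _).
      by move: (congr1 (fun A : 'M[{poly {poly R}}]_(#|T|) => A q q) (mul_adj_mx (char_poly_mx redmx)));
        rewrite !mxE eqxx mulr1n => ->.
    under eq_bigr do rewrite mulrA -evM.
    rewrite -mulr_suml -ev_sum.
    move: (congr1 (fun A : 'M[{poly {poly R}}]_(#|T|) => A q c) (mul_adj_mx (char_poly_mx redmx))).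
    by rewrite !mxE eq_sym (negPf cq) mulr0n => ->; rewrite ev0 mul0r.
  under eq_bigr do rewrite (row_eq sys).
  rewrite [RHS]big_mkcond /= [RHS](reindex (@enum_val T T)) /=; last first.
    exact/onW_bij/enum_val_bij.
  apply: eq_bigr => r _; rewrite inE enum_valK evM.
  case: (reduced _); last by rewrite mulr0.
  by rewrite mulrA; congr (_ * _ * _); rewrite /ev hornerX hornerC.
transitivity (\sum_(s in B) (ev eta u (\sum_(j < M.+1) v 0 j *
    (\adj (char_poly_mx redmx) (enum_rank (pw j)) (enum_rank s) * 'X))) * monval x s).
  under [RHS]eq_bigr do rewrite ev_sum mulr_suml.
  rewrite exchange_big /=; apply: eq_bigr => j _.
  under [RHS]eq_bigr do rewrite evM -mulrA.
  rewrite -mulr_sumr -chiE inord_val !evM mulrA; congr (_ * _).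
  by rewrite -!rmorphXn /ev !hornerC.
rewrite big1 // => s sB.
have sB' : (enum_rank_in sB s < M.+1)%N.
  by apply: leq_trans (ltn_ord _) _; apply: leq_trans card_B _.
rewrite (_ : \sum_j _ = 0) ?ev0 ?mul0r //.
have := congr1 (fun A : 'rV[{poly {poly R}}]_(M.+1) => A 0 (Ordinal sB')) vW.
rewrite !mxE => {2}<-; apply: eq_bigr => j _; congr (_ * _); rewrite [RHS]mxE.
by rewrite insubT //= => ?; rewrite (_ : Sub _ _ = enum_rank_in sB s) ?enum_rankK_in //; exact/val_inj.
Qed.
End Elimination.

(** * Definable sets and functions of one variable *)

Import ordered_qelim.

Section Definable.
Variable R : realType.
Implicit Types (P Q : (nat -> R) -> Prop) (e : nat -> R).

Definition upd e (i : nat) (x : R) : nat -> R := fun j => if j == i then x else e j.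

(* Valuations are total functions; those of [ord.holds] are sequences padded by 0. *)
Definition definable P := exists f : ord.formula R,
  forall s : seq R, P (nth 0 s) <-> ord.holds s f.

Definition definable_fun (T : (nat -> R) -> R) := exists t : GRing.term R,
  GRing.rterm t /\ forall s : seq R, T (nth 0 s) = GRing.eval s t.

Lemma nth_upd (s : seq R) i x : nth 0 (set_nth 0 s i x) = upd (nth 0 s) i x.
Proof. by apply/funext => j; rewrite nth_set_nth. Qed.

Lemma definable_ext P Q : (forall e, P e <-> Q e) -> definable P -> definable Q.
Proof. by move=> PQ [f fP]; exists f => s; rewrite -PQ. Qed.

Lemma definable_not P : definable P -> definable (fun e => ~ P e).
Proof. by move=> [f fP]; exists (ord.Not f) => s /=; rewrite fP. Qed.

Lemma definable_and P Q : definable P -> definable Q ->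
  definable (fun e => P e /\ Q e).
Proof. by move=> [f fP] [g gP]; exists (ord.And f g) => s /=; rewrite fP gP. Qed.

Lemma definable_or P Q : definable P -> definable Q ->
  definable (fun e => P e \/ Q e).
Proof. by move=> [f fP] [g gP]; exists (ord.Or f g) => s /=; rewrite fP gP. Qed.

Lemma definable_imp P Q : definable P -> definable Q ->
  definable (fun e => P e -> Q e).
Proof. by move=> [f fP] [g gP]; exists (ord.Implies f g) => s /=; rewrite fP gP. Qed.

Lemma definable_const (A : Prop) : definable (fun=> A).
Proof.
by exists (ord.Bool `[<A>]) => s /=; split=> [a|/asboolP//]; exact/asboolP.
Qed.

Definition qex i P : (nat -> R) -> Prop := fun e => exists x, P (upd e i x).
Definition qall i P : (nat -> R) -> Prop := fun e => forall x, P (upd e i x).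

Lemma definable_ex i P : definable P -> definable (qex i P).
Proof.
move=> [f fP]; exists (ord.Exists i f) => s /=.
by split=> -[x Px]; exists x; move: Px; rewrite -?nth_upd fP.
Qed.

Lemma definable_all i P : definable P -> definable (qall i P).
Proof.
move=> [f fP]; exists (ord.Forall i f) => s /=.
by split=> Px x; move: (Px x); rewrite -?nth_upd fP.
Qed.

Lemma definable_lt S T : definable_fun S -> definable_fun T ->
  definable (fun e => S e < T e).
Proof.
by move=> [s [_ sP]] [t [_ tP]]; exists (ord.Lt s t) => u /=; rewrite sP tP.
Qed.

Lemma definable_le S T : definable_fun S -> definable_fun T ->
  definable (fun e => S e <= T e).
Proof.
by move=> [s [_ sP]] [t [_ tP]]; exists (ord.Le s t) => u /=; rewrite sP tP.
Qed.

Lemma definable_eq S T : definable_fun S -> definable_fun T ->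
  definable (fun e => S e = T e).
Proof.
by move=> [s [_ sP]] [t [_ tP]]; exists (ord.Equal s t) => u /=; rewrite sP tP.
Qed.

Lemma definable_fun_ext S T : S =1 T -> definable_fun S -> definable_fun T.
Proof. by move=> ST [s [rs sP]]; exists s; split=> // u; rewrite -ST. Qed.

Lemma definable_fun_var i : definable_fun (fun e => e i).
Proof. by exists (GRing.Var R i). Qed.

Lemma definable_fun_cst (c : R) : definable_fun (fun=> c).
Proof. by exists (GRing.Const c). Qed.

Lemma definable_funD S T : definable_fun S -> definable_fun T ->
  definable_fun (fun e => S e + T e).
Proof.
move=> [s [rs sP]] [t [rt tP]]; exists (GRing.Add s t); split=> [|u] /=.
  by rewrite rs.
by rewrite sP tP.
Qed.

Lemma definable_funM S T : definable_fun S -> definable_fun T ->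
  definable_fun (fun e => S e * T e).
Proof.
move=> [s [rs sP]] [t [rt tP]]; exists (GRing.Mul s t); split=> [|u] /=.
  by rewrite rs.
by rewrite sP tP.
Qed.

Lemma definable_funN S : definable_fun S -> definable_fun (fun e => - S e).
Proof. by move=> [s [rs sP]]; exists (GRing.Opp s); split=> // u /=; rewrite sP. Qed.

Lemma definable_funB S T : definable_fun S -> definable_fun T ->
  definable_fun (fun e => S e - T e).
Proof. by move=> dS dT; apply: definable_funD => //; exact: definable_funN. Qed.

Lemma definable_funX S k : definable_fun S -> definable_fun (fun e => S e ^+ k).
Proof. by move=> [s [rs sP]]; exists (GRing.Exp s k); split=> // u /=; rewrite sP. Qed.

Lemma definable_fun_sum I (r : seq I) (p : pred I) (S : I -> (nat -> R) -> R) :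
  (forall i, definable_fun (S i)) ->
  definable_fun (fun e => \sum_(i <- r | p i) S i e).
Proof.
move=> dS; elim: r => [|i r ih].
  by apply: definable_fun_ext (definable_fun_cst 0) => e; rewrite big_nil.
case pi: (p i); last by apply: definable_fun_ext ih => e; rewrite big_cons pi.
by apply: definable_fun_ext (definable_funD (dS i) ih) => e; rewrite big_cons pi.
Qed.

Lemma definable_fun_prod I (r : seq I) (p : pred I) (S : I -> (nat -> R) -> R) :
  (forall i, definable_fun (S i)) ->
  definable_fun (fun e => \prod_(i <- r | p i) S i e).
Proof.
move=> dS; elim: r => [|i r ih].
  by apply: definable_fun_ext (definable_fun_cst 1) => e; rewrite big_nil.
case pi: (p i); last by apply: definable_fun_ext ih => e; rewrite big_cons pi.
by apply: definable_fun_ext (definable_funM (dS i) ih) => e; rewrite big_cons pi.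
Qed.

Lemma definable_fun_meval n (p : mpoly.mpoly n R) (S : 'I_n -> (nat -> R) -> R) :
  (forall i, definable_fun (S i)) ->
  definable_fun (fun e => mpoly.meval (fun i => S i e) p).
Proof.
move=> dS.
have dsum := @definable_fun_sum _ (mpoly.msupp p) xpredT
  (fun m e => mpoly.mcoeff m p * \prod_(i < n) S i e ^+ m i).
apply: definable_fun_ext (dsum _); first by move=> e; rewrite mpoly.mevalE.
move=> m; apply: definable_funM; first exact: definable_fun_cst.
by apply: definable_fun_prod => i; exact: definable_funX.
Qed.

Lemma definable_fun_horner2 (p : {poly {poly R}}) S T :
  definable_fun S -> definable_fun T ->
  definable_fun (fun e => p.[(S e)%:P].[T e]).
Proof.
move=> dS dT.
have horner1 (q : {poly R}) : definable_fun (fun e => q.[T e]).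
  have dsum := @definable_fun_sum _ (index_enum 'I_(size q)) xpredT
    (fun i e => q`_i * T e ^+ i).
  apply: definable_fun_ext (dsum _).
    by move=> e; rewrite horner_coef.
  move=> i; apply: definable_funM; first exact: definable_fun_cst.
  exact: definable_funX.
have dsum := @definable_fun_sum _ (index_enum 'I_(size p)) xpredT
    (fun i e => (p`_i).[T e] * S e ^+ i).
apply: definable_fun_ext (dsum _).
  move=> e; rewrite (horner_coef p) horner_sum; apply: eq_bigr => i _.
  by rewrite hornerM -rmorphXn /= hornerC.
by move=> i; apply: definable_funM => //; exact: definable_funX.
Qed.

Definition rvof k n e : 'rV[R]_n := \row_i e (k + i)%N.

Definition setv n e k (y : 'rV[R]_n) : nat -> R := fun j =>
  if insub (j - k)%N is Some i then if (k <= j)%N then y ord0 i else e j else e j.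

Lemma rvof_setv n e k (y : 'rV_n) : rvof k n (setv e k y) = y.
Proof.
apply/rowP => i; rewrite mxE /setv addKn insubT //= => ltin.
by rewrite leq_addr; congr (y _ _); exact/val_inj.
Qed.

Lemma setv_lt n e k (y : 'rV_n) j : (j < k)%N -> setv e k y j = e j.
Proof. by move=> jk; rewrite /setv leqNgt jk /=; case: insub. Qed.

Lemma rvof_setv_lt n m e k (y : 'rV_n) j : (j + m <= k)%N ->
  rvof j m (setv e k y) = rvof j m e.
Proof.
move=> jk; apply/rowP => i; rewrite !mxE setv_lt //.
by apply: leq_trans jk; rewrite ltn_add2l.
Qed.

(** The premise says that [A] ignores the slots [k, ..., k + n - 1] of the valuation; these are
    bound one at a time, so that [n] real quantifiers range over a vector. *)
Lemma definable_ex_rv n k (A : (nat -> R) -> 'rV[R]_n -> Prop) :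
  (forall e y, A (setv e k y) y <-> A e y) ->
  definable (fun e => A e (rvof k n e)) -> definable (fun e => exists y, A e y).
Proof.
move=> Aset dA.
have iter m : definable (fun e => exists y : nat -> R,
    (fun e => A e (rvof k n e)) (fun j => if (k <= j < k + m)%N then y j else e j)).
  elim: m => [|m ih].
    apply: definable_ext dA => e.
    have E (y : nat -> R) : (fun j => if (k <= j < k + 0)%N then y j else e j) = e.
      by apply/funext => j; rewrite addn0; case: leqP => //; lia.
    by split=> [?|[y]]; [exists e; rewrite E|rewrite E].
  have E x y e : (fun j => if (k <= j < k + m)%N then y j else upd e (k + m)%N x j) =
      (fun j => if (k <= j < k + m.+1)%N then upd y (k + m)%N x j else e j).
    apply/funext => j; rewrite /upd addnS ltnS.
    by case: ltngtP => // ->; rewrite ?leq_addr ?andbF ?andbT.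
  apply: definable_ext (definable_ex (k + m)%N ih) => e; split.
    by move=> [x [y Ay]]; exists (upd y (k + m)%N x); rewrite -E.
  move=> [y Ay]; exists (y (k + m)%N), y; rewrite E.
  by rewrite (_ : upd y _ _ = y) //; apply/funext => j; rewrite /upd; case: eqP => // ->.
apply: definable_ext (iter n) => e.
have E y : (fun j => if (k <= j < k + n)%N then y j else e j) =
    setv e k (rvof k n y).
  apply/funext => j; rewrite /setv; case: (leqP k j) => /= [kj|jk]; last by case: insub.
    case: (ltnP j (k + n)) => jkn.
      have h : (j - k < n)%N by lia.
      by rewrite insubT mxE /= subnKC.
    by rewrite insubN //; lia.
split=> [[y]|[y Ay]].
  by rewrite E rvof_setv => /Aset; exists (rvof k n y).
exists (setv e k y); by rewrite E !rvof_setv; apply/Aset.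
Qed.
End Definable.

(** * Quantifier elimination and sign conditions *)

Section SignConditions.
Variable R : realType.

(** The sign of the difference of its two sides decides each atom, and truth values of compound
    formulas follow. *)
Lemma qf_signs (f : ord.formula R) : ord.qf_form f && ord.rformula f ->
  exists ts : seq (GRing.term R), all (@GRing.rterm R) ts /\ forall s s' : seq R,
    all (fun t => Num.sg (GRing.eval s t) == Num.sg (GRing.eval s' t)) ts ->
    ord.qf_eval s f = ord.qf_eval s' f.
Proof.
have atom t1 t2 : GRing.rterm t1 && GRing.rterm t2 ->
    exists ts : seq (GRing.term R), all (@GRing.rterm R) ts /\ forall s s' : seq R,
    all (fun t => Num.sg (GRing.eval s t) == Num.sg (GRing.eval s' t)) ts ->
    Num.sg (GRing.eval s t1 - GRing.eval s t2) =
    Num.sg (GRing.eval s' t1 - GRing.eval s' t2).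
  move=> rt; exists [:: GRing.Add t1 (GRing.Opp t2)]; split; first by rewrite /= rt.
  by move=> s s' /=; rewrite andbT => /eqP.
have both f1 f2 : (ord.qf_form f1 && ord.rformula f1 ->
      exists ts : seq (GRing.term R), all (@GRing.rterm R) ts /\ forall s s' : seq R,
      all (fun t => Num.sg (GRing.eval s t) == Num.sg (GRing.eval s' t)) ts ->
      ord.qf_eval s f1 = ord.qf_eval s' f1) ->
    (ord.qf_form f2 && ord.rformula f2 ->
      exists ts : seq (GRing.term R), all (@GRing.rterm R) ts /\ forall s s' : seq R,
      all (fun t => Num.sg (GRing.eval s t) == Num.sg (GRing.eval s' t)) ts ->
      ord.qf_eval s f2 = ord.qf_eval s' f2) ->
    (ord.qf_form f1 && ord.qf_form f2) && (ord.rformula f1 && ord.rformula f2) ->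
    exists ts : seq (GRing.term R), all (@GRing.rterm R) ts /\ forall s s' : seq R,
    all (fun t => Num.sg (GRing.eval s t) == Num.sg (GRing.eval s' t)) ts ->
    ord.qf_eval s f1 = ord.qf_eval s' f1 /\ ord.qf_eval s f2 = ord.qf_eval s' f2.
  move=> h1 h2 /andP[/andP[q1 q2] /andP[r1 r2]].
  have [|ts1 [rts1 ts1P]] := h1; first by rewrite q1.
  have [|ts2 [rts2 ts2P]] := h2; first by rewrite q2.
  exists (ts1 ++ ts2); split; first by rewrite all_cat rts1.
  by move=> s s'; rewrite all_cat => /andP[/ts1P-> /ts2P->].
elim: f => //=.
- by move=> b _; exists [::].
- move=> t1 t2 /atom[ts [rts tsP]]; exists ts; split=> // s s' /tsP h.
  by rewrite -subr_eq0 -[RHS]subr_eq0 -sgr_eq0 h sgr_eq0.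
- move=> t1 t2 /atom[ts [rts tsP]]; exists ts; split=> // s s' /tsP h.
  by rewrite -subr_lt0 -[RHS]subr_lt0 -sgr_lt0 h sgr_lt0.
- move=> t1 t2 /atom[ts [rts tsP]]; exists ts; split=> // s s' /tsP h.
  by rewrite -subr_le0 -[RHS]subr_le0 -sgr_le0 h sgr_le0.
- by move=> f1 h1 f2 h2 /(both _ _ h1 h2)[ts [rts tsP]];
    exists ts; split=> // s s' /tsP[-> ->].
- by move=> f1 h1 f2 h2 /(both _ _ h1 h2)[ts [rts tsP]];
    exists ts; split=> // s s' /tsP[-> ->].
- by move=> f1 h1 f2 h2 /(both _ _ h1 h2)[ts [rts tsP]];
    exists ts; split=> // s s' /tsP[-> ->].
- by move=> f1 h1 /h1[ts [rts tsP]]; exists ts; split=> // s s' /tsP->.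
Qed.

Lemma definable_signs (P : (nat -> R) -> Prop) : definable P ->
  exists ts : seq (GRing.term R), all (@GRing.rterm R) ts /\ forall s s' : seq R,
    all (fun t => Num.sg (GRing.eval s t) == Num.sg (GRing.eval s' t)) ts ->
    P (nth 0 s) <-> P (nth 0 s').
Proof.
move=> [f fP].
pose g := ord.quantifier_elim (fun i s => qe_rcf.qfr_to_formula (@qe_rcf.wproj R i s)) (ord.to_rform f).
have [|ts [rts tsP]] := @qf_signs g.
  by apply: ord.quantifier_elim_wf; [exact: qe_rcf.wf_QE_wproj|exact: ord.to_rform_rformula].
exists ts; split=> // s s' /tsP E.
have gP u : P (nth 0 u) <-> ord.qf_eval u g.
  by rewrite fP; split=> /qe_rcf.rcf_satP.
by rewrite !gP E.
Qed.

Lemma eval_horner (t : GRing.term R) : GRing.rterm t ->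
  exists p : {poly R}, forall x, GRing.eval [:: x] t = p.[x].
Proof.
elim: t => //=.
- move=> [|i] _; first by exists 'X => x; rewrite hornerX.
  by exists 0 => x; rewrite horner0 /= nth_nil.
- by move=> c _; exists c%:P => x; rewrite hornerC.
- by move=> n _; exists n%:R => x; rewrite -polyC_natr hornerC.
- move=> t1 h1 t2 h2 /andP[/h1[p1 p1P] /h2[p2 p2P]].
  by exists (p1 + p2) => x; rewrite hornerD p1P p2P.
- by move=> t1 h1 /h1[p1 p1P]; exists (- p1) => x; rewrite hornerN p1P.
- by move=> t1 h1 n /h1[p1 p1P]; exists (p1 *+ n) => x; rewrite hornerMn p1P.
- move=> t1 h1 t2 h2 /andP[/h1[p1 p1P] /h2[p2 p2P]].
  by exists (p1 * p2) => x; rewrite hornerM p1P p2P.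
- by move=> t1 h1 n /h1[p1 p1P]; exists (p1 ^+ n) => x; rewrite horner_exp p1P.
Qed.

(** The convention for two variables: in [p.[y%:P].[x]] the outer variable of [p] takes the value
    [y] and its coefficients are polynomials in [x]. Variables beyond the list evaluate to 0. *)
Lemma eval_horner2 (t : GRing.term R) : GRing.rterm t ->
  exists p : {poly {poly R}}, forall x y, GRing.eval [:: x; y] t = p.[y%:P].[x].
Proof.
elim: t => //=.
- move=> [|[|i]] _; first by exists 'X%:P => x y; rewrite hornerC hornerX.
    by exists 'X => x y; rewrite hornerX hornerC.
  by exists 0 => x y; rewrite !horner0 /= nth_nil.
- by move=> c _; exists c%:P%:P => x y; rewrite !hornerC.
- by move=> n _; exists n%:R => x y; rewrite -!polyC_natr !hornerC.
- move=> t1 h1 t2 h2 /andP[/h1[p1 p1P] /h2[p2 p2P]].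
  by exists (p1 + p2) => x y; rewrite !hornerD p1P p2P.
- by move=> t1 h1 /h1[p1 p1P]; exists (- p1) => x y; rewrite !hornerN p1P.
- by move=> t1 h1 n /h1[p1 p1P]; exists (p1 *+ n) => x y; rewrite !hornerMn p1P.
- move=> t1 h1 t2 h2 /andP[/h1[p1 p1P] /h2[p2 p2P]].
  by exists (p1 * p2) => x y; rewrite !hornerM p1P p2P.
- by move=> t1 h1 n /h1[p1 p1P]; exists (p1 ^+ n) => x y; rewrite !horner_exp p1P.
Qed.

Lemma sgr_near (p : {poly R}) x : p.[x] != 0 ->
  exists2 d, 0 < d & forall y, `|y - x| < d -> Num.sg p.[y] = Num.sg p.[x].
Proof.
move=> px; have [|d d0 dP] := @polyrcf.poly_cont R x p `|p.[x]|.
  by rewrite normr_gt0.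
exists d => // y /dP h.
have [p0|p0|p0] := ltrgt0P p.[x]; last by rewrite p0 eqxx in px.
  move: h; rewrite (gtr0_sg p0) (gtr0_norm p0) ltr_norml => /andP[h _].
  by rewrite gtr0_sg //; lra.
move: h; rewrite (ltr0_sg p0) (ltr0_norm p0) ltr_norml => /andP[_ h].
by rewrite ltr0_sg //; lra.
Qed.

(** Finitely many polynomials decide [P], and the nonzero ones have no root just to the right of
    0. *)
Lemma definable_eventually (P : R -> Prop) : definable (fun e => P (e 0%N)) ->
  exists2 d, 0 < d & (forall t, 0 < t < d -> P t) \/ (forall t, 0 < t < d -> ~ P t).
Proof.
move=> /definable_signs[ts [rts tsP]].
have [d d0 dP] : exists2 d : R, 0 < d & forall x y, 0 < x < d -> 0 < y < d ->
    all (fun t => Num.sg (GRing.eval [:: x] t) == Num.sg (GRing.eval [:: y] t)) ts.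
  elim: ts rts {tsP} => [_|t ts ih /= /andP[/eval_horner[p pP] /ih[d d0 dP]]].
    by exists 1.
  have [p0|p0] := eqVneq p 0.
    by exists d => // x y xd yd; rewrite !pP p0 !horner0 eqxx /= dP.
  exists (Num.min d (polyrcf.next_root p 0 1)).
    by rewrite lt_min d0 polyrcf.next_root_gt.
  move=> x y; rewrite !lt_min => /and3P[x0 xd xr] /and3P[y0 yd yr].
  rewrite dP ?x0 ?y0 // andbT !pP; apply/eqP.
  by apply: (@polyrcf.sgr_neighpr_same R p 0 1); rewrite in_itv /= ?x0 ?y0.
have d2 : 0 < d / 2 < d by lra.
exists d => //; have [Pd|Pd] := pselect (P (d / 2)); [left|right] => t td.
  exact: (tsP [:: d / 2] [:: t] (dP _ _ d2 td)).1 Pd.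
by move=> Pt; exact/Pd/(tsP [:: d / 2] [:: t] (dP _ _ d2 td)).2.
Qed.

Lemma definable_locally_constant (P : R -> Prop) : definable (fun e => P (e 0%N)) ->
  exists F : seq R, forall t, t \notin F ->
    exists2 d, 0 < d & forall t', `|t' - t| < d -> (P t' <-> P t).
Proof.
move=> /definable_signs[ts [rts tsP]].
have [F FP] : exists F : seq R, forall t, t \notin F ->
    exists2 d, 0 < d & forall t', `|t' - t| < d ->
    all (fun u => Num.sg (GRing.eval [:: t'] u) == Num.sg (GRing.eval [:: t] u)) ts.
  elim: ts rts {tsP} => [_|t ts ih /= /andP[/eval_horner[p pP] /ih[F FP]]].
    by exists [::] => t _; exists 1.
  have [p0|p0] := eqVneq p 0.
    exists F => x /FP[d d0 dP]; exists d => // y yd.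
    by rewrite !pP p0 !horner0 eqxx /= dP.
  exists (polyrcf.rootsR p ++ F) => x; rewrite mem_cat negb_or => /andP[xp /FP[d d0 dP]].
  have [|d' d'0 d'P] := @sgr_near p x.
    by apply: contra xp => px; rewrite -(polyrcf.roots_on_rootsR p0 x) in_itv.
  exists (Num.min d d'); first by rewrite lt_min d0.
  by move=> y; rewrite lt_min => /andP[/dP-> /d'P]; rewrite !pP => ->; rewrite eqxx.
exists F => t /FP[d d0 dP]; exists d => // t' /dP; exact: tsP.
Qed.

(** [p] is the product of the nonzero polynomials whose signs decide [P]; off its zeros these signs
    are stable under small changes of [s]. *)
Lemma definable_boundary (P : R -> R -> Prop) : definable (fun e => P (e 0%N) (e 1%N)) ->
  exists2 p : {poly {poly R}}, p != 0 & forall t s, p.[s%:P].[t] != 0 ->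
    exists2 d, 0 < d & forall s', `|s' - s| < d -> (P t s' <-> P t s).
Proof.
move=> /definable_signs[ts [rts tsP]].
have [p p0 pP] : exists2 p : {poly {poly R}}, p != 0 & forall t s, p.[s%:P].[t] != 0 ->
    exists2 d, 0 < d & forall s', `|s' - s| < d ->
    all (fun u => Num.sg (GRing.eval [:: t; s'] u) == Num.sg (GRing.eval [:: t; s] u)) ts.
  elim: ts rts {tsP} => [_|t ts ih /= /andP[/eval_horner2[p pP] /ih[q q0 qP]]].
    by exists 1; rewrite ?oner_eq0 // => t s _; exists 1.
  have [p0|p0] := eqVneq p 0.
    exists q => // x s /qP[d d0 dP]; exists d => // y yd.
    by rewrite !pP p0 !horner0 eqxx /= dP.
  exists (p * q); first by rewrite mulf_neq0.
  move=> x s; rewrite !hornerM mulf_eq0 negb_or => /andP[ps /qP[d d0 dP]].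
  have E z : p.[z%:P].[x] = (map_poly (horner_eval x) p).[z].
    by rewrite -[z in RHS](hornerC z x) -[_.[x]]/(horner_eval x _) horner_map.
  have [|d' d'0 d'P] := @sgr_near (map_poly (horner_eval x) p) s; first by rewrite -E.
  exists (Num.min d d'); first by rewrite lt_min d0.
  by move=> y; rewrite lt_min => /andP[/dP-> /d'P]; rewrite !pP !E => ->; rewrite eqxx.
exists p => // t s /pP[d d0 dP]; exists d => // s' /dP; exact: tsP.
Qed.

End SignConditions.

(** * Definable functions of one variable: continuity and algebraicity *)

Section OneVariable.
Variable R : realType.
Implicit Types (xi : R -> R).

Lemma definable_graph_at (G : R -> R -> Prop) i j :
  definable (fun e => G (e 0%N) (e 1%N)) -> definable (fun e => G (e i) (e j)).
Proof.
(* The relation is first moved to slots beyond 0, 1, [i] and [j]; a direct renaming would capture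
   variables when [i] or [j] is 0 or 1. *)
pose k := (maxn i j).+2 => dG.
have d2 : definable (fun e : nat -> R => G (e k) (e k.+1)).
  apply: (definable_ext (P := qex 0 (fun e => e 0%N = e k /\
      qex 1 (fun e => e 1%N = e k.+1 /\ G (e 0%N) (e 1%N)) e))).
    move=> e; rewrite /qex /upd /=; split; first by move=> [x [-> [y [-> //]]]].
    by move=> Gk; exists (e k); split=> //; exists (e k.+1).
  apply/definable_ex/definable_and.
    by apply: definable_eq; exact: definable_fun_var.
  apply/definable_ex/definable_and => //.
  by apply: definable_eq; exact: definable_fun_var.
apply: (definable_ext (P := qex k (fun e => e k = e i /\
      qex k.+1 (fun e => e k.+1 = e j /\ G (e k) (e k.+1)) e))).
  move=> e; have ik : (i == k) = false by rewrite /k; lia.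
  have jk : (j == k) = false by rewrite /k; lia.
  have ik1 : (i == k.+1) = false by rewrite /k; lia.
  have jk1 : (j == k.+1) = false by rewrite /k; lia.
  have kk1 : (k == k.+1) = false by lia.
  rewrite /qex /upd eqxx ik; split.
    by move=> [x [-> [y []]]]; rewrite !eqxx jk jk1 kk1 => ->.
  by move=> Gk; exists (e i); split=> //; exists (e j); rewrite !eqxx jk jk1 kk1.
apply/definable_ex/definable_and.
  by apply: definable_eq; exact: definable_fun_var.
apply/definable_ex/definable_and => //.
by apply: definable_eq; exact: definable_fun_var.
Qed.

Definition definable1 xi := definable (fun e => e 1%N = xi (e 0%N)).

Lemma definable1_rel xi (P : R -> R -> Prop) : definable1 xi ->
  definable (fun e => P (e 0%N) (e 1%N)) -> definable (fun e => P (e 0%N) (xi (e 0%N))).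
Proof.
move=> dxi dP.
apply: (definable_ext (P := qex 1 (fun e => e 1%N = xi (e 0%N) /\ P (e 0%N) (e 1%N)))).
  move=> e; rewrite /qex /upd /=; split; first by move=> [y [->]].
  by move=> Pe; exists (xi (e 0%N)).
exact/definable_ex/definable_and.
Qed.

Definition cont_at xi t := forall e, 0 < e ->
  exists2 d, 0 < d & forall t', `|t' - t| < d -> `|xi t' - xi t| < e.

Lemma definable_cont_at xi : definable1 xi -> definable (fun e => cont_at xi (e 0%N)).
Proof.
move=> dxi; pose V i := @definable_fun_var R i.
apply: (definable_ext (P := qall 1 (fun e => 0 < e 1%N ->
   qex 2 (fun e => 0 < e 2%N /\ qall 3 (fun e =>
     (e 3%N - e 0%N < e 2%N /\ e 0%N - e 3%N < e 2%N) ->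
     qall 4 (fun e => e 4%N = xi (e 0%N) -> qall 5 (fun e => e 5%N = xi (e 3%N) ->
     (e 5%N - e 4%N < e 1%N /\ e 4%N - e 5%N < e 1%N)) e) e) e) e))).
  move=> e; rewrite /qall /qex /upd /=; split=> h x x0.
    have [d [d0 dP]] := h x x0; exists d => // t'; rewrite ltr_norml => /andP[h1 h2].
    have tt : t' - e 0%N < d /\ e 0%N - t' < d by split; lra.
    have [h3 h4] := dP t' tt (xi (e 0%N)) erefl (xi t') erefl.
    by rewrite ltr_norml; lra.
  have [d d0 dP] := h x x0; exists d; split=> // u [u1 u2] v -> w ->.
  have /dP : `|u - e 0%N| < d by rewrite ltr_norml; lra.
  by rewrite ltr_norml => /andP[h1 h2]; split; lra.
apply/definable_all/definable_imp.
  by apply: definable_lt => //; exact: definable_fun_cst.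
apply/definable_ex/definable_and.
  by apply: definable_lt => //; exact: definable_fun_cst.
apply/definable_all/definable_imp.
  by apply: definable_and; apply: definable_lt => //; exact: definable_funB.
apply/definable_all/definable_imp.
  exact: (definable_graph_at (G := fun x y => y = xi x) 0 4 dxi).
apply/definable_all/definable_imp.
  exact: (definable_graph_at (G := fun x y => y = xi x) 3 5 dxi).
by apply: definable_and; apply: definable_lt => //; exact: definable_funB.
Qed.

(* A discontinuity is a boundary point of some [xi > q] or [xi < q] with [q]
   rational, so there are only countably many of them. *)
Lemma definable_continuous xi : definable1 xi ->
  exists2 d, 0 < d & forall t, 0 < t < d -> cont_at xi t.
Proof.
(* In the remaining case every point of [(0, d)] is a discontinuity. The interval is then contained
   in the countable set [bad], against its positive Lebesgue measure. *)
move=> dxi; have [d d0 [|ncont]] := definable_eventually (definable_cont_at dxi); first by exists d.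
have gtF (q : rat) : exists F : seq R, forall t, t \notin F ->
    exists2 d, 0 < d & forall t', `|t' - t| < d -> (ratr q < xi t' <-> ratr q < xi t).
  apply: (definable_locally_constant (P := fun t => ratr q < xi t)).
  apply: (definable1_rel (P := fun t s => ratr q < s)) => //.
  by apply: definable_lt; [exact: definable_fun_cst|exact: definable_fun_var].
have ltF (q : rat) : exists F : seq R, forall t, t \notin F ->
    exists2 d, 0 < d & forall t', `|t' - t| < d -> (xi t' < ratr q <-> xi t < ratr q).
  apply: (definable_locally_constant (P := fun t => xi t < ratr q)).
  apply: (definable1_rel (P := fun t s => s < ratr q)) => //.
  by apply: definable_lt; [exact: definable_fun_var|exact: definable_fun_cst].
have [F FP] := choice gtF; have [G GP] := choice ltF.
pose bad := \bigcup_(q in [set: rat]) ([set` F q] `|` [set` G q]).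
have bad_count : countable bad.
  apply: bigcup_countable => // q _; apply/finite_set_countable.
  by rewrite finite_setU.
have sub : `]0, d[%classic `<=` bad.
  move=> t td; apply: contrapT => nbad.
  have {nbad} nF q : t \notin F q /\ t \notin G q.
    by split; apply/negP => tq; apply: nbad; exists q => //; [left|right].
  apply: (ncont t); first by move: td; rewrite /= in_itv.
  move=> e e0.
  have xie : xi t - e < xi t < xi t + e by lra.
  have /andP[xie1 xie2] := xie; have [q1] := rat_in_itvoo xie1.
  rewrite in_itv /= => /andP[q1l q1r].
  have [q2] := rat_in_itvoo xie2.
  rewrite in_itv /= => /andP[q2l q2r].
  have [d1 d10 d1P] := FP q1 t (nF q1).1; have [d2 d20 d2P] := GP q2 t (nF q2).2.
  exists (Num.min d1 d2); first by rewrite lt_min d10.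
  move=> t'; rewrite lt_min => /andP[/d1P[_ /(_ q1r) h1] /d2P[_ /(_ q2l) h2]].
  by rewrite ltr_norml; lra.
have := countable_lebesgue_measure0 (sub_countable (subset_card_le sub) bad_count).
by rewrite lebesgue_measure_itv /= lte_fin d0 -EFinD => -[]; lra.
Qed.

(** For fixed [t] the truth of [s = xi t] is not locally constant at [s = xi t], so the polynomial
    of [definable_boundary] vanishes there. *)
Lemma definable_annihilator xi : definable1 xi ->
  exists2 p : {poly {poly R}}, p != 0 & forall t, p.[(xi t)%:P].[t] = 0.
Proof.
move=> /(definable_boundary (P := fun t s => s = xi t))[p p0 pP].
exists p => // t; apply/eqP; apply: contrapT => /negP /pP[d d0 dP].
have /dP[_] : `|xi t + d / 2 - xi t| < d.
  by rewrite addrAC subrr add0r gtr0_norm; lra.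
by move=> /(_ erefl); lra.
Qed.

Lemma poly_eq0_near0 (p : {poly R}) d : 0 < d -> (forall t, 0 < t < d -> p.[t] = 0) -> p = 0.
Proof.
move=> d0 p0; apply/eqP; apply: contrapT => /negP pn0.
have [t td] := polyrcf.neighpr_wit d0 pn0.
have := polyrcf.neighpr_root td; rewrite /root p0 ?eqxx //.
move: td; rewrite /polyrcf.neighpr in_itv /= => /andP[-> h].
have := polyrcf.next_root_in p 0 d; rewrite in_itv /= (max_l (ltW d0)) => /andP[_].
exact: lt_le_trans h.
Qed.

(** An annihilator of least degree in [s] works, up to shrinking the interval: were its derivative
    zero along [xi] near 0, it would be an annihilator of smaller degree. *)
Lemma definable_simple_root xi : definable1 xi ->
  exists (p : {poly {poly R}}) (d : R), 0 < d /\ forall t, 0 < t < d ->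
    p.[(xi t)%:P].[t] = 0 /\ p^`().[(xi t)%:P].[t] != 0.
Proof.
move=> dxi; have [p0 p0n0 p0P] := definable_annihilator dxi.
suff H n (p : {poly {poly R}}) d : (size p < n)%N -> p != 0 -> 0 < d ->
    (forall t, 0 < t < d -> p.[(xi t)%:P].[t] = 0) ->
    exists (p : {poly {poly R}}) (d : R), 0 < d /\ forall t, 0 < t < d ->
    p.[(xi t)%:P].[t] = 0 /\ p^`().[(xi t)%:P].[t] != 0.
  exact: (H (size p0).+1 p0 1).
elim: n => // n ih in p d * => sp pn0 d0 pP.
have sp2 : (1 < size p)%N.
  rewrite ltnNge; apply: contra pn0 => /size1_polyC pE; rewrite pE.
  rewrite (@poly_eq0_near0 p`_0 d) // => t /pP.
  by rewrite pE hornerC coefC.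
have dp0 : p^`() != 0.
  apply: contraNneq pn0 => dp0; rewrite -lead_coef_eq0 lead_coefE.
  have := congr1 (fun q : {poly {poly R}} => q`_(size p).-2) dp0.
  rewrite coef_deriv coef0; case: (size p) sp2 => [|[|m]] //= _ /eqP.
  by rewrite -mulr_natr mulf_eq0 -polyC_natr polyC_eq0 pnatr_eq0 orbF.
have dev : definable (fun e : nat -> R => p^`().[(xi (e 0%N))%:P].[e 0%N] = 0).
  apply: (definable1_rel (P := fun t s => p^`().[s%:P].[t] = 0)) => //.
  apply: definable_eq; last exact: definable_fun_cst.
  by apply: definable_fun_horner2; exact: definable_fun_var.
have [d' d'0 [h|h]] := definable_eventually (P := fun t => p^`().[(xi t)%:P].[t] = 0) dev.
  by apply: (ih p^`() d') => //; rewrite (leq_trans (lt_size_deriv pn0)).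
exists p, (Num.min d d'); split; first by rewrite lt_min d0.
move=> t /andP[t0]; rewrite lt_min => /andP[td td'].
by split; [apply: pP; rewrite t0|apply/eqP/h; rewrite t0].
Qed.
End OneVariable.

(** * Derivative of a simple root *)

Section Curves.
Variable R : realType.

Lemma poly_taylor (p : {poly R}) t : exists2 C, 0 <= C & forall h, `|h| <= 1 ->
  `|p.[t + h] - p.[t] - h * p^`().[t]| <= C * h ^+ 2.
Proof.
elim/poly_ind: p => [|p c [C C0 IH]].
  by exists 0 => // h _; rewrite deriv0 !horner0 mulr0 !subr0 normr0 mul0r.
exists (`|t| * C + `|p^`().[t]| + C); first by rewrite !addr_ge0 ?mulr_ge0.
move=> h h1; rewrite derivD derivM derivX derivC addr0 mulr1 !(hornerD, hornerM, hornerX, hornerC).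
have {IH} := IH h h1; set E := (X in `|X|) => EC.
have -> : p.[t + h] * (t + h) + c - (p.[t] * t + c) - h * (p^`().[t] * t + p.[t]) =
  t * E + h ^+ 2 * p^`().[t] + h * E by rewrite /E; ring.
have b1 : `|t * E| <= `|t| * C * h ^+ 2 by rewrite normrM -mulrA ler_wpM2l.
have b2 : `|h ^+ 2 * p^`().[t]| = `|p^`().[t]| * h ^+ 2.
  by rewrite normrM normrX real_normK ?num_real // mulrC.
have b3 : `|h * E| <= C * h ^+ 2 by rewrite normrM -[leRHS]mul1r ler_pM.
have := ler_normD (t * E + h ^+ 2 * p^`().[t]) (h * E).
have := ler_normD (t * E) (h ^+ 2 * p^`().[t]).
by move=> *; lra.
Qed.

Lemma poly2_taylor (p : {poly {poly R}}) t y : exists2 C, 0 <= C & forall h k,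
  `|h| <= 1 -> `|k| <= 1 ->
  `|p.[(y + k)%:P].[t + h] - p.[y%:P].[t] - h * (p.[y%:P])^`().[t]
    - k * p^`().[y%:P].[t]| <= C * (h ^+ 2 + k ^+ 2).
Proof.
elim/poly_ind: p => [|p c [C C0 IH]].
  exists 0 => // h k _ _; rewrite deriv0 !horner0 deriv0 !horner0 !mulr0 !subr0.
  by rewrite normr0 mul0r.
have [Cc Cc0 cP] := poly_taylor c t.
exists (`|y| * C + (`|(p.[y%:P])^`().[t]| + `|p^`().[y%:P].[t]|) + C + Cc).
  by rewrite !addr_ge0 ?mulr_ge0.
move=> h k h1 k1; rewrite derivD derivM derivX derivC addr0 mulr1 !(hornerD, hornerM, hornerX, hornerC).
rewrite derivD derivM derivC mulr0 addr0 !(hornerD, hornerM, hornerC).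
have {IH} := IH h k h1 k1; set E := (X in `|X|) => EC.
have {cP} := cP h h1; set F := (X in `|X|) => FC.
have -> : p.[(y + k)%:P].[t + h] * (y + k) + c.[t + h] - (p.[y%:P].[t] * y + c.[t]) -
    h * ((p.[y%:P])^`().[t] * y + c^`().[t]) -
    k * (p^`().[y%:P].[t] * y + p.[y%:P].[t]) =
   y * E + ((k * h) * (p.[y%:P])^`().[t] + k ^+ 2 * p^`().[y%:P].[t]) + k * E + F.
  by rewrite /E /F; ring.
have h20 : 0 <= h ^+ 2 := sqr_ge0 h.
have k20 : 0 <= k ^+ 2 := sqr_ge0 k.
set N := h ^+ 2 + k ^+ 2.
have kh : `|k * h| <= N by rewrite ler_norml /N; nra.
have b1 : `|y * E| <= `|y| * C * N by rewrite normrM -mulrA ler_wpM2l.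
have b2 : `|k * E| <= C * N by rewrite normrM -[leRHS]mul1r ler_pM.
have b3 : `|F| <= Cc * N by apply: le_trans FC _; rewrite ler_wpM2l // lerDl.
have b4 : `|k * h * (p.[y%:P])^`().[t]| <= `|(p.[y%:P])^`().[t]| * N.
  by rewrite normrM mulrC ler_wpM2l.
have b5 : `|k ^+ 2 * p^`().[y%:P].[t]| <= `|p^`().[y%:P].[t]| * N.
  by rewrite normrM mulrC ler_wpM2l // ger0_norm // lerDr.
have := ler_normD (y * E + (k * h * (p.[y%:P])^`().[t] + k ^+ 2 * p^`().[y%:P].[t])
  + k * E) F.
have := ler_normD (y * E + (k * h * (p.[y%:P])^`().[t] + k ^+ 2 * p^`().[y%:P].[t]))
  (k * E).
have := ler_normD (y * E) (k * h * (p.[y%:P])^`().[t] + k ^+ 2 * p^`().[y%:P].[t]).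
have := ler_normD (k * h * (p.[y%:P])^`().[t]) (k ^+ 2 * p^`().[y%:P].[t]).
by move=> *; lra.
Qed.

Lemma is_derive_eps (xi : R -> R) t D :
  (forall e, 0 < e -> exists2 d, 0 < d & forall h, `|h| < d ->
    `|xi (t + h) - xi t - D * h| <= e * `|h|) -> is_derive t 1 xi D.
Proof.
move=> H.
have : (fun h => h^-1 *: ((xi \o shift t) (h *: (1 : R)) - xi t)) @ 0^' --> D.
  apply/cvgrPdist_le => e e0; have [d d0 dP] := H e e0.
  near=> h.
  have h0 : h != 0 by near: h; exact: nbhs_dnbhs_neq.
  have /dP : `|h| < d.
    near: h; apply: dnbhs0_lt.
    exact: d0.
  rewrite /= [h *: 1]mulr1 (addrC h) => hd.
  rewrite -(ler_pM2l (_ : 0 < `|h|)) ?normr_gt0 // -normrM mulrC [leRHS]mulrC.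
  apply: le_trans hd; rewrite -normrN le_eqVlt; apply/predU1P; left; congr (`|_|).
  by rewrite /GRing.scale /=; field.
move=> cD; apply: DeriveDef; [apply/cvg_ex; exists D => //|exact: cvg_lim].
Unshelve. all: by end_near.
Qed.

(** Implicit differentiation: [xi] is already known to be continuous at [t], so only the quadratic
    Taylor remainder of [p] has to be controlled. *)
Lemma simple_root_derive (p : {poly {poly R}}) (xi : R -> R) a b t : a < t < b ->
  (forall u, a < u < b -> p.[(xi u)%:P].[u] = 0) -> p^`().[(xi t)%:P].[t] != 0 ->
  cont_at xi t ->
  is_derive t 1 xi (- (p.[(xi t)%:P])^`().[t] / p^`().[(xi t)%:P].[t]).
Proof.
move=> tab p0 ps cxi; apply: is_derive_eps => e e0.
have [C C0 CP] := poly2_taylor p t (xi t).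
set A := (p.[(xi t)%:P])^`().[t] in CP *.
set B := p^`().[(xi t)%:P].[t] in CP ps *.
have B0 : 0 < `|B| by rewrite normr_gt0.
(* For [|k| < c] half of [|B| |k|] absorbs the quadratic term in [k], which leaves [|k| <= K |h|];
   [d2] then makes the remainder at most [e |h| |B|]. *)
pose K := 2 * (`|A| + C) / `|B|.
have K0 : 0 <= K by rewrite divr_ge0 // mulr_ge0 // addr_ge0.
pose c := Num.min 1 (`|B| / (2 * (C + 1))).
have [d1 d10 d1P] : exists2 d, 0 < d & forall t', `|t' - t| < d -> `|xi t' - xi t| < c.
  by apply: cxi; rewrite lt_min ltr01 divr_gt0 // mulr_gt0 //; lra.
pose d2 := e * `|B| / ((C + 1) * (1 + K ^+ 2)).
have C1 : 0 < C + 1 by lra.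
have K1 : 0 < 1 + K ^+ 2 by have := sqr_ge0 K; lra.
have M0 : 0 < (C + 1) * (1 + K ^+ 2) by rewrite mulr_gt0.
have d20 : 0 < d2 by rewrite divr_gt0 // mulr_gt0.
exists (Num.min (Num.min 1 d1) (Num.min d2 (Num.min (t - a) (b - t)))).
  by rewrite !lt_min ltr01 d10 d20 /=; lra.
move=> h; rewrite !lt_min => /andP[/andP[h1 hd1]] /andP[hd2] /andP[hta htb].
set k := xi (t + h) - xi t.
have kc : `|k| < c by apply: d1P; rewrite addrAC subrr add0r.
have tk : xi (t + h) = xi t + k by rewrite /k; ring.
have := CP h k (ltW h1).
rewrite -tk p0; last by move: hta htb; rewrite !ltr_norml; lra.
rewrite p0 // subr0 sub0r.
have k1 : `|k| <= 1 by rewrite (le_trans (ltW kc)) // ge_min lexx.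
move=> /(_ k1); set E := (X in `|X|) => EC.
have Ckk : C * k ^+ 2 <= `|k| * `|B| / 2.
  have h3 : `|k| * (2 * (C + 1)) <= `|B|.
    by rewrite -ler_pdivlMr ?(le_trans (ltW kc)) ?ge_min ?lexx ?orbT //; lra.
  rewrite -real_normK ?num_real //.
  have := normr_ge0 k; set q := `|k| in h3 *; set r := `|B| in h3 *; nra.
have kB : `|k| * `|B| <= `|h| * `|A| + `|E|.
  rewrite -normrM -normrM -[k * B]opprK normrN.
  rewrite (_ : - (k * B) = h * A + E); last by rewrite /E; ring.
  exact: ler_normD.
have hh : h ^+ 2 <= `|h|.
  rewrite -real_normK ?num_real //; have := normr_ge0 h; set q := `|h| in h1 *; nra.
have kK : `|k| <= K * `|h|.
  rewrite /K mulrAC ler_pdivlMr //.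
  have : C * h ^+ 2 <= C * `|h| by rewrite ler_wpM2l.
  by rewrite mulrDr in EC; lra.
have k2 : k ^+ 2 <= K ^+ 2 * h ^+ 2.
  rewrite -(real_normK (num_real k)) -(real_normK (num_real h)) -exprMn.
  by rewrite ler_sqr // nnegrE mulr_ge0.
have -> : k - - A / B * h = - E / B by rewrite /E; field.
rewrite normrM normrN normfV ler_pdivrMr //.
have h2 : h ^+ 2 * ((C + 1) * (1 + K ^+ 2)) <= e * `|h| * `|B|.
  have hM : `|h| * ((C + 1) * (1 + K ^+ 2)) <= e * `|B| by rewrite -ler_pdivlMr // ltW.
  by have := ler_wpM2l (normr_ge0 h) hM; rewrite -(real_normK (num_real h)) => *; lra.
apply: le_trans EC _; apply: le_trans h2.
have : 0 <= h ^+ 2 := sqr_ge0 h.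
have : C * k ^+ 2 <= C * (K ^+ 2 * h ^+ 2) by rewrite ler_wpM2l.
have : 0 <= K ^+ 2 * h ^+ 2 by rewrite mulr_ge0 ?sqr_ge0.
move=> *; lra.
Qed.

End Curves.

(** * Curve selection with monotone coordinates *)

Section CurveSelection.
Variable R : realType.

Lemma definable1_derive (xi : R -> R) : definable1 xi ->
  exists (D : R -> R) (d s : R), [/\ 0 < d, s = 1 \/ s = -1 &
    forall t, 0 < t < d -> is_derive t 1 xi (D t) /\ 0 <= s * D t].
Proof.
move=> dxi; have [p [d1 [d10 pP]]] := definable_simple_root dxi.
have [d2 d20 cxi] := definable_continuous dxi.
pose q := map_poly deriv p.
have qE y t : q.[y%:P].[t] = (p.[y%:P])^`().[t].
  congr (_.[t]); rewrite /q; elim/poly_ind: (p) => [|r c IH].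
    by rewrite map_poly0 horner0 deriv0.
  rewrite raddfD /= map_polyC /= !hornerD !hornerC derivD; congr (_ + _).
  rewrite !hornerM !hornerX derivM derivC mulr0 addr0 -IH.
  rewrite (_ : map_poly deriv (r * 'X) = map_poly deriv r * 'X) ?hornerM ?hornerX //.
  by apply/polyP => -[|i]; rewrite coef_map /= !coefMX /= ?deriv0 // coef_map.
pose D t := - q.[(xi t)%:P].[t] / p^`().[(xi t)%:P].[t].
(* Multiplying by the square of the denominator turns the sign of the quotient [D t] into a
   polynomial condition, which is definable and so of constant truth near 0. *)
have sgD t : 0 < t < d1 -> (0 <= D t) = (q.[(xi t)%:P].[t] * p^`().[(xi t)%:P].[t] <= 0).
  move=> /pP[_ p'0]; rewrite /D.
  rewrite -(pmulr_lge0 _ (_ : 0 < p^`().[(xi t)%:P].[t] ^+ 2)) ?exprn_even_gt0 //.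
  by rewrite expr2 mulrA mulfVK // mulNr oppr_ge0.
have dsg : definable (fun e : nat -> R =>
    q.[(xi (e 0%N))%:P].[e 0%N] * p^`().[(xi (e 0%N))%:P].[e 0%N] <= 0).
  apply: (definable1_rel (P := fun t s => q.[s%:P].[t] * p^`().[s%:P].[t] <= 0)) => //.
  apply: definable_le; last exact: definable_fun_cst.
  by apply: definable_funM; apply: definable_fun_horner2; exact: definable_fun_var.
have [d3 d30 d3P] := definable_eventually
  (P := fun t => q.[(xi t)%:P].[t] * p^`().[(xi t)%:P].[t] <= 0) dsg.
have dD t : 0 < t < Num.min d1 d2 -> is_derive t 1 xi (D t).
  rewrite lt_min => /and3P[t0 td1 td2]; rewrite /D qE.
  apply: (@simple_root_derive _ _ _ 0 d1); rewrite ?t0 //.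
  - by move=> u /pP[].
  - by apply: (pP t _).2; rewrite t0.
  - by apply: cxi; rewrite t0.
exists D, (Num.min (Num.min d1 d2) d3), (if `[< forall t, 0 < t < d3 ->
  q.[(xi t)%:P].[t] * p^`().[(xi t)%:P].[t] <= 0 >] then 1 else -1); split.
- by rewrite !lt_min d10 d20.
- by case: ifP; [left|right].
move=> t; rewrite lt_min => /and3P[t0 td12 td3]; split; first by apply: dD; rewrite t0.
have t1 : 0 < t < d1 by move: td12; rewrite lt_min t0 => /andP[].
case: asboolP => [h|nh]; first by rewrite mul1r sgD // h // t0.
have {d3P} [//|h] := d3P; have /h : 0 < t < d3 by rewrite t0.
by move=> /negP; rewrite -sgD // -ltNge mulN1r oppr_ge0 => /ltW.
Qed.

Lemma compact_min n (A : set 'rV[R]_n) (f : 'rV[R]_n -> R) :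
  A !=set0 -> compact A -> continuous f -> exists2 c, A c & forall x, A x -> f c <= f x.
Proof.
move=> A0 cA cf; have [c Ac cmin] := EVT_min_rV A0 cA (continuous_subspaceT cf).
by exists c => [|x Ax]; [exact: set_mem|apply/cmin/mem_set].
Qed.

Section Lexicographic.
Variables (n : nat) (S : R -> set 'rV[R]_n).

(** A definable choice of a point of [S t]: the coordinates are minimised one after the other, and
    stage [n] is the lexicographic minimum. Stages beyond [n] change nothing. *)
Fixpoint lexmin k t : set 'rV[R]_n :=
  if k is k'.+1 then
    if insub k' is Some i then
      [set x | lexmin k' t x /\ forall y, lexmin k' t y -> x ord0 i <= y ord0 i]
    else lexmin k' t
  else S t.

Lemma lexmin_sub k t : lexmin k t `<=` S t.
Proof.
elim: k => [//|k ih] x /=; case: insubP => [i _ _ [/ih//]|_ /ih//].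
Qed.

Lemma lexmin_compact k t : S t !=set0 -> compact (S t) ->
  lexmin k t !=set0 /\ compact (lexmin k t).
Proof.
move=> S0 cS; elim: k => [//|k [ne cp]] /=; case: insubP => [i _ _|//].
have cc : continuous (fun x : 'rV[R]_n => x ord0 i) by exact: coord_continuous.
have [c Lc cmin] := compact_min ne cp cc.
have mE : [set x | lexmin k t x /\ forall y, lexmin k t y -> x ord0 i <= y ord0 i] =
    lexmin k t `&` [set x | x ord0 i <= c ord0 i].
  apply/seteqP; split => x /= [Lx h]; split => //; first exact: h.
  by move=> y /cmin; exact: le_trans.
rewrite mE; split; first by exists c; split => /=.
apply: compact_closedI => //.
exact: (closed_comp (fun x _ => cc x) (@closed_le R (c ord0 i))).
Qed.

Lemma lexmin_le k l t : (k <= l)%N -> lexmin l t `<=` lexmin k t.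
Proof.
move=> /subnK <-; elim: (l - k)%N => [//|m ih] x; rewrite addSn /=.
by case: insubP => [i _ _ [/ih//]|_ /ih//].
Qed.

Lemma lexmin_uniq t x y : lexmin n t x -> lexmin n t y -> x = y.
Proof.
move=> Lx Ly; apply/rowP => i.
have LE z : lexmin n t z -> lexmin i.+1 t z by exact/lexmin_le/ltn_ord.
have Lk z : lexmin n t z -> lexmin i t z by apply/lexmin_le/ltnW/ltn_ord.
move: (LE _ Lx) (LE _ Ly) => /=; rewrite valK => -[_ hx] [_ hy].
by apply/eqP; rewrite eq_le hx ?hy //; exact: Lk.
Qed.

Hypothesis dS : forall j, (0 < j)%N -> definable (fun e => S (e 0%N) (rvof j n e)).

Lemma definable_lexmin k j : (0 < j)%N ->
  definable (fun e => lexmin k (e 0%N) (rvof j n e)).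
Proof.
elim: k j => [|k ih] j j0 /=; first exact: dS.
case: insubP => [i _ _|_]; last exact: ih.
apply: definable_and; first exact: ih.
apply: (definable_ext (P := fun e => ~ exists y : 'rV[R]_n,
    lexmin k (e 0%N) y /\ ~ (rvof j n e ord0 i <= y ord0 i))).
  move=> e; split=> [h y Ly|h [y [Ly]]]; last by apply; exact: h.
  by apply: contrapT => ny; apply: h; exists y.
apply/definable_not/(definable_ex_rv (k := (j + n)%N)).
  by move=> e y; rewrite rvof_setv_lt // setv_lt // addn_gt0 j0.
apply: definable_and; first by apply: ih; rewrite addn_gt0 j0.
apply/definable_not/definable_le.
  by apply: definable_fun_ext (definable_fun_var R (j + i)) => e; rewrite mxE.
by apply: definable_fun_ext (definable_fun_var R (j + n + i)) => e; rewrite mxE.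
Qed.

Theorem curve_selection eps : 0 < eps ->
  (forall t, 0 < t < eps -> S t !=set0 /\ compact (S t)) ->
  exists (x D : R -> 'rV[R]_n) (s : 'I_n -> R) (d : R),
  [/\ 0 < d <= eps, (forall i, s i = 1 \/ s i = -1) &
   forall t, 0 < t < d -> S t (x t) /\
     forall i, is_derive t 1 (fun u => x u ord0 i) (D t ord0 i) /\
               0 <= s i * D t ord0 i].
Proof.
move=> e0 S0.
(* The value 0 off [(0, eps)], where [S t] may be empty, makes [x] a total function with a definable
   graph. *)
pose x t : 'rV[R]_n := if `[< 0 < t < eps >] then xget 0 (lexmin n t) else 0.
have xP t : 0 < t < eps -> lexmin n t (x t).
  move=> te; rewrite /x asboolT //.
  by have [/(xgetPex 0)] := lexmin_compact n (S0 t te).1 (S0 t te).2.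
have dx i : definable1 (fun t => x t ord0 i).
  apply: (definable_ext (P := fun e => (((0 < e 0%N) /\ (e 0%N < eps)) /\
       exists y : 'rV[R]_n, lexmin n (e 0%N) y /\ e 1%N = y ord0 i) \/
       (~ ((0 < e 0%N) /\ (e 0%N < eps)) /\ e 1%N = 0))).
    move=> e; have [te|te] := pselect (0 < e 0%N < eps).
      have te' : 0 < e 0%N /\ e 0%N < eps by apply/andP.
      split=> [[[_ [y [Ly ->]]]|[]//]|->].
        by rewrite (lexmin_uniq Ly (xP _ te)).
      by left; split=> //; exists (x (e 0%N)); split => //; exact: xP.
    have te' : ~ (0 < e 0%N /\ e 0%N < eps) by move/andP.
    rewrite /x asboolF // mxE; split=> [[[]//|[]//]|->].
    by right.
  have dt : definable (fun e : nat -> R => 0 < e 0%N /\ e 0%N < eps).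
    apply: definable_and; apply: definable_lt;
    by [exact: definable_fun_cst|exact: definable_fun_var].
  apply: definable_or; apply: definable_and => //; last first.
  - by apply: definable_eq; [exact: definable_fun_var|exact: definable_fun_cst].
  - exact: definable_not.
  apply: (definable_ex_rv (k := 2)); first by move=> e y; rewrite !setv_lt.
  apply: definable_and; first exact: definable_lexmin.
  apply: definable_eq; first exact: definable_fun_var.
  by apply: definable_fun_ext (definable_fun_var R (2 + i)) => e; rewrite mxE.
have [D DP] := choice (fun i => definable1_derive (dx i)).
have [d dP] := choice DP; have [s sP] := choice dP.
pose d0 := \big[Num.min/eps]_i d i.
exists x, (fun t => \row_i D i t), s, d0; split.
- apply/andP; split; last by apply: bigmin_le_id.
  by apply: lt_bigmin => // i _; case: (sP i).
- by move=> i; case: (sP i).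
move=> t /andP[t0 td]; split.
  by apply: lexmin_sub (xP _ _); rewrite t0 (lt_le_trans td) // bigmin_le_id.
move=> i; rewrite mxE; case: (sP i) => _ _; apply.
by rewrite t0 (lt_le_trans td) // bigmin_le.
Qed.
End Lexicographic.

(** [s * f] is nondecreasing, so its limit at 0 is its infimum. The sign of [f t - l] is recorded
    because it later turns sums of absolute values into differentiable sums. *)
Lemma monotone_limit (f D : R -> R) (s d B : R) : 0 < d -> (s = 1 \/ s = -1) ->
  (forall t, 0 < t < d -> is_derive t 1 f (D t) /\ 0 <= s * D t) ->
  (forall t, 0 < t < d -> `|f t| <= B) ->
  exists l, (forall t, 0 < t < d -> 0 <= s * (f t - l)) /\
    forall e, 0 < e -> exists2 r, 0 < r <= d & forall t, 0 < t < r -> `|f t - l| < e.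
Proof.
move=> d0 s1 fD fB; pose g t := s * f t.
have ss : s * s = 1 by case: s1 => ->; rewrite ?mul1r // mulrNN mulr1.
have gD t : 0 < t < d -> is_derive t 1 g (s * D t).
  by move=> /fD[h _]; apply: is_deriveZ.
have gmono t u : 0 < t -> t <= u -> u < d -> g t <= g u.
  move=> t0; rewrite le_eqVlt => /predU1P[-> //|tu] ud.
  have inside z : z \in `[t, u] -> 0 < z < d.
    by rewrite in_itv /= => /andP[z1 z2]; rewrite (lt_le_trans t0) ?(le_lt_trans z2).
  have [||z zi] := MVT (f := g) (df := fun t => s * D t) tu.
  - by move=> z zi; apply/gD/inside; exact: subset_itv_oo_cc.
  - apply: derivable_within_continuous => z /inside zi.
    have h := gD z zi; exact: ex_derive.
  move=> E; rewrite -subr_ge0 E; apply: mulr_ge0; last by rewrite subr_ge0 ltW.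
  have /inside zd : z \in `[t, u] by exact: subset_itv_oo_cc.
  by have [] := fD z zd.
pose A := [set g t | t in [set t | 0 < t < d]].
have Ainf : has_inf A.
  split; first by exists (g (d / 2)), (d / 2) => //=; lra.
  exists (- B) => _ [t /= td <-].
  have : `|g t| <= B by rewrite /g normrM; case: s1 => ->; rewrite ?normrN normr1 mul1r fB.
  by rewrite ler_norml => /andP[].
exists (s * inf A); split.
  move=> t td; rewrite mulrBr mulrA ss mul1r subr_ge0.
  by apply: ge_inf; [case: Ainf|exists t].
move=> e e0; have [_ [u /= ud <-] ue] := inf_adherent e0 Ainf.
exists u; first by move: ud => /andP[-> /ltW].
move=> t /andP[t0 tu].
have td : 0 < t < d by rewrite t0 (lt_trans tu); move: ud => /andP[].
have -> : f t - s * inf A = s * (g t - inf A) by rewrite /g mulrBr mulrA ss mul1r.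
rewrite normrM (_ : `|s| = 1) ?mul1r; last by case: s1 => ->; rewrite ?normrN normr1.
have h1 : inf A <= g t by apply: ge_inf; [case: Ainf|exists t].
have h2 : g t <= g u by apply: gmono => //; [exact: ltW|case/andP: ud].
by rewrite ger0_norm; lra.
Qed.
End CurveSelection.

(** * Euclidean norm and polynomial functions *)

Section EuclideanNorm.
Variables (R : realType) (n : nat).
Implicit Types (x y z : 'rV[R]_n).

Definition edot x y : R := \sum_(i < n) x ord0 i * y ord0 i.

Lemma enorm_ge0 x : 0 <= enorm x. Proof. exact: sqrtr_ge0. Qed.

Lemma sqr_enorm x : enorm x ^+ 2 = \sum_(i < n) x ord0 i ^+ 2.
Proof. by rewrite sqr_sqrtr // sumr_ge0 // => i _; exact: sqr_ge0. Qed.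

Lemma sqr_enorm_edot x : enorm x ^+ 2 = edot x x.
Proof. by rewrite sqr_enorm; apply: eq_bigr => i _; rewrite expr2. Qed.

Lemma edotC x y : edot x y = edot y x.
Proof. by apply: eq_bigr => i _; rewrite mulrC. Qed.

Lemma edotDl x y z : edot (x + y) z = edot x z + edot y z.
Proof. by rewrite -big_split; apply: eq_bigr => i _ /=; rewrite mxE mulrDl. Qed.

Lemma edotZl a x y : edot (a *: x) y = a * edot x y.
Proof. by rewrite mulr_sumr; apply: eq_bigr => i _; rewrite mxE mulrA. Qed.

Lemma edotDr x y z : edot x (y + z) = edot x y + edot x z.
Proof. by rewrite ![edot x _]edotC edotDl. Qed.

Lemma edotZr a x y : edot x (a *: y) = a * edot x y.
Proof. by rewrite ![edot x _]edotC edotZl. Qed.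

Lemma edotNl x y : edot (- x) y = - edot x y.
Proof. by rewrite -scaleN1r edotZl mulN1r. Qed.

Lemma edotNr x y : edot x (- y) = - edot x y.
Proof. by rewrite -scaleN1r edotZr mulN1r. Qed.

Lemma enorm0 : enorm (0 : 'rV[R]_n) = 0.
Proof. by rewrite /enorm big1 ?sqrtr0 // => i _; rewrite mxE expr0n. Qed.

Lemma enormZ a x : enorm (a *: x) = `|a| * enorm x.
Proof.
apply/eqP; rewrite -(eqrXn2 (n := 2)) ?mulr_ge0 ?enorm_ge0 //.
by rewrite exprMn !sqr_enorm_edot edotZl edotZr mulrA -expr2 real_normK ?num_real.
Qed.

Lemma enormN x : enorm (- x) = enorm x.
Proof. by rewrite -scaleN1r enormZ normrN normr1 mul1r. Qed.

Lemma enormB x y : enorm (x - y) = enorm (y - x).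
Proof. by rewrite -enormN opprB. Qed.

Lemma enorm_coord x i : `|x ord0 i| <= enorm x.
Proof.
rewrite -ler_sqr ?nnegrE ?enorm_ge0 // real_normK ?num_real // sqr_enorm.
by rewrite (bigD1 i) //= lerDl sumr_ge0 // => j _; exact: sqr_ge0.
Qed.

Lemma enorm_eq0 x : enorm x = 0 -> x = 0.
Proof.
move=> x0; apply/rowP => i; rewrite mxE; apply/eqP.
by rewrite -normr_eq0 eq_le normr_ge0 andbT -x0 enorm_coord.
Qed.

Lemma cauchy_schwarz x y : `|edot x y| <= enorm x * enorm y.
Proof.
have [y0|yn0] := eqVneq (enorm y) 0.
  rewrite (enorm_eq0 y0) enorm0 mulr0 /edot big1 ?normr0 // => i _.
  by rewrite mxE mulr0.
have y2 : 0 < enorm y ^+ 2 by rewrite exprn_even_gt0.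
rewrite -ler_sqr ?nnegrE ?mulr_ge0 ?enorm_ge0 // real_normK ?num_real // exprMn.
set S := edot x y; set Y := enorm y ^+ 2 in y2 *.
have : 0 <= enorm (x - (S / Y) *: y) ^+ 2 by exact: sqr_ge0.
rewrite sqr_enorm_edot edotDl !edotDr !edotNl !edotNr edotZl !edotZr -!sqr_enorm_edot.
rewrite (edotC y x) edotZl -sqr_enorm_edot -/S -/Y => h.
rewrite -subr_ge0 (_ : _ - _ = Y * (enorm x ^+ 2 - S ^+ 2 / Y)).
  by rewrite pmulr_rge0 //; apply: le_trans h _; rewrite le_eqVlt; apply/predU1P;
    left; field; rewrite gt_eqF.
by field; rewrite gt_eqF.
Qed.

Lemma enormD x y : enorm (x + y) <= enorm x + enorm y.
Proof.
rewrite -ler_sqr ?nnegrE ?addr_ge0 ?enorm_ge0 // sqrrD !sqr_enorm_edot.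
rewrite edotDl !edotDr (edotC y x).
have := cauchy_schwarz x y; rewrite ler_norml => /andP[_ h].
by rewrite -mulr_natr; lra.
Qed.

Lemma enorm_triangle z x y : enorm (x - y) <= enorm (x - z) + enorm (z - y).
Proof. by rewrite (le_trans _ (enormD _ _)) // addrA subrK. Qed.

Lemma enorm_le_sum x : enorm x <= \sum_(i < n) `|x ord0 i|.
Proof.
have s0 : 0 <= \sum_(i < n) `|x ord0 i| by rewrite sumr_ge0.
rewrite -ler_sqr ?nnegrE ?enorm_ge0 // sqr_enorm expr2 mulr_suml.
apply: ler_sum => i _; rewrite -real_normK ?num_real // expr2 ler_wpM2l //.
by rewrite (bigD1 i) //= lerDl sumr_ge0.
Qed.

Lemma mx_norm_le_enorm x : `|x| <= enorm x.
Proof.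
rewrite /Num.norm /= mx_normrE; apply/bigmax_leP; split; first exact: enorm_ge0.
by move=> [i j] _ /=; rewrite (ord1 i) enorm_coord.
Qed.

Lemma enorm_le_mx_norm x : enorm x <= n%:R * `|x|.
Proof.
apply: le_trans (enorm_le_sum x) _.
rewrite -[n in n%:R]card_ord -sum1_card natr_sum mulr_suml; apply: ler_sum => i _.
rewrite mul1r [leRHS]/Num.norm /= mx_normrE.
by apply: (le_bigmax _ (fun ij => `|x ij.1 ij.2|) (ord0, i)).
Qed.

Lemma nbhs_enorm x (A : set 'rV[R]_n) :
  nbhs x A <-> exists2 e, 0 < e & forall y, enorm (y - x) < e -> A y.
Proof.
split.
  move=> /nbhs_ballP[e /= e0 eA]; exists e => // y xy; apply: eA.
  rewrite -ball_normE /= distrC; exact: le_lt_trans (mx_norm_le_enorm _) xy.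
move=> [e e0 eA]; apply/nbhs_ballP; exists (e / n.+1%:R) => /=; first by rewrite divr_gt0.
move=> y; rewrite -ball_normE /= ltr_pdivlMr // mulrC => xy; apply: eA.
rewrite enormB; apply: le_lt_trans (enorm_le_mx_norm _) (le_lt_trans _ xy).
by rewrite ler_wpM2r // ler_nat.
Qed.

Lemma enorm_continuous z : continuous (fun x => enorm (x - z)).
Proof.
move=> x A /nbhs_ballP[e /= e0 eA]; apply/nbhs_enorm; exists e => // y xy; apply: eA.
rewrite -ball_normE /=.
have := enorm_triangle y x z; have := enorm_triangle x y z.
by rewrite ltr_norml (enormB x y); lra.
Qed.

Lemma compact_eball z r : compact [set x | enorm (x - z) <= r].
Proof.
apply: bounded_closed_compact.
  exists (r + enorm z); split; first exact: num_real.
  move=> M rM x /= xr; apply: le_trans (mx_norm_le_enorm x) _.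
  by have := enormD (x - z) z; rewrite subrK; lra.
exact: (closed_comp (fun x _ => @enorm_continuous z x) (@closed_le R r)).
Qed.

End EuclideanNorm.

(** * Polynomial functions: Taylor bounds and gradients *)

Section PolynomialFunctions.
Variables (R : realType) (n : nat).
Implicit Types (p q : mpoly.mpoly n R) (x y z : 'rV[R]_n).

Lemma mpoly_ring_ind (Q : mpoly.mpoly n R -> Prop) :
  (forall c, Q (mpoly.mpolyC n c)) -> (forall i, Q (mpoly.mpolyX R (mpoly.mnm1 i))) ->
  (forall p q, Q p -> Q q -> Q (p + q)) -> (forall p q, Q p -> Q q -> Q (p * q)) ->
  forall p, Q p.
Proof.
move=> QC QX QD QM; elim/mpoly.mpolyind => [|c m p _ _ Qp].
  by rewrite -(mpoly.mpolyC0 n R).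
apply: (QD) => //; rewrite -mpoly.mul_mpolyC; apply: (QM) => //.
rewrite mpoly.mpolyXE_id; elim/big_rec: _ => [|i q _ Qq]; first exact: (QC 1).
apply: (QM) => //; elim: (m i) => [|k ih]; first exact: (QC 1).
by rewrite exprS; apply: (QM).
Qed.

Definition grad p x : 'rV[R]_n := \row_i peval (mpoly.mderiv i p) x.

Lemma pevalD p q x : peval (p + q) x = peval p x + peval q x.
Proof. exact: mpoly.mevalD. Qed.
Lemma pevalB p q x : peval (p - q) x = peval p x - peval q x.
Proof. exact: mpoly.mevalB. Qed.
Lemma pevalN p x : peval (- p) x = - peval p x.
Proof. exact: mpoly.mevalN. Qed.
Lemma pevalM p q x : peval (p * q) x = peval p x * peval q x.
Proof. exact: mpoly.mevalM. Qed.
Lemma pevalXn p k x : peval (p ^+ k) x = peval p x ^+ k.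
Proof. exact: rmorphXn. Qed.
Lemma pevalZ c p x : peval (c *: p) x = c * peval p x.
Proof. exact: mpoly.mevalZ. Qed.
Lemma pevalC c x : peval (mpoly.mpolyC n c) x = c.
Proof. exact: mpoly.mevalC. Qed.
Lemma pevalX i x : peval (mpoly.mpolyX R (mpoly.mnm1 i)) x = x ord0 i.
Proof. exact: mpoly.mevalXU. Qed.
Lemma peval0 x : peval 0 x = 0.
Proof. exact: mpoly.meval0. Qed.
Lemma peval_sum I (r : seq I) (P : pred I) (F : I -> mpoly.mpoly n R) x :
  peval (\sum_(i <- r | P i) F i) x = \sum_(i <- r | P i) peval (F i) x.
Proof. exact: raddf_sum. Qed.
Lemma peval_prod I (r : seq I) (P : pred I) (F : I -> mpoly.mpoly n R) x :
  peval (\prod_(i <- r | P i) F i) x = \prod_(i <- r | P i) peval (F i) x.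
Proof. exact: rmorph_prod. Qed.

Lemma gradD p q x : grad (p + q) x = grad p x + grad q x.
Proof. by apply/rowP => i; rewrite !mxE mpoly.mderivD pevalD. Qed.
Lemma gradZ c p x : grad (c *: p) x = c *: grad p x.
Proof. by apply/rowP => i; rewrite !mxE mpoly.mderivZ pevalZ. Qed.
Lemma gradN p x : grad (- p) x = - grad p x.
Proof. by rewrite -scaleN1r gradZ scaleN1r. Qed.
Lemma gradM p q x : grad (p * q) x = peval q x *: grad p x + peval p x *: grad q x.
Proof.
by apply/rowP => i; rewrite !mxE mpoly.mderivM pevalD !pevalM [X in X + _]mulrC.
Qed.
Lemma gradC c x : grad (mpoly.mpolyC n c) x = 0.
Proof. by apply/rowP => i; rewrite !mxE mpoly.mderivC peval0. Qed.

Lemma mderivXU i j :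
  mpoly.mderiv i (mpoly.mpolyX R (mpoly.mnm1 j)) = mpoly.mpolyC n (i == j)%:R.
Proof.
rewrite mpoly.mderivX mpoly.mnm1E eq_sym; case: eqVneq => [<-|_]; last first.
  by rewrite scale0r mpoly.mpolyC0.
rewrite scale1r (_ : mpoly.mnm_sub _ _ = mpoly.mnm0) ?mpoly.mpolyX0 ?mpoly.mpolyC1 //.
by apply/mpoly.mnmP => k; rewrite mpoly.mnmBE mpoly.mnm0E subnn.
Qed.

Lemma peval_continuous p : continuous (peval p).
Proof.
elim/mpoly_ring_ind: p => [c|i|p q cp cq|p q cp cq].
- by rewrite (_ : peval _ = cst c); [exact: cst_continuous|apply/funext => x; rewrite pevalC].
- rewrite (_ : peval _ = fun x => x ord0 i); last by apply/funext => x; rewrite pevalX.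
  exact: coord_continuous.
- rewrite (_ : peval _ = peval p \+ peval q); last by apply/funext => x; rewrite pevalD.
  by move=> x; apply: continuousD; [exact: cp|exact: cq].
- rewrite (_ : peval _ = peval p \* peval q); last by apply/funext => x; rewrite pevalM.
  by move=> x; apply: continuousM; [exact: cp|exact: cq].
Qed.

(** The bound on the values and the Lipschitz constant are obtained together because the product
    case needs both. *)
Lemma peval_lipschitz p B : exists2 C, 0 <= C & forall x y,
  enorm x <= B -> enorm y <= B ->
  `|peval p x| <= C /\ `|peval p y - peval p x| <= C * enorm (y - x).
Proof.
elim/mpoly_ring_ind: p => [c|i|p q [C C0 CP] [D D0 DP]|p q [C C0 CP] [D D0 DP]].
- exists `|c| => // x y _ _; rewrite !pevalC subrr normr0; split=> //.
  by rewrite mulr_ge0 ?enorm_ge0.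
- exists (Num.max B 1); first by rewrite le_max ler01 orbT.
  move=> x y xB _; rewrite !pevalX; split.
    by rewrite le_max (le_trans (enorm_coord x i) xB).
  have := enorm_coord (y - x) i; rewrite !mxE => /le_trans; apply.
  by rewrite -{1}[enorm _]mul1r ler_wpM2r ?enorm_ge0 // le_max lexx orbT.
- exists (C + D); first exact: addr_ge0.
  move=> x y xB yB; have [c1 c2] := CP x y xB yB; have [d1 d2] := DP x y xB yB.
  rewrite !pevalD; split; first by rewrite (le_trans (ler_normD _ _)) // lerD.
  rewrite opprD addrACA (le_trans (ler_normD _ _)) // mulrDl lerD //.
- exists (2 * C * D); first by rewrite !mulr_ge0.
  move=> x y xB yB; have [c1 c2] := CP x y xB yB; have [d1 d2] := DP x y xB yB.
  have [c3 _] := CP y x yB xB; have CD : 0 <= C * D by rewrite mulr_ge0.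
  rewrite !pevalM; split.
    rewrite normrM; apply: (@le_trans _ _ (C * D)); last by lra.
    exact: ler_pM.
  rewrite (_ : _ - _ = peval p y * (peval q y - peval q x) +
    (peval p y - peval p x) * peval q x); last by ring.
  rewrite (le_trans (ler_normD _ _)) // !normrM.
  have h1 : `|peval p y| * `|peval q y - peval q x| <= C * (D * enorm (y - x)).
    exact: ler_pM.
  have h2 : `|peval p y - peval p x| * `|peval q x| <= C * enorm (y - x) * D.
    exact: ler_pM.
  lra.
Qed.

Lemma peval_taylor p B : exists2 C, 0 <= C & forall x y,
  enorm x <= B -> enorm y <= B ->
  `|peval p y - peval p x - edot (grad p x) (y - x)| <= C * enorm (y - x) ^+ 2.
Proof.
elim/mpoly_ring_ind: p => [c|i|p q [C C0 CP] [D D0 DP]|p q [C C0 CP] [D D0 DP]].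
- exists 0 => // x y _ _; rewrite !pevalC gradC subrr sub0r -(scale0r (0 : 'rV[R]_n)).
  by rewrite edotZl mul0r oppr0 normr0 mul0r.
- exists 0 => // x y _ _; rewrite !pevalX /edot (bigD1 i) //= big1 ?addr0.
    by rewrite !mxE mderivXU pevalC eqxx mul1r subrr normr0 mul0r.
  by move=> j ji; rewrite !mxE mderivXU pevalC (negPf ji) mul0r.
- exists (C + D); first exact: addr_ge0.
  move=> x y xB yB; rewrite !pevalD gradD edotDl mulrDl.
  apply: le_trans (lerD (CP x y xB yB) (DP x y xB yB)).
  apply: le_trans (ler_normD _ _); rewrite le_eqVlt; apply/predU1P; left.
  by congr (`|_|); ring.
- have [K K0 KP] := peval_lipschitz p B; have [L L0 LP] := peval_lipschitz q B.
  exists (L * C + K * D + K * L); first by rewrite !addr_ge0 ?mulr_ge0.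
  move=> x y xB yB; rewrite !pevalM gradM edotDl !edotZl.
  have {CP} := CP x y xB yB; set E := (X in `|X|) => EC.
  have {DP} := DP x y xB yB; set F := (X in `|X|) => FD.
  rewrite (_ : _ - _ = peval q x * E + peval p x * F +
    (peval p y - peval p x) * (peval q y - peval q x)); last by rewrite /E /F; ring.
  have [k1 k2] := KP x y xB yB; have [l1 l2] := LP x y xB yB.
  set N := enorm (y - x) in k2 l2 EC FD *.
  have N0 : 0 <= N by exact: enorm_ge0.
  have h1 : `|peval q x * E| <= L * (C * N ^+ 2) by rewrite normrM ler_pM.
  have h2 : `|peval p x * F| <= K * (D * N ^+ 2) by rewrite normrM ler_pM.
  have h3 : `|(peval p y - peval p x) * (peval q y - peval q x)| <= (K * N) * (L * N).
    by rewrite normrM ler_pM.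
  have := ler_normD (peval q x * E + peval p x * F)
    ((peval p y - peval p x) * (peval q y - peval q x)).
  have := ler_normD (peval q x * E) (peval p x * F).
  by move=> *; lra.
Qed.

Lemma is_derive_peval p (X D : R -> 'rV[R]_n) (t : R) :
  (forall i, is_derive t 1 (fun u => X u ord0 i) (D t ord0 i)) ->
  is_derive t 1 (fun u => peval p (X u)) (edot (grad p (X t)) (D t)).
Proof.
move=> dX; elim/mpoly_ring_ind: p => [c|i|p q dp dq|p q dp dq].
- rewrite (_ : (fun _ => _) = cst c); last by apply/funext => u; rewrite pevalC.
  by rewrite gradC -(scale0r (0 : 'rV[R]_n)) edotZl mul0r; exact: is_derive_cst.
- rewrite (_ : (fun u => peval _ _) = (fun u => X u ord0 i)); last first.
    by apply/funext => u; rewrite pevalX.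
  rewrite (_ : edot _ _ = D t ord0 i) // /edot (bigD1 i) //= big1 ?addr0.
    by rewrite !mxE mderivXU pevalC eqxx mul1r.
  by move=> j ji; rewrite !mxE mderivXU pevalC (negPf ji) mul0r.
- rewrite (_ : (fun u => peval _ _) =
    (fun u => peval p (X u)) + (fun u => peval q (X u))); last first.
    by apply/funext => u; rewrite pevalD.
  by rewrite gradD edotDl; exact: is_deriveD.
- rewrite (_ : (fun u => peval _ _) =
    (fun u => peval p (X u)) * (fun u => peval q (X u))); last first.
    by apply/funext => u; rewrite pevalM.
  have h := is_deriveM dp dq; apply: is_derive_eq h _.
  by rewrite gradM edotDl !edotZl addrC.
Qed.

(** With [N = |grad p x| > k], a step of length [t N] against the gradient lowers [p] by about
    [t N^2], more than the allowed [k t N]. The bounds on [t] keep the step inside both balls and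
    the Taylor remainder at most half of the gain. *)
Lemma grad_le_of_slope p x k e : 0 < e -> 0 <= k ->
  (forall y, enorm (y - x) < e -> peval p x - k * enorm (y - x) <= peval p y) ->
  enorm (grad p x) <= k.
Proof.
move=> e0 k0 hp; rewrite leNgt; apply/negP => kg.
set g := grad p x in kg; set N := enorm g in kg.
have [C C0 CP] := peval_taylor p (enorm x + N).
have N0 : 0 < N by lra.
pose t := Num.min (Num.min 1 (e / (2 * N))) ((N - k) / (2 * (C * N + 1))).
have CN1 : 0 < C * N + 1 by have : 0 <= C * N by [rewrite mulr_ge0 // ltW]; lra.
have t0 : 0 < t.
  by rewrite /t !lt_min ltr01 !divr_gt0 ?mulr_gt0 //; lra.
have t1 : t <= 1 by rewrite /t !ge_min lexx.
have t2 : t * N < e.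
  have : t <= e / (2 * N) by rewrite /t !ge_min lexx orbT.
  by rewrite ler_pdivlMr ?mulr_gt0 //; lra.
have t3 : t * (2 * (C * N + 1)) <= N - k.
  rewrite -ler_pdivlMr ?mulr_gt0 // /t ge_min lexx orbT //.
pose y := x - t *: g.
have yx : y - x = (- t) *: g by rewrite /y addrAC subrr add0r scaleNr.
have nyx : enorm (y - x) = t * N by rewrite yx enormZ normrN gtr0_norm.
have h1 := hp y; rewrite nyx in h1; have {h1} h1 := h1 t2.
have h2 := CP x y _ _; rewrite nyx yx edotZr -sqr_enorm_edot -/g -/N in h2.
have {}h2 : `|peval p y - peval p x - - t * N ^+ 2| <= C * (t * N) ^+ 2.
  apply: h2; first by lra.
  have -> : y = (y - x) + x by rewrite subrK.
  apply: le_trans (enormD _ _) _; rewrite nyx.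
  have : t * N <= N by rewrite -[leRHS]mul1r ler_wpM2r // ltW.
  by lra.
move: h2; rewrite ler_norml => /andP[_ h2].
have h3 : t * N * (N - k) <= t * N * (C * (t * N)) by lra.
rewrite ler_pM2l ?mulr_gt0 // in h3.
have : t * (C * N) <= (N - k) / 2 by lra.
by lra.
Qed.

Lemma grad_eq0_of_min p x e : 0 < e ->
  (forall y, enorm (y - x) < e -> peval p x <= peval p y) -> grad p x = 0.
Proof.
move=> e0 hp; apply: enorm_eq0; apply/eqP; rewrite eq_le enorm_ge0 andbT.
by apply: (grad_le_of_slope e0) => // y /hp; rewrite mul0r subr0.
Qed.
End PolynomialFunctions.

(** * Minimisers of one-parameter families of polynomials *)

Section ParameterFactor.
Variable A : idomainType.

(** The largest power of the parameter is divided out, so that a nonzero polynomial remains at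
    [u = 0]. The coefficients lie in a domain because both the reals and the polynomials in a second
    parameter occur. *)
Lemma factor_parameter (P : {poly {poly A}}) : P != 0 ->
  exists (m : nat) (Q : {poly A}) (r : {poly {poly A}}),
  [/\ Q != 0, (size Q <= size P)%N &
    forall s u, P.[s%:P].[u] = u ^+ m * (Q.[s] + u * r.[s%:P].[u])].
Proof.
move=> P0; pose S := swapXY P.
have S0 : S != 0 by rewrite swapXY_eq0.
have [m [q]] := multiplicity_XsubC S 0.
rewrite S0 /= subr0 rootE horner_coef0 => q0 SE.
have [r qE] : exists r : {poly {poly A}}, q = r * 'X + (q`_0)%:P.
  exists (drop_poly 1 q); apply/polyP => -[|i].
    by rewrite coefD coefC coefMX /= add0r.
  by rewrite coefD coefC coefMX /= addr0 coef_drop_poly addn1.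
exists m, q`_0, (swapXY r); split => //.
  apply/leq_sizeP => j Pj.
  have <- : S`_m = q`_0 by rewrite SE coefMXn ltnn subnn.
  by rewrite coef_swapXY (nth_default _ Pj) coef0.
move=> s u.
have -> : P.[s%:P].[u] = S.[u%:P].[s] by rewrite /S horner2_swapXY.
have -> : (swapXY r).[s%:P].[u] = r.[u%:P].[s] by rewrite horner2_swapXY.
rewrite SE hornerM hornerXn hornerM -rmorphXn /= hornerC mulrC; congr (_ * _).
by rewrite {1}qE hornerD hornerC hornerD hornerMX hornerM hornerC addrC mulrC.
Qed.
End ParameterFactor.

Section RootOrder.
Variable R : realType.

Lemma poly_bounded (p : {poly R}) B : exists2 K, 0 <= K &
  forall x, `|x| <= B -> `|p.[x]| <= K.
Proof.
elim/poly_ind: p => [|p c [K K0 KP]]; first by exists 0 => // x _; rewrite horner0 normr0.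
exists (K * Num.max B 0 + `|c|); first by rewrite addr_ge0 // mulr_ge0 // le_max lexx orbT.
move=> x xB; rewrite hornerD hornerMX hornerC (le_trans (ler_normD _ _)) // lerD //.
by rewrite normrM ler_pM ?KP // le_max xB.
Qed.

Lemma poly2_bounded (p : {poly {poly R}}) B : exists2 K, 0 <= K &
  forall x y, `|x| <= B -> `|y| <= B -> `|p.[y%:P].[x]| <= K.
Proof.
elim/poly_ind: p => [|p c [K K0 KP]].
  by exists 0 => // x y _ _; rewrite !horner0 normr0.
have [L L0 LP] := poly_bounded c B.
exists (K * Num.max B 0 + L); first by rewrite addr_ge0 // mulr_ge0 // le_max lexx orbT.
move=> x y xB yB; rewrite hornerD hornerMX hornerC hornerD hornerM hornerC.
rewrite (le_trans (ler_normD _ _)) // lerD ?LP //.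
by rewrite normrM ler_pM ?KP // le_max yB.
Qed.

Lemma poly3_bounded (p : {poly {poly {poly R}}}) u B : exists2 K, 0 <= K &
  forall x y, `|x| <= B -> `|y| <= B -> `|p.[y%:P%:P].[x%:P].[u]| <= K.
Proof.
elim/poly_ind: p => [|p c [K K0 KP]].
  by exists 0 => // x y _ _; rewrite !horner0 normr0.
have [L L0 LP] := poly2_bounded c (Num.max B `|u|).
exists (K * Num.max B 0 + L); first by rewrite addr_ge0 // mulr_ge0 // le_max lexx orbT.
move=> x y xB yB; rewrite hornerD hornerMX hornerC !hornerD !hornerM !hornerC.
rewrite (le_trans (ler_normD _ _)) // lerD ?LP ?le_max ?xB ?lexx ?orbT //.
by rewrite normrM ler_pM ?KP // le_max yB.
Qed.

Lemma horner2_cont (Q : {poly {poly R}}) u s e : 0 < e -> exists2 d, 0 < d &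
  forall s', `|s' - s| < d -> `|Q.[s'%:P].[u] - Q.[s%:P].[u]| < e.
Proof.
move=> e0; have [d d0 dP] := @polyrcf.poly_cont R s (map_poly (horner_eval u) Q) e e0.
have E z : Q.[z%:P].[u] = (map_poly (horner_eval u) Q).[z].
  by rewrite -[z in RHS](hornerC z u) -[_.[u]]/(horner_eval u _) horner_map.
by exists d => // s' /dP; rewrite !E.
Qed.

(** This turns an algebraic degree into an exponent. Divided by a power of [u], the equation reads
    [c(s) + u r(s, u) = 0]; if [s0] is a zero of [c] of order [k <= M], then [|s - s0|^k] is at most
    a multiple of [u]. *)
Lemma root_order (Q : {poly {poly R}}) M s0 : Q != 0 -> (size Q <= M.+1)%N ->
  exists C d, [/\ 0 < C, 0 < d & forall u s, 0 < u < d -> `|s - s0| < d ->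
    Q.[s%:P].[u] = 0 -> `|s - s0| ^+ M <= C * u].
Proof.
move=> Q0 sQ; have [m [c [r [c0 sc QE]]]] := factor_parameter Q0.
have [k [c' cE]] := multiplicity_XsubC c s0.
move: cE; rewrite c0 /= => -[c's0 cE].
have kM : (k <= M)%N.
  have c'0 : c' != 0 by apply: contraNneq c0 => c'0; rewrite cE c'0 mul0r.
  have := leq_trans sc sQ; rewrite cE size_Mmonic ?monic_exp ?monicXsubC //.
  have : (0 < size c')%N by rewrite size_poly_gt0.
  by rewrite size_exp_XsubC; case: (size c') => // a _; rewrite addSn /= addnS /= ltnS; lia.
have [K K0 KP] := poly2_bounded r (`|s0| + 1).
have [|d d0 dP] := @polyrcf.poly_cont R s0 c' (`|c'.[s0]| / 2).
  by rewrite divr_gt0 // normr_gt0.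
have c'n : 0 < `|c'.[s0]| by rewrite normr_gt0.
exists (2 * (K + 1) / `|c'.[s0]|), (Num.min d 1); split.
- by rewrite divr_gt0 // mulr_gt0 //; lra.
- by rewrite lt_min d0 /=.
move=> u s /andP[u0]; rewrite !lt_min => /andP[ud u1] /andP[sd s1].
rewrite QE => /eqP; rewrite mulf_eq0 expf_eq0 (gt_eqF u0) andbF /= => /eqP cu.
have {cu} cu : `|c.[s]| <= K * u.
  have -> : c.[s] = - (u * r.[s%:P].[u]) by lra.
  rewrite normrN normrM mulrC (gtr0_norm u0) ler_pM2r // KP //.
    by rewrite gtr0_norm //; have := normr_ge0 s0; lra.
  by have := ler_normD (s - s0) s0; rewrite subrK; lra.
have c's : `|c'.[s0]| / 2 <= `|c'.[s]|.
  have := dP s sd; have := ler_normB c'.[s] (c'.[s] - c'.[s0]).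
  by rewrite opprB addrC subrK; lra.
have h : `|s - s0| ^+ k * `|c'.[s0]| <= 2 * (K + 1) * u.
  move: cu; rewrite cE hornerM horner_exp hornerXsubC normrM normrX => cu.
  have : `|s - s0| ^+ k * (`|c'.[s0]| / 2) <= `|s - s0| ^+ k * `|c'.[s]|.
    by rewrite ler_wpM2l // exprn_ge0.
  by lra.
rewrite mulrAC ler_pdivlMr //; apply: le_trans h; rewrite ler_pM2r //.
by rewrite ler_wiXn2l // ltW.
Qed.
End RootOrder.

Section PerturbedMinimizers.
Variables (R : realType) (n m : nat).

Lemma cluster_sequence (K : set 'rV[R]_n) (y : nat -> 'rV[R]_n) : compact K ->
  (forall j, K (y j)) -> exists2 x, K x & forall J e, 0 < e ->
  exists2 j, (J <= j)%N & enorm (y j - x) < e.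
Proof.
move=> cK Ky; have [|x [Kx clx]] := cK (y @ \oo) _.
  by exists 0%N => // j _ /=.
exists x => // J e e0.
have [||z [/= [j Jj <-] yj]] := clx [set y j | j in [set j | (J <= j)%N]]
  [set z | enorm (z - x) < e].
- by exists J => // j Jj; exists j.
- by apply/nbhs_enorm; exists e.
by exists j.
Qed.

Definition power_sum : mpoly.mpoly n R :=
  m.+1%:R^-1 *: \sum_(i < n) mpoly.mpolyX R (mpoly.mnm1 i) ^+ m.+1.


Lemma gradXn (p : mpoly.mpoly n R) k x :
  grad (p ^+ k.+1) x = (k.+1%:R * peval p x ^+ k) *: grad p x.
Proof.
elim: k => [|k ih]; first by rewrite expr1 expr0 mulr1 scale1r.
rewrite exprS gradM ih pevalXn scalerA -scalerDl; congr (_ *: _).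
by rewrite -[in RHS]natr1 exprS; ring.
Qed.

Lemma grad_sum I (r : seq I) (F : I -> mpoly.mpoly n R) x :
  grad (\sum_(i <- r) F i) x = \sum_(i <- r) grad (F i) x.
Proof.
elim/big_rec2: _ => [|i y p _ <-]; last by rewrite gradD.
by rewrite -(mpoly.mpolyC0 n R) gradC.
Qed.

Lemma grad_power_sum x i : grad power_sum x ord0 i = x ord0 i ^+ m.
Proof.
rewrite gradZ mxE grad_sum summxE (bigD1 i) //= big1 => [|j ji].
  rewrite gradXn !mxE pevalX mderivXU pevalC eqxx mulr1 addr0.
  by rewrite mulrA mulVf ?mul1r // pnatr_eq0.
by rewrite gradXn !mxE mderivXU pevalC eq_sym (negPf ji) mulr0.
Qed.

(* With [eta * power_sum] added, the gradient vanishes on a [perturbed_elimination] system;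
   divide the resulting polynomial by a power of [eta] and let [eta] tend to 0. *)
Lemma minimizer_elimination (F G : mpoly.mpoly n R) (K : set 'rV[R]_n) B :
  (0 < m)%N -> (forall i, mpoly.msize (mpoly.mderiv i F) <= m.+1)%N ->
  (forall i, mpoly.msize (mpoly.mderiv i G) <= m.+1)%N ->
  K !=set0 -> compact K -> (forall x, K x -> enorm x <= B) ->
  exists Q : 'I_n -> {poly {poly R}},
    (forall k, Q k != 0 /\ (size (Q k) <= (m ^ n).+1)%N) /\
    forall u, (forall x, K x -> (forall y, K y -> peval (F + u *: G) x <= peval (F + u *: G) y) ->
      exists2 e, 0 < e & forall y, enorm (y - x) < e -> K y) ->
    exists x, [/\ K x, (forall y, K y -> peval (F + u *: G) x <= peval (F + u *: G) y) &
      forall k, (Q k).[(x ord0 k)%:P].[u] = 0].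
Proof.
move=> m0 sF sG K0 cK KB.
have [P PP] := choice (fun k => @perturbed_elimination R n m k
  (fun i => mpoly.mderiv i F) (fun i => mpoly.mderiv i G) m0 sF sG).
have HQ k : exists Qr : {poly {poly R}} * {poly {poly {poly R}}},
    [/\ Qr.1 != 0, (size Qr.1 <= (m ^ n).+1)%N & forall s u eta, eta != 0 ->
    (P k).[s%:P%:P].[eta%:P].[u] = 0 ->
    Qr.1.[s%:P].[u] + eta * Qr.2.[s%:P%:P].[eta%:P].[u] = 0].
  have [P0 sP _] := PP k; have [a [Q [r [Q0 sQ QE]]]] := factor_parameter P0.
  exists (Q, r); split => //=; first exact: leq_trans sP.
  move=> s u eta eta0; rewrite QE hornerM hornerD hornerM -rmorphXn /= !hornerC.
  by move=> /eqP; rewrite mulf_eq0 expf_eq0 (negPf eta0) andbF /= => /eqP.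
have [Qr QrP] := choice HQ.
(* The polynomials are fixed before [u], so they are equations between the coordinates of a
   minimiser and [u]. *)
exists (fun k => (Qr k).1); split; first by move=> k; have [] := QrP k.
move=> u inter; pose Phi := F + u *: G.
pose eta j : R := j.+1%:R^-1.
have eta0 j : 0 < eta j by rewrite invr_gt0.
have Hy j : exists y, K y /\ forall z, K z ->
    peval (Phi + eta j *: power_sum) y <= peval (Phi + eta j *: power_sum) z.
  have [y Ky yP] := compact_min K0 cK (@peval_continuous _ _ (Phi + eta j *: power_sum)).
  by exists y.
have [y yP] := choice Hy.
(* The equations will hold at this cluster point of perturbed minimisers, not at every minimiser of
   [Phi]. *)
have [x Kx xcl] := cluster_sequence cK (fun j => (yP j).1).
have [CN CN0 CNP] := peval_lipschitz power_sum B.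
have [CP CP0 CPP] := peval_lipschitz Phi B.
have small e : 0 < e -> exists J, forall j, (J <= j)%N -> eta j < e.
  move=> e0; exists (Num.bound e^-1) => j Jj.
  rewrite /eta invf_plt ?posrE //; apply: (lt_le_trans (archi_boundP _)).
    by rewrite invr_ge0 ltW.
  by rewrite ler_nat ltnW // ltnS.
have xmin z : K z -> peval Phi x <= peval Phi z.
  move=> Kz; rewrite leNgt; apply/negP => h.
  set g := peval Phi x - peval Phi z.
  have g0 : 0 < g by rewrite subr_gt0.
  (* With this precision the errors from the two perturbation terms and from replacing [x] by [y j]
     add up to less than the gap [g]. *)
  have e0 : 0 < g / (4 * (CN + CP + 1)) by rewrite divr_gt0 // mulr_gt0 //; lra.
  have [J JP] := small _ e0; have [j Jj yj] := xcl J _ e0.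
  have {}JP := JP j Jj.
  have := (yP j).2 z Kz; rewrite 2!(pevalD Phi) 2!(pevalZ (eta j)).
  have [n1 _] := CNP z z (KB _ Kz) (KB _ Kz).
  have [n2 _] := CNP (y j) z (KB _ (yP j).1) (KB _ Kz).
  have [_ n3] := CPP x (y j) (KB _ Kx) (KB _ (yP j).1).
  move: n1 n2 n3; rewrite !ler_norml => /andP[a1 a2] /andP[b1 b2] /andP[c1 c2] hy.
  have d1 : eta j * peval power_sum z <= eta j * CN by rewrite ler_pM2l.
  have d2 : - (eta j * CN) <= eta j * peval power_sum (y j) by rewrite -mulrN ler_pM2l.
  have d3 : CP * enorm (y j - x) <= CP * (g / (4 * (CN + CP + 1))).
    by rewrite ler_wpM2l // ltW.
  have d4 : eta j * CN <= (g / (4 * (CN + CP + 1))) * CN by rewrite ler_wpM2r // ltW.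
  have E : g = 4 * (CN + CP + 1) * (g / (4 * (CN + CP + 1))).
    by rewrite mulrC mulfVK // gt_eqF //; lra.
  move: e0 d3 d4 E; set w := g / _ => e0 d3 d4 E.
  have : 0 <= CN * w by rewrite mulr_ge0 // ltW.
  have : 0 <= CP * w by rewrite mulr_ge0 // ltW.
  have gE : g = peval Phi x - peval Phi z by [].
  move: gE a1 a2 b1 b2 c1 c2 hy d1 d2 d3 d4 E; clearbody w; move=> *; lra.
exists x; split => //.
have [e e0 eK] := inter x Kx xmin.
move=> k; apply/eqP; rewrite -normr_le0 leNgt; apply/negP => Q0.
set q := `|_| in Q0.
have [_ _ QE] := QrP k.
have [Kr Kr0 KrP] := poly3_bounded (Qr k).2 u (Num.max 1 B).
have q20 : 0 < q / 2 by rewrite divr_gt0.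
have [d d0 dP] := horner2_cont (Qr k).1 u (x ord0 k) q20.
have qK0 : 0 < q / (2 * (Kr + 1)) by rewrite divr_gt0 // mulr_gt0 //; lra.
have min1 : 0 < Num.min 1 (q / (2 * (Kr + 1))) by rewrite lt_min ltr01 qK0.
have [J JP] := small _ min1.
have min2 : 0 < Num.min d (e / 2) by rewrite lt_min d0 divr_gt0.
have [j Jj yj] := xcl J _ min2.
move: (JP j Jj) yj; rewrite !lt_min => /andP[eta1 etaq] /andP[yd ye].
(* Close to the interior minimiser [x], the point [y j] is interior too, hence critical. *)
have sys : grad (Phi + eta j *: power_sum) (y j) = 0.
  have e20 : 0 < e / 2 by rewrite divr_gt0.
  apply: (grad_eq0_of_min e20) => z zy; apply: (yP j).2; apply: eK.
  by have := enorm_triangle (y j) z x; lra.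
have [_ _ /(_ (eta j) u (fun i => y j ord0 i))] := PP k.
have {}sys i : mpoly.meval (fun i => y j ord0 i) (mpoly.mderiv i F) +
    u * mpoly.meval (fun i => y j ord0 i) (mpoly.mderiv i G) + eta j * y j ord0 i ^+ m = 0.
  have : grad (Phi + eta j *: power_sum) (y j) ord0 i = 0 by rewrite sys mxE.
  rewrite (gradD Phi) (gradZ (eta j)) mxE [X in _ + X]mxE.
  by rewrite grad_power_sum (gradD F) (gradZ u) !mxE.
move=> /(_ sys) /(QE _ _ _ (lt0r_neq0 (eta0 j))) h.
have ck := enorm_coord (y j - x) k; rewrite !mxE in ck.
have h1 := dP (y j ord0 k) (le_lt_trans ck yd).
have hK : `|(Qr k).1.[(y j ord0 k)%:P].[u]| <= eta j * Kr.
  have -> : (Qr k).1.[(y j ord0 k)%:P].[u] =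
    - (eta j * (Qr k).2.[(y j ord0 k)%:P%:P].[(eta j)%:P].[u]) by lra.
  rewrite normrN normrM gtr0_norm // ler_pM2l // KrP //.
    by rewrite gtr0_norm // le_max (ltW eta1).
  by apply: le_trans (enorm_coord _ k) _; rewrite le_max (KB _ (yP j).1) orbT.
have hq : eta j * Kr <= q / 2.
  have : eta j * (2 * (Kr + 1)) < q by rewrite -ltr_pdivlMr // mulr_gt0 //; lra.
  by have := eta0 j; lra.
have := ler_normB (Qr k).1.[(y j ord0 k)%:P].[u]
  ((Qr k).1.[(y j ord0 k)%:P].[u] - (Qr k).1.[(x ord0 k)%:P].[u]).
by rewrite opprB addrC subrK -/q; lra.
Qed.
End PerturbedMinimizers.

(** * Isolated zeros *)

Section Degree.
Variables (R : realType) (n : nat).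
Implicit Types (p q : mpoly.mpoly n R).

Lemma msizeM_leq p q a b : (mpoly.msize p <= a.+1)%N -> (mpoly.msize q <= b.+1)%N ->
  (mpoly.msize (p * q) <= (a + b).+1)%N.
Proof.
move=> pa qb; have [->|p0] := eqVneq p 0; first by rewrite mul0r mpoly.mmeasure0.
have [->|q0] := eqVneq q 0; first by rewrite mulr0 mpoly.mmeasure0.
by rewrite mpoly.msizeM //; have := leq_add pa qb; rewrite addSn addnS; case: (_ + _)%N.
Qed.

Lemma msizeD_leq p q a : (mpoly.msize p <= a)%N -> (mpoly.msize q <= a)%N ->
  (mpoly.msize (p + q) <= a)%N.
Proof. by move=> pa qa; rewrite (leq_trans (mpoly.msizeD_le _ _)) // geq_max pa. Qed.

Lemma msize_sum_leq I (r : seq I) (F : I -> mpoly.mpoly n R) a :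
  (forall i, mpoly.msize (F i) <= a)%N -> (mpoly.msize (\sum_(i <- r) F i) <= a)%N.
Proof.
move=> Fa; elim/big_rec: _ => [|i p _ pa]; first by rewrite mpoly.mmeasure0.
exact: msizeD_leq.
Qed.

Lemma msizeC_leq c a : (mpoly.msize (mpoly.mpolyC n c : mpoly.mpoly n R) <= a.+1)%N.
Proof. by rewrite mpoly.msizeC; case: (c != 0). Qed.

Lemma msizeXU_leq i a : (mpoly.msize (mpoly.mpolyX R (mpoly.mnm1 i) : mpoly.mpoly n R) <= a.+2)%N.
Proof. by rewrite mpoly.msizeX mpoly.mdeg1. Qed.

Lemma msizeZ_leq c p a : (mpoly.msize p <= a)%N -> (mpoly.msize (c *: p) <= a)%N.
Proof. exact/leq_trans/mpoly.msizeZ_le. Qed.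

Lemma msizeN_leq p a : (mpoly.msize p <= a)%N -> (mpoly.msize (- p) <= a)%N.
Proof. by rewrite mpoly.mmeasureN. Qed.

Lemma msizeXn_leq p a k : (mpoly.msize p <= a.+1)%N -> (mpoly.msize (p ^+ k) <= (k * a).+1)%N.
Proof.
move=> pa; elim: k => [|k ih]; first by rewrite expr0 mpoly.msize1.
by rewrite exprS mulSn; exact: msizeM_leq.
Qed.

Lemma msize_mderiv p i a : (mpoly.msize p <= a.+2)%N ->
  (mpoly.msize (mpoly.mderiv i p) <= a.+1)%N.
Proof.
move=> pa; rewrite /mpoly.mderiv big_seq; elim/big_rec: _ => [|m q mp qa].
  by rewrite mpoly.mmeasure0.
apply: msizeD_leq => //.
have [mi|mi] := eqVneq (m i) 0%N; first by rewrite mi mul0r scale0r mpoly.mmeasure0.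
apply: msizeZ_leq; rewrite mpoly.msizeX.
have := leq_trans (mpoly.msize_mdeg_lt mp) pa; rewrite ltnS; apply: leq_trans.
rewrite !mpoly.mdegE (bigD1 i) //= [leqRHS](bigD1 i) //= -addSn leq_add //.
  by rewrite mpoly.mnmBE mpoly.mnm1E eqxx subn1 prednK // lt0n.
by apply: leq_sum => j _; rewrite mpoly.mnmBE leq_subr.
Qed.
End Degree.

Section IsolatedZero.
Variables (R : realType) (n m : nat) (f : mpoly.mpoly n R) (z : 'rV[R]_n).
Hypothesis m_gt0 : (0 < m)%N.
Hypothesis size_f : (mpoly.msize f <= m.+2)%N.
Hypothesis f_ge0 : forall x, 0 <= peval f x.
Hypothesis fz : peval f z = 0.
Variable r : R.
Hypothesis r_gt0 : 0 < r.
Hypothesis f_isolated : forall x, enorm (x - z) <= r -> peval f x = 0 -> x = z.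

Let K : set 'rV[R]_n := [set x | enorm (x - z) <= r].

Let small_values d : 0 < d -> exists2 u0, 0 < u0 & forall x, K x ->
  peval f x < u0 -> enorm (x - z) < d.
Proof.
move=> d0; pose A := K `&` [set x | d <= enorm (x - z)].
have cA : compact A.
  apply: compact_closedI; first exact: compact_eball.
  exact: (closed_comp (fun x _ => @enorm_continuous _ _ z x) (@closed_ge R d)).
have [A0|/set0P A0] := eqVneq A set0.
  exists 1 => // x Kx _; rewrite ltNge; apply/negP => dx.
  by have : A x by []; rewrite A0.
have [c [Kc /= cd] cmin] := compact_min A0 cA (@peval_continuous _ _ f).
have fc : 0 < peval f c.
  rewrite lt_neqAle f_ge0 andbT; apply/eqP => /esym /f_isolated -/(_ Kc) cz.
  by move: cd; rewrite cz subrr enorm0 leNgt d0.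
exists (peval f c) => // x Kx; apply: contraTT; rewrite -!leNgt => dx.
exact: cmin.
Qed.

(** Let [t = s (y_k - z_k)] and let [x] minimise [f - u s (x_k - z_k)]. As [f x >= 0], minimality
    gives [f y >= u (t - |x_k - z_k|)], and [|x_k - z_k|^M <= C u] makes this at least [u t / 2] for
    [u] a suitable multiple of [t^M]. *)
Let coordinate_bound k (s : R) : s * s = 1 -> exists c rho, [/\ 0 < c, 0 < rho &
  forall y, enorm (y - z) < rho -> 0 < s * (y ord0 k - z ord0 k) ->
  c * (s * (y ord0 k - z ord0 k)) ^+ (m ^ n).+1 <= peval f y].
Proof.
move=> ss; set M := (m ^ n)%N.
have s1 : `|s| = 1 by apply/eqP; rewrite -sqrp_eq1 // real_normK ?num_real // expr2 ss.
pose G : mpoly.mpoly n R :=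
  (- s) *: (mpoly.mpolyX R (mpoly.mnm1 k) - mpoly.mpolyC n (z ord0 k)).
have GE x : peval G x = - (s * (x ord0 k - z ord0 k)).
  by rewrite pevalZ pevalB pevalX pevalC mulNr.
have sF i : (mpoly.msize (mpoly.mderiv i f) <= m.+1)%N by exact: msize_mderiv.
have sG i : (mpoly.msize (mpoly.mderiv i G) <= m.+1)%N.
  apply: (@leq_trans 1); last by rewrite ltnS.
  apply: msize_mderiv; apply: msizeZ_leq; apply: msizeD_leq; first exact: msizeXU_leq.
  by apply: msizeN_leq; exact: msizeC_leq.
have K0 : K !=set0 by exists z; rewrite /K /= subrr enorm0 ltW.
have KB x : K x -> enorm x <= r + enorm z.
  by rewrite /K /= => Kx; have := enormD (x - z) z; rewrite subrK; lra.
have [Q [QP Qmin]] := minimizer_elimination m_gt0 sF sG K0 (@compact_eball _ _ z r) KB.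
have [Qk0 sQk] := QP k.
have [C [d [C0 d0 QC]]] := root_order (z ord0 k) Qk0 sQk.
have [|u0 u00 u0P] := @small_values (Num.min d r); first by rewrite lt_min d0.
have key u : 0 < u -> u < d -> u * r < u0 -> exists x,
    (forall y, K y -> peval f x - u * (s * (x ord0 k - z ord0 k)) <=
      peval f y - u * (s * (y ord0 k - z ord0 k))) /\
    `|x ord0 k - z ord0 k| ^+ M <= C * u.
  move=> u_gt0 ud ur.
  (* The perturbed function is 0 at [z], so [f x <= u r] at a minimiser; small values of [f] occur
     only near [z], inside the ball. *)
  have near x : K x -> (forall y, K y -> peval (f + u *: G) x <= peval (f + u *: G) y) ->
      enorm (x - z) < Num.min d r.
    move=> Kx /(_ z); rewrite 2!(pevalD f) 2!(pevalZ u) !GE fz subrr mulr0 oppr0 mulr0 addr0.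
    move=> xmin; apply: u0P => //; apply: le_lt_trans ur.
    have {}xmin : peval f x <= u * (s * (x ord0 k - z ord0 k)).
      by have := xmin (_ : K z); rewrite /K /= subrr enorm0 => /(_ (ltW r_gt0)); lra.
    apply: le_trans xmin _; rewrite ler_pM2l //.
    apply: le_trans (ler_norm _) _; rewrite normrM s1 mul1r.
    by apply: le_trans Kx; have := enorm_coord (x - z) k; rewrite !mxE.
  have [|x [Kx xmin xQ]] := Qmin u.
    move=> x Kx /(near _ Kx); rewrite lt_min => /andP[_ xr].
    exists (r - enorm (x - z)); first by rewrite subr_gt0.
    by move=> y; have := enorm_triangle x y z; rewrite /K /=; lra.
  exists x; split.
    by move=> y /xmin; rewrite 2!(pevalD f) 2!(pevalZ u) !GE !mulrN.
  apply: QC; rewrite ?u_gt0 //.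
  have := near x Kx xmin; rewrite lt_min => /andP[+ _].
  by apply: le_lt_trans; have := enorm_coord (x - z) k; rewrite !mxE.
(* Chosen so that [C * u = (t / 2) ^+ M] for [u = c * t ^+ M]. *)
pose c := (C * 2 ^+ M)^-1.
have c0 : 0 < c by rewrite invr_gt0 mulr_gt0 // exprn_gt0.
pose rho := Num.min (Num.min 1 r) (Num.min (d / c) (u0 / (c * r))).
exists (c / 2), rho; split; first by rewrite divr_gt0.
  by rewrite !lt_min ltr01 r_gt0 !divr_gt0 // mulr_gt0.
move=> y; rewrite !lt_min => /andP[/andP[y1 yr] /andP[yd yu]].
set t := s * _ => t0.
have ty : t <= enorm (y - z).
  apply: le_trans (ler_norm _) _; rewrite normrM s1 mul1r.
  by have := enorm_coord (y - z) k; rewrite !mxE.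
have tM : t ^+ M <= enorm (y - z).
  have [j MJ] : exists j, M = j.+1 by exists M.-1; rewrite prednK // expn_gt0 m_gt0.
  rewrite MJ exprS; apply: (le_trans _ ty); rewrite -[leRHS]mulr1 ler_pM2l //.
  by apply: exprn_ile1; [exact: ltW|exact: le_trans ty (ltW y1)].
pose u := c * t ^+ M.
have u_gt0 : 0 < u by rewrite mulr_gt0 // exprn_gt0.
have ud : u < d by rewrite /u mulrC -ltr_pdivlMr //; apply: le_lt_trans yd.
have ur : u * r < u0.
  by rewrite /u mulrAC mulrC -ltr_pdivlMr ?mulr_gt0 //; apply: le_lt_trans yu.
have [x [xmin xM]] := key u u_gt0 ud ur.
have xt : `|x ord0 k - z ord0 k| <= t / 2.
  have M0 : (0 < M)%N by rewrite expn_gt0 m_gt0.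
  rewrite -(ler_pXn2r M0) ?nnegrE //; last by apply: divr_ge0 => //; exact: ltW.
  apply: le_trans xM _; rewrite /u /c expr_div_n le_eqVlt; apply/predU1P; left.
  by field; rewrite expf_neq0 // gt_eqF.
have := xmin y (ltW yr); rewrite -/t.
have := f_ge0 x.
have : u * (s * (x ord0 k - z ord0 k)) <= u * (t / 2).
  rewrite ler_pM2l //; apply: le_trans (ler_norm _) _.
  by rewrite normrM s1 mul1r.
have : c / 2 * t ^+ M.+1 = u * (t / 2) by rewrite /u exprS; field.
by move=> *; lra.
Qed.

Theorem isolated_zero_lower_bound : exists c rho, [/\ 0 < c, 0 < rho &
  forall y, enorm (y - z) < rho -> c * enorm (y - z) ^+ (m ^ n).+1 <= peval f y].
Proof.
have H k : exists cr : R * R, [/\ 0 < cr.1, 0 < cr.2 &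
    forall y, enorm (y - z) < cr.2 ->
    cr.1 * `|y ord0 k - z ord0 k| ^+ (m ^ n).+1 <= peval f y].
  have [c1 [r1 [c10 r10 P1]]] := @coordinate_bound k 1 (mul1r 1).
  have [|c2 [r2 [c20 r20 P2]]] := @coordinate_bound k (-1); first by rewrite mulrNN mul1r.
  exists (Num.min c1 c2, Num.min r1 r2); split; rewrite /= ?lt_min ?c10 ?r10 //.
  move=> y; rewrite lt_min => /andP[y1 y2].
  have N0 : 0 <= `|y ord0 k - z ord0 k| ^+ (m ^ n).+1 by rewrite exprn_ge0.
  have [h|h|h] := ltrgt0P (y ord0 k - z ord0 k); last first.
  - by rewrite expr0n /= mulr0.
  - have := P2 y y2; rewrite mulN1r oppr_gt0 => /(_ h); apply: le_trans.
    rewrite ler_pM2r ?exprn_gt0 ?oppr_gt0 // ge_min lexx orbT //.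
  - have := P1 y y1; rewrite mul1r => /(_ h); apply: le_trans.
    by rewrite ler_pM2r ?exprn_gt0 // ge_min lexx.
have [cr crP] := choice H.
pose c := \big[Num.min/1]_k (cr k).1; pose rho := \big[Num.min/1]_k (cr k).2.
have c0 : 0 < c by apply: lt_bigmin => // k _; case: (crP k).
have rho0 : 0 < rho by apply: lt_bigmin => // k _; case: (crP k).
(* Some coordinate of [y - z] is at least [|y - z| / (n + 1)] when [y] is not [z]. *)
exists (c / n.+1%:R ^+ (m ^ n).+1), rho; split => //.
  by rewrite divr_gt0 // exprn_gt0.
move=> y yr; rewrite mulrAC -mulrA -expr_div_n.
have [y0|yn0] := eqVneq (enorm (y - z)) 0; first by rewrite y0 mul0r expr0n mulr0.
have [k kP] : exists k, enorm (y - z) / n.+1%:R <= `|y ord0 k - z ord0 k|.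
  apply: contrapT => /forallNP nk.
  have lek i : `|(y - z) ord0 i| <= enorm (y - z) / n.+1%:R.
    by rewrite !mxE ltW // ltNge; apply/negP.
  have := le_trans (enorm_le_sum (y - z)) (ler_sum _ (fun i _ => lek i)).
  rewrite sumr_const card_ord -[leRHS]mulr_natr => h.
  have E : enorm (y - z) = enorm (y - z) / n.+1%:R * (n%:R + 1).
    by rewrite natr1 mulfVK // pnatr_eq0.
  have w0 : 0 < enorm (y - z) / n.+1%:R.
    by rewrite divr_gt0 ?ltr0n // lt_neqAle eq_sym yn0 enorm_ge0.
  move: h E w0; set w := enorm (y - z) / n.+1%:R => h E w0; lra.
have [_ _ kb] := crP k; apply: le_trans (kb y _); last by rewrite (lt_le_trans yr) // bigmin_le.
have e0 : 0 <= enorm (y - z) / n.+1%:R by rewrite divr_ge0 // enorm_ge0.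
apply: ler_pM; [exact: ltW|exact: exprn_ge0|exact: bigmin_le|].
by rewrite ler_pXn2r // nnegrE.
Qed.
End IsolatedZero.

(** * From gradients to distances *)

Section PowerInequalities.
Variable R : realType.
Implicit Types (a b s w : R).

Lemma exprD_ge a b k : 0 <= a -> 0 <= b -> a ^+ k.+1 + b ^+ k.+1 <= (a + b) ^+ k.+1.
Proof.
move=> a0 b0; elim: k => [|k ih]; first by rewrite !expr1.
rewrite ![_ ^+ k.+2]exprS.
have h : (a + b) * (a ^+ k.+1 + b ^+ k.+1) <= (a + b) * (a + b) ^+ k.+1.
  by rewrite ler_wpM2l // addr_ge0.
have : 0 <= a * b ^+ k.+1 by rewrite mulr_ge0 ?exprn_ge0.
have : 0 <= b * a ^+ k.+1 by rewrite mulr_ge0 ?exprn_ge0.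
by move=> *; lra.
Qed.

Lemma exprB_le a b k : 0 <= b -> b <= a ->
  a ^+ k.+1 - b ^+ k.+1 <= k.+1%:R * a ^+ k * (a - b).
Proof.
move=> b0 ba; have a0 : 0 <= a by exact: le_trans ba.
rewrite subrXX mulrC ler_wpM2r ?subr_ge0 //.
rewrite -[k.+1%:R]/(k.+1%:R) -[in leRHS](card_ord k.+1) -sumr_const mulr_suml.
apply: ler_sum => i _; rewrite mul1r.
have ik : (i <= k)%N by rewrite -ltnS.
rewrite -[in leRHS](subnK ik) exprD ler_wpM2l ?exprn_ge0 //.
by apply: lerXn2r; rewrite ?nnegrE.
Qed.

Lemma powR_root a L : 0 <= a -> (a `^ (L.+1%:R^-1)) ^+ L.+1 = a.
Proof.
by move=> a0; rewrite -powR_mulrn ?powR_ge0 // -powRrM mulVf ?pnatr_eq0 // powRr1.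
Qed.

(** Superadditivity of the power gives [|s - t|^(L+1) <= |s^(L+1) - t^(L+1)|], so closeness of the
    values passes to the roots. *)
Lemma root_continuous n (f : 'rV[R]_n -> R) L : continuous f -> (forall x, 0 <= f x) ->
  continuous (fun x => f x `^ (L.+1%:R^-1)).
Proof.
move=> cf f0 x A /nbhs_ballP[e /= e0 eA].
have eL : 0 < e ^+ L.+1 by exact: exprn_gt0.
have /nbhs_enorm[d d0 dP] := cf x _ (nbhsx_ballx (f x) _ eL).
apply/nbhs_enorm; exists d => // y /dP; rewrite -ball_normE /= => h.
apply: eA; rewrite -ball_normE /= ltNge; apply/negP => h2.
move: h; apply/negP; rewrite -leNgt.
set s := f x `^ _ in h2; set t := f y `^ _ in h2.
rewrite -(powR_root L (f0 x)) -(powR_root L (f0 y)) -/s -/t.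
have s0 : 0 <= s := powR_ge0 _ _; have t0 : 0 <= t := powR_ge0 _ _.
apply: (@le_trans _ _ (`|s - t| ^+ L.+1)); first by rewrite ler_pXn2r // nnegrE ltW.
have [st|ts] := leP t s.
  rewrite !ger0_norm ?subr_ge0 ?ler_pXn2r // lerBrDr.
  by have := @exprD_ge (s - t) t L; rewrite subrK subr_ge0; apply.
have ts' := ltW ts.
rewrite distrC [leRHS]distrC !ger0_norm ?subr_ge0 ?ler_pXn2r // lerBrDr.
by have := @exprD_ge (t - s) s L; rewrite subrK subr_ge0; apply.
Qed.
End PowerInequalities.

Section Distance.
Variables (R : realType) (n : nat).
Implicit Types (x a : 'rV[R]_n) (A : set 'rV[R]_n).

Lemma dist_le x a A : A a -> dist x A <= enorm (x - a).
Proof.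
move=> Aa; apply: ge_inf; last by exists a.
by exists 0 => _ [b _ <-]; exact: enorm_ge0.
Qed.

Lemma dist_ge0 x A : 0 <= dist x A.
Proof.
have [->|/set0P[a Aa]] := eqVneq A set0; first by rewrite /dist image_set0 inf0.
apply: lb_le_inf; first by exists (enorm (x - a)), a.
by move=> _ [b _ <-]; exact: enorm_ge0.
Qed.

Lemma dist_sub x A B : A !=set0 -> A `<=` B -> dist x B <= dist x A.
Proof.
move=> [a Aa] AB; apply: lb_le_inf; first by exists (enorm (x - a)), a.
by move=> _ [b Ab <-]; apply: dist_le; exact: AB.
Qed.
End Distance.

Section GradientToDistance.
Variables (R : realType) (n L : nat) (f : mpoly.mpoly n R) (z : 'rV[R]_n) (c r : R).
Hypothesis f_ge0 : forall x, 0 <= peval f x.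
Hypothesis fz : peval f z = 0.
Hypotheses (c_gt0 : 0 < c) (r_gt0 : 0 < r).
Hypothesis grad_lower : forall x s, enorm (x - z) <= r -> 0 <= s ->
  s ^+ L.+1 = peval f x -> c * s ^+ L <= enorm (grad f x).

(* Ekeland's trick: a minimiser of [f^(1/L) + c' |x - a|] with [c' < c/L] must
   be a zero of [f]. *)
Theorem distance_lower_bound : exists c1 rho, [/\ 0 < c1, 0 < rho &
  forall a, enorm (a - z) < rho ->
    c1 * dist a [set x | peval f x = 0] ^+ L.+1 <= peval f a].
Proof.
pose h x := peval f x `^ (L.+1%:R^-1).
have hL x : h x ^+ L.+1 = peval f x by exact: powR_root.
have h0 x : 0 <= h x by exact: powR_ge0.
have ch : continuous h by apply: root_continuous => //; exact: peval_continuous.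
have hz : h z = 0 by rewrite /h fz powR0 // invr_eq0 pnatr_eq0.
(* At a minimiser with [f > 0] the gradient of [f = h^(L+1)] has norm at most [(L + 1) h^L c']; this
   choice makes it half of what [grad_lower] requires. *)
pose c' := c / (2 * L.+1%:R).
have c'0 : 0 < c' by rewrite divr_gt0 // mulr_gt0.
have c'r : 0 < c' * (r / 2) by rewrite mulr_gt0 // divr_gt0.
have /nbhs_enorm[d d0 dP] := ch z _ (nbhsx_ballx (h z) _ c'r).
exists (c' ^+ L.+1), (Num.min d (r / 2)); split.
- exact: exprn_gt0.
- by rewrite lt_min d0 divr_gt0.
move=> a; rewrite lt_min => /andP[/dP ad ar].
(* So small a value keeps the minimiser within [r / 2] of [a], hence inside the ball. *)
have ha : h a < c' * (r / 2).
  by move: ad; rewrite -ball_normE /= hz sub0r normrN ger0_norm.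
pose K : set 'rV[R]_n := [set x | enorm (x - z) <= r].
have K0 : K !=set0 by exists z; rewrite /K /= subrr enorm0 ltW.
have cH : continuous (fun x => h x + c' * enorm (x - a)).
  rewrite (_ : (fun x => _) = h \+ (cst c' \* (fun x => enorm (x - a)))) //.
  move=> x; apply: continuousD; first exact: ch.
  by apply: continuousM; [exact: cst_continuous|exact: enorm_continuous].
have [x Kx xmin] := compact_min K0 (@compact_eball _ _ z r) cH.
have Ka : K a by apply: (le_trans (ltW ar)); have := r_gt0; lra.
have xa : h x + c' * enorm (x - a) <= h a.
  by have := xmin a Ka; rewrite subrr enorm0 mulr0 addr0.
have xr : enorm (x - z) < r.
  have h1 : enorm (x - a) < r / 2 by rewrite -(ltr_pM2l c'0); have := h0 x; lra.
  by have := enorm_triangle a x z; lra.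
have fx : peval f x = 0.
  apply/eqP; rewrite eq_le f_ge0 andbT leNgt; apply/negP => fx.
  have hx : 0 < h x by rewrite /h powR_gt0.
  have : enorm (grad f x) <= L.+1%:R * h x ^+ L * c'.
    apply: (@grad_le_of_slope _ _ f x _ (Num.min (r - enorm (x - z)) (h x / c'))).
    - by rewrite lt_min subr_gt0 xr divr_gt0.
    - by rewrite !mulr_ge0 ?exprn_ge0 // ltW.
    move=> y; rewrite lt_min => /andP[yr yh].
    have Ky : K y by rewrite /K /=; have := enorm_triangle x y z; lra.
    have hy : h x - c' * enorm (y - x) <= h y.
      have := xmin y Ky; have : c' * enorm (y - a) <= c' * (enorm (y - x) + enorm (x - a)).
        by rewrite ler_pM2l // enorm_triangle.
      by lra.
    have b0 : 0 <= h x - c' * enorm (y - x).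
      by rewrite subr_ge0 mulrC -ler_pdivlMr // ltW.
    have bh : h x - c' * enorm (y - x) <= h x.
      by rewrite gerBl mulr_ge0 ?enorm_ge0 // ltW.
    have := exprB_le L b0 bh; rewrite -(hL x) -(hL y).
    have : (h x - c' * enorm (y - x)) ^+ L.+1 <= h y ^+ L.+1.
      by rewrite ler_pXn2r // nnegrE.
    by move=> *; lra.
  have := grad_lower Kx (h0 x) (hL x).
  rewrite (_ : L.+1%:R * h x ^+ L * c' = c * h x ^+ L / 2); last first.
    have : (L.+1%:R : R) != 0 by rewrite pnatr_eq0.
    by rewrite /c'; set l := (L.+1%:R : R) => l0; field.
  have : 0 < c * h x ^+ L by rewrite mulr_gt0 // exprn_gt0.
  by move=> *; lra.
have da : dist a [set x | peval f x = 0] <= enorm (x - a).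
  by rewrite enormB; exact: dist_le.
rewrite -(hL a) -exprMn ler_pXn2r ?nnegrE ?mulr_ge0 ?dist_ge0 //; last exact: ltW.
apply: (@le_trans _ _ (c' * enorm (x - a))); first by rewrite ler_pM2l.
by have := h0 x; lra.
Qed.
End GradientToDistance.

(** * Definable balls and critical values *)

Section DefinableBalls.
Variables (R : realType) (n : nat).

Definition sqdist (z : 'rV[R]_n) : mpoly.mpoly n R :=
  \sum_(i < n) (mpoly.mpolyX R (mpoly.mnm1 i) - mpoly.mpolyC n (z ord0 i)) ^+ 2.

Lemma peval_sqdist z x : peval (sqdist z) x = enorm (x - z) ^+ 2.
Proof.
rewrite peval_sum sqr_enorm; apply: eq_bigr => i _.
by rewrite pevalXn pevalB pevalX pevalC !mxE.
Qed.

Lemma msize_sqdist z : (mpoly.msize (sqdist z) <= 3)%N.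
Proof.
apply: msize_sum_leq => i; rewrite -[3%N]/(2 * 1).+1; apply: msizeXn_leq.
by apply: msizeD_leq; [exact: msizeXU_leq|apply: msizeN_leq; exact: msizeC_leq].
Qed.

Lemma enorm_le_sqdist z x r : 0 <= r ->
  (enorm (x - z) <= r) = (peval (sqdist z) x <= r ^+ 2).
Proof. by move=> r0; rewrite peval_sqdist ler_pXn2r // nnegrE enorm_ge0. Qed.

Lemma definable_fun_peval (p : mpoly.mpoly n R) j :
  definable_fun (fun e => peval p (rvof j n e)).
Proof.
have h := @definable_fun_meval R n p (fun i e => e (j + i)%N)
  (fun i => definable_fun_var R (j + i)).
by apply: definable_fun_ext h => e; apply: mpoly.meval_eq => i; rewrite mxE.
Qed.

Lemma definable_eball (z : 'rV[R]_n) (r : R) j : 0 <= r ->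
  definable (fun e : nat -> R => enorm (rvof j n e - z) <= r).
Proof.
move=> r0; apply: (definable_ext (P := fun e => peval (sqdist z) (rvof j n e) <= r ^+ 2)).
  by move=> e; rewrite enorm_le_sqdist.
by apply: definable_le; [exact: definable_fun_peval|exact: definable_fun_cst].
Qed.

Definition sqgrad (f : mpoly.mpoly n R) : mpoly.mpoly n R :=
  \sum_(i < n) mpoly.mderiv i f ^+ 2.

Lemma peval_sqgrad f x : peval (sqgrad f) x = enorm (grad f x) ^+ 2.
Proof.
by rewrite peval_sum sqr_enorm; apply: eq_bigr => i _; rewrite pevalXn !mxE.
Qed.

Lemma grad_eq0_sqgrad f x : grad f x = 0 <-> peval (sqgrad f) x = 0.
Proof.
rewrite peval_sqgrad; split=> [->|/eqP]; first by rewrite enorm0 expr0n.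
by rewrite sqrf_eq0 => /eqP /enorm_eq0.
Qed.

Lemma closed_peval_eq (p : mpoly.mpoly n R) c : closed [set x | peval p x = c].
Proof.
exact: (closed_comp (fun x _ => @peval_continuous _ _ p x) (@closed_eq R c)).
Qed.

Lemma closed_peval_le (p : mpoly.mpoly n R) c : closed [set x | peval p x <= c].
Proof.
exact: (closed_comp (fun x _ => @peval_continuous _ _ p x) (@closed_le R c)).
Qed.

(* Along a curve of critical points with [f = t], differentiating in [t] gives [0 = 1]. *)
Lemma critical_values (f : mpoly.mpoly n R) z : peval f z = 0 -> (forall x, 0 <= peval f x) ->
  exists2 r, 0 < r & forall x, enorm (x - z) <= r -> grad f x = 0 -> peval f x = 0.
Proof.
move=> fz f0.
pose S (t : R) : set 'rV[R]_n :=
  [set x | enorm (x - z) <= 1] `&`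
    ([set x | peval (sqgrad f) x = 0] `&` [set x | peval (f - mpoly.mpolyC n t) x = 0]).
have dS j : (0 < j)%N -> definable (fun e => S (e 0%N) (rvof j n e)).
  move=> j0; apply: (definable_ext (P := fun e => enorm (rvof j n e - z) <= 1 /\
      (peval (sqgrad f) (rvof j n e) = 0 /\ peval f (rvof j n e) - e 0%N = 0))).
    by move=> e; rewrite /S /= pevalB pevalC.
  apply: definable_and; first exact: definable_eball.
  apply: definable_and; apply: definable_eq; try exact: definable_fun_cst.
    exact: definable_fun_peval.
  by apply: definable_funB; [exact: definable_fun_peval|exact: definable_fun_var].
have dV : definable (fun e => exists x, S (e 0%N) x).
  apply: (definable_ex_rv (k := 1)); last exact: dS.
  by move=> e y; rewrite setv_lt.
(* The critical values in the unit ball either fill some interval [(0, d)], which curve selection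
   refutes, or miss one. *)
have [d d0 [Sne|Se]] := definable_eventually (P := fun t => exists x, S t x) dV.
  have [|x [D [s [d' [/andP[d'0 d'd] _ xP]]]]] := curve_selection dS d0.
    move=> t /Sne[x Sx]; split; first by exists x.
    apply: compact_closedI; first exact: compact_eball.
    by apply: closedI; exact: closed_peval_eq.
  exfalso; have t0 : 0 < d' / 2 < d' by lra.
  have [[_ [/= /grad_eq0_sqgrad g0 _]] xD] := xP _ t0.
  have h1 := is_derive_peval f (fun i => (xD i).1).
  have h2 : is_derive (d' / 2) (1 : R) (fun u => peval f (x u)) 1.
    apply: (@near_eq_is_derive R R R id) (is_derive_id (d' / 2) 1).
    near=> u; have u0 : 0 < u < d'.
      by apply/andP; split; near: u; [apply: lt_nbhsr|apply: lt_nbhsl]; lra.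
    have [[_ [_ /=]]] := xP _ u0.
    by rewrite pevalB pevalC => /eqP; rewrite subr_eq0 => /eqP.
  have := @derive_val _ _ _ _ _ _ _ h2; rewrite (@derive_val _ _ _ _ _ _ _ h1).
  by rewrite g0 -(scale0r (0 : 'rV[R]_n)) edotZl mul0r => /eqP; rewrite eq_sym oner_eq0.
have /nbhs_enorm[e e0 eP] := @peval_continuous _ _ f z _ (nbhsx_ballx (peval f z) _ d0).
exists (Num.min 1 (e / 2)); first by rewrite lt_min ltr01 divr_gt0.
move=> x; rewrite le_min => /andP[x1 xe] gx.
apply/eqP; rewrite eq_le f0 andbT leNgt; apply/negP => fx.
have := eP x; rewrite -ball_normE /= fz sub0r normrN ger0_norm // => fd.
apply: (Se (peval f x)); first by rewrite fx fd //; lra.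
exists x; split => //=; split; first exact/grad_eq0_sqgrad.
by rewrite pevalB pevalC subrr.
Unshelve. all: by end_near.
Qed.
End DefinableBalls.

Lemma enorm_le_coord (R : realType) n (v : 'rV[R]_n) w :
  (forall i, `|v ord0 i| <= w) -> enorm v <= w * n%:R.
Proof.
move=> vw; apply: le_trans (enorm_le_sum v) _.
have := ler_sum (index_enum 'I_n) (fun i (_ : true) => vw i).
by rewrite sumr_const card_ord -[w *+ n]mulr_natr.
Qed.

(** * Growth of a polynomial along a curve of small gradient *)

Section CurveBound.
Variables (R : realType) (n : nat) (f : mpoly.mpoly n R) (K : set 'rV[R]_n) (A : R).
Variables (x D : R -> 'rV[R]_n) (s : 'I_n -> R) (d : R).
Hypothesis f_ge0 : forall x, 0 <= peval f x.
Hypotheses (cK : compact K) (clK : closed K).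
Hypothesis crit : forall x, K x -> grad f x = 0 -> peval f x = 0.
Hypotheses (d_gt0 : 0 < d) (A_ge0 : 0 <= A).
Hypothesis s1 : forall i, s i = 1 \/ s i = -1.
Hypothesis xP : forall t, 0 < t < d -> [/\ K (x t), 0 < peval f (x t),
  enorm (grad f (x t)) ^+ 2 <= A * t * peval f (x t) &
  forall i, is_derive t 1 (fun u => x u ord0 i) (D t ord0 i) /\ 0 <= s i * D t ord0 i].

(* [(sqrt f)' <= sqrt (A t) |x'| / 2] and the curve ends at a critical point, where [f = 0]. *)
Lemma curve_bound : exists x0 : 'rV[R]_n,
  (forall e, 0 < e -> exists2 r, 0 < r <= d & forall t, 0 < t < r ->
     forall i, `|x t ord0 i - x0 ord0 i| < e) /\
  forall t, 0 < t < d ->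
    4 * peval f (x t) <= A * t * (\sum_i `|x t ord0 i - x0 ord0 i|) ^+ 2.
Proof.
have [B KB] : exists B, forall y, K y -> enorm y <= B.
  have [[a Ka]|K0] := pselect (K !=set0); last first.
    by exists 0 => y Ky; exfalso; apply: K0; exists y.
  have cf : continuous (cst 0 \- (fun y : 'rV[R]_n => enorm (y - 0))).
    by move=> y; apply: continuousB; [exact: cst_continuous|exact: enorm_continuous].
  have [b Kb bmin] := compact_min (ex_intro _ a Ka) cK cf.
  by exists (enorm b) => y /bmin /=; rewrite !subr0 !sub0r lerN2.
have H i : exists l, (forall t, 0 < t < d -> 0 <= s i * (x t ord0 i - l)) /\
    forall e, 0 < e -> exists2 r, 0 < r <= d & forall t, 0 < t < r -> `|x t ord0 i - l| < e.
  apply: (@monotone_limit R (fun t => x t ord0 i) (fun t => D t ord0 i) (s i) d B) => //.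
    by move=> t td; have [_ _ _] := xP td; apply.
  move=> t td; have [Kx _ _ _] := xP td.
  exact: le_trans (enorm_coord _ _) (KB _ Kx).
have [l lP] := choice H.
pose x0 : 'rV[R]_n := \row_i l i.
have lim e : 0 < e -> exists2 r, 0 < r <= d & forall t, 0 < t < r ->
     forall i, `|x t ord0 i - x0 ord0 i| < e.
  move=> e0.
  have Hr i : exists r, 0 < r <= d /\ forall t, 0 < t < r -> `|x t ord0 i - l i| < e.
    by have [r rd rP] := (lP i).2 e e0; exists r.
  have [r rP] := choice Hr; exists (\big[Num.min/d]_i r i).
    rewrite bigmin_le_id andbT; apply: lt_bigmin => // i _.
    by have [/andP[]] := rP i.
  move=> t /andP[t0 tr] i; rewrite mxE; apply: (rP i).2.
  by rewrite t0 (lt_le_trans tr) // bigmin_le.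
exists x0; split=> // t1 t1d.
have xsum t : 0 < t < d -> \sum_i `|x t ord0 i - x0 ord0 i| =
    \sum_i s i * (x t ord0 i - x0 ord0 i).
  move=> td; apply: eq_bigr => i _; rewrite mxE.
  have := (lP i).1 t td; case: (s1 i) => ->; rewrite ?mul1r ?mulN1r => h.
    by rewrite ger0_norm.
  by rewrite ler0_norm // -oppr_ge0.
have limp (p : mpoly.mpoly n R) e : 0 < e -> exists2 r, 0 < r <= d &
    forall t, 0 < t < r -> `|peval p (x t) - peval p x0| < e.
  move=> e0; have /nbhs_enorm[e' e'0 e'P] :=
    @peval_continuous _ _ p x0 _ (nbhsx_ballx (peval p x0) _ e0).
  have e'n : 0 < e' / n.+1%:R by rewrite divr_gt0.
  have [r rd rP] := lim _ e'n; exists r => // t /rP xt.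
  rewrite distrC; apply: e'P; apply: (@le_lt_trans _ _ (e' / n.+1%:R * n%:R)).
    by apply: enorm_le_coord => i; rewrite !mxE; have := xt i; rewrite mxE => /ltW.
  by rewrite mulrAC ltr_pdivrMr ?ltr0n // ltr_pM2l // ltr_nat.
have Kx0 : K x0.
  apply: contrapT => nK; have : open (~` K) by exact: closed_openC.
  rewrite openE => /(_ _ nK) /nbhs_enorm[e e0 eP].
  have en : 0 < e / n.+1%:R by rewrite divr_gt0.
  have [r /andP[r0 rd] rP] := lim _ en.
  have r2 : 0 < r / 2 < r by lra.
  have [|Kx _ _ _] := @xP (r / 2); first by lra.
  apply: (eP (x (r / 2))) => //; apply: (@le_lt_trans _ _ (e / n.+1%:R * n%:R)).
    by apply: enorm_le_coord => i; rewrite !mxE; have := rP _ r2 i; rewrite mxE => /ltW.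
  by rewrite mulrAC ltr_pdivrMr ?ltr0n // ltr_pM2l // ltr_nat.
(* [|grad f|^2 <= A t f] with [f] bounded on [K] forces the limit point to be critical. *)
have fx0 : peval f x0 = 0.
  apply: crit => //; apply/grad_eq0_sqgrad/eqP; rewrite eq_le; apply/andP; split; last first.
    by rewrite peval_sqgrad sqr_ge0.
  apply/ler_addgt0Pr => e e0; rewrite add0r.
  have [C C0 CP] := peval_lipschitz f B.
  have e20 : 0 < e / 2 by rewrite divr_gt0.
  have [r /andP[r0 rd] rP] := limp (sqgrad f) _ e20.
  have AC : 0 < A * C + 1 by have := mulr_ge0 A_ge0 C0; lra.
  pose t := Num.min (r / 2) (e / 2 / (A * C + 1)).
  have t0 : 0 < t by rewrite lt_min !divr_gt0.
  have tr : t < r by rewrite /t gt_min; apply/orP; left; lra.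
  have t01 : 0 < t < r by rewrite t0.
  have t0d : 0 < t < d by rewrite t0 (lt_le_trans tr).
  have [Kx _ gx _] := xP t0d; have := rP t t01; rewrite peval_sqgrad.
  have [fC _] := CP _ _ (KB _ Kx) (KB _ Kx).
  have : A * t * peval f (x t) <= A * t * C.
    by apply: ler_wpM2l; [rewrite mulr_ge0 // ltW|exact: le_trans (ler_norm _) fC].
  have : t * (A * C + 1) <= e / 2.
    by rewrite -ler_pdivlMr // /t ge_min lexx orbT.
  by rewrite ltr_norml => h1 h2 /andP[h3 h4]; lra.
pose c := Num.sqrt (A * t1) / 2.
have c0 : 0 <= c by rewrite divr_ge0 // sqrtr_ge0.
(* Monotonicity replaces an integral: [W] does not increase up to [t1], because the [s i * D i] are
   the absolute values of the components of the velocity and sum to at least its norm. Letting [u]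
   tend to 0 then bounds [sqrt f] at [t1]. *)
pose W u := Num.sqrt (peval f (x u)) - c * \sum_i s i * x u ord0 i.
have Wmono u : 0 < u -> u < t1 -> W t1 <= W u.
  move=> u0 ut1.
  pose W' v := (2 * Num.sqrt (peval f (x v)))^-1 * edot (grad f (x v)) (D v) -
    c * \sum_i s i * D v ord0 i.
  have inside v : v \in `[u, t1] -> 0 < v < d.
    rewrite in_itv /= => /andP[v1 v2]; rewrite (lt_le_trans u0) //=.
    by apply: le_lt_trans v2 _; case/andP: t1d.
  have dW v : 0 < v < d -> is_derive v 1 W (W' v).
    move=> vd; have [_ fv _ xD] := xP vd.
    have h1 := is_derive_peval f (fun i => (xD i).1).
    have h2 := is_derive1_comp (is_derive1_sqrt fv) h1.
    have h3 i : is_derive v 1 (s i *: (fun w => x w ord0 i)) (s i *: D v ord0 i).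
      by have h := (xD i).1; exact: is_deriveZ.
    have h4 := is_derive_sum h3.
    have h5 := is_deriveB h2 (is_deriveZ c h4).
    suff -> : W = (Num.sqrt \o (fun u => peval f (x u))) -
      c *: \sum_(i < n) (s i *: (fun w => x w ord0 i)) by exact: h5.
    apply/funext => w; rewrite /W; congr (_ - _).
    by rewrite [RHS]/= /GRing.scale /= fct_sumE.
  have W'le v : 0 < v -> v <= t1 -> W' v <= 0.
    move=> v0 vt1; have vd : 0 < v < d.
      by rewrite v0 /=; apply: le_lt_trans vt1 _; case/andP: t1d.
    have [_ fv gv xD] := xP vd.
    set q := Num.sqrt (peval f (x v)).
    have q0 : 0 < q by rewrite sqrtr_gt0.
    have Ds : enorm (D v) <= \sum_i s i * D v ord0 i.
      apply: le_trans (enorm_le_sum _) _; apply: ler_sum => i _.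
      have := (xD i).2; case: (s1 i) => ->; rewrite ?mul1r ?mulN1r => h.
        by rewrite ger0_norm.
      by rewrite ler0_norm // -oppr_ge0.
    have gq : enorm (grad f (x v)) <= Num.sqrt (A * t1) * q.
      rewrite -ler_sqr ?nnegrE ?enorm_ge0 ?mulr_ge0 ?sqrtr_ge0 // exprMn.
      have At1 : 0 <= A * t1 by rewrite mulr_ge0 // (le_trans _ vt1) // ltW.
      rewrite /q [X in X * _]sqr_sqrtr // [X in _ * X]sqr_sqrtr ?f_ge0 //.
      by apply: (le_trans gv); rewrite ler_pM2r // ler_wpM2l.
    have := cauchy_schwarz (grad f (x v)) (D v); rewrite ler_norml => /andP[_ cs].
    have e0 := enorm_ge0 (D v).
    have h1 : edot (grad f (x v)) (D v) <= Num.sqrt (A * t1) * q * \sum_i s i * D v ord0 i.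
      by apply: le_trans cs _; apply: ler_pM => //; exact: enorm_ge0.
    rewrite /W' -/q subr_le0 ler_pdivrMl ?mulr_gt0 //; apply: le_trans h1 _.
    by rewrite /c le_eqVlt; apply/predU1P; left; field.
  have [||v vi] := MVT (f := W) (df := W') ut1.
  - by move=> v vi; apply/dW/inside; exact: subset_itv_oo_cc.
  - apply: derivable_within_continuous => v /inside vi.
    have h := dW v vi; exact: ex_derive.
  move=> E; rewrite -subr_le0 E; apply: mulr_le0_ge0; last by rewrite subr_ge0 ltW.
  by move: vi; rewrite in_itv /= => /andP[v1 v2]; apply: W'le; [exact: lt_trans v1|exact: ltW].
have final : Num.sqrt (peval f (x t1)) <= c * \sum_i s i * (x t1 ord0 i - x0 ord0 i).
  apply/ler_addgt0Pr => e e0.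
  have cn : 0 < c * n%:R + 1 by have := mulr_ge0 c0 (ler0n R n); lra.
  pose e' := e / (c * n%:R + 1).
  have e'0 : 0 < e' by rewrite divr_gt0.
  have [r1 /andP[r10 r1d] r1P] := lim _ e'0.
  have e'2 : 0 < e' ^+ 2 by rewrite exprn_gt0.
  have [r2 /andP[r20 r2d] r2P] := limp f _ e'2.
  have t10 : 0 < t1 by case/andP: t1d.
  pose u := Num.min (Num.min r1 r2) t1 / 2.
  have m0 : 0 < Num.min (Num.min r1 r2) t1 by rewrite !lt_min r10 r20.
  have u0 : 0 < u by rewrite divr_gt0.
  have um : u < Num.min (Num.min r1 r2) t1 by rewrite /u; lra.
  move: um; rewrite !lt_min => /andP[/andP[ur1 ur2] ut1].
  have ur1' : 0 < u < r1 by rewrite u0.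
  have ur2' : 0 < u < r2 by rewrite u0.
  have := Wmono u u0 ut1; rewrite /W.
  have su : Num.sqrt (peval f (x u)) <= e'.
    have := r2P u ur2'; rewrite fx0 subr0 => /(le_lt_trans (ler_norm _)) h.
    rewrite -ler_sqr ?nnegrE ?sqrtr_ge0 //; last exact: ltW.
    by rewrite sqr_sqrtr ?f_ge0 //; exact: ltW.
  have sx : \sum_i s i * x u ord0 i >= \sum_i s i * x0 ord0 i - e' * n%:R.
    rewrite lerBlDr -lerBlDl -sumrB.
    have -> : e' * n%:R = \sum_(i < n) e' by rewrite sumr_const card_ord mulr_natr.
    apply: ler_sum => i _; rewrite -mulrBr; have := r1P u ur1' i; rewrite ltr_norml.
    by case: (s1 i) => -> /andP[h1 h2]; lra.
  have sxx : \sum_i s i * (x t1 ord0 i - x0 ord0 i) =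
      \sum_i s i * x t1 ord0 i - \sum_i s i * x0 ord0 i.
    by rewrite -sumrB; apply: eq_bigr => i _; rewrite mulrBr.
  have ee : e' * (c * n%:R + 1) = e by rewrite mulfVK // gt_eqF.
  have := ler_wpM2l c0 sx; rewrite sxx => h1 h2.
  move: ee h1 h2 su; rewrite !mulrBr !mulrDr => *; lra.
rewrite xsum //; set S := \sum_i _ in final *.
have At1 : 0 <= A * t1 by rewrite mulr_ge0 //; case/andP: t1d => /ltW.
have fs : 0 <= peval f (x t1) := f_ge0 _.
rewrite -[peval f _]sqr_sqrtr // -[A * t1]sqr_sqrtr //.
have S0 : 0 <= c * S by apply: le_trans final; exact: sqrtr_ge0.
have : Num.sqrt (peval f (x t1)) ^+ 2 <= (c * S) ^+ 2.
  by rewrite ler_pXn2r // nnegrE sqrtr_ge0.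
rewrite /c !exprMn exprVn => h.
have -> : (Num.sqrt (A * t1) ^+ 2) * S ^+ 2 =
  4 * (Num.sqrt (A * t1) ^+ 2 * (2 ^+ 2)^-1 * S ^+ 2) by field.
by rewrite ler_pM2l.
Qed.
End CurveBound.

(** * The gradient inequality *)

Section GradientInequality.
Variables (R : realType) (n k : nat) (f w : mpoly.mpoly n R) (z : 'rV[R]_n) (r : R).
Hypotheses (k_gt0 : (0 < k)%N) (r_gt0 : 0 < r).
Hypothesis f_ge0 : forall x, 0 <= peval f x.

Definition ebal (z : 'rV[R]_n) (r : R) : set 'rV[R]_n := [set x | enorm (x - z) <= r].
Local Notation K := (ebal z r).

Hypothesis crit : forall x, K x -> grad f x = 0 -> peval f x = 0.
Hypothesis w_bounds : forall x, K x -> 0 <= peval w x <= 2.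
Hypothesis w_half : forall x, enorm (x - z) <= r / 2 -> 1 / 2 <= peval w x.

Definition penalized t : mpoly.mpoly n R := sqgrad f + t *: (- (w * f)).

(** Here [s] is the root [f(x)^(1/(k+2))]: this is [|grad f| >= c f^(1 - 1/L)] for [L = k + 2]. *)
Definition gradient_inequality := exists c eps, [/\ 0 < c, 0 < eps &
  forall x s, enorm (x - z) <= r / 2 -> 0 <= s -> s ^+ k.+2 = peval f x ->
    peval f x < eps -> c * s ^+ k.+1 <= enorm (grad f x)].

Lemma peval_penalized t x :
  peval (penalized t) x = enorm (grad f x) ^+ 2 - t * (peval w x * peval f x).
Proof. by rewrite pevalD pevalZ pevalN pevalM peval_sqgrad mulrN. Qed.

(** Here [|grad f|] is at least a multiple of [f^(1/2)], which is stronger since [f <= 1] and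
    [2 (k + 1) >= k + 2]. Once this case is excluded, the penalized minimum is negative for every
    [t > 0]. *)
Lemma gradient_inequality_nonneg t : 0 < t ->
  (forall y, K y -> 0 <= peval (penalized t) y) -> gradient_inequality.
Proof.
move=> t0 tP; pose c := Num.min 1 (t / 2).
have c0 : 0 < c by rewrite lt_min ltr01 divr_gt0.
exists c, 1; split=> // x s xr s0 sf f1.
have Kx : K x by apply: le_trans xr _; have := r_gt0; lra.
have s1 : s <= 1.
  by rewrite leNgt; apply/negP => s1; move: f1; rewrite -sf ltNge exprn_ege1 // ltW.
have := tP x Kx; rewrite peval_penalized -sf => h.
have h2 : c ^+ 2 * s ^+ k.+2 <= enorm (grad f x) ^+ 2.
  have sk : 0 <= s ^+ k.+2 by rewrite exprn_ge0.
  have : t * (1 / 2) * s ^+ k.+2 <= t * (peval w x * s ^+ k.+2).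
    by rewrite -mulrA ler_pM2l // ler_wpM2r // w_half.
  have : c ^+ 2 * s ^+ k.+2 <= t / 2 * s ^+ k.+2.
    rewrite ler_wpM2r // expr2 -[leRHS]mul1r ler_pM ?(ltW c0) ///c ge_min lexx ?orbT //.
  by move=> *; lra.
rewrite -ler_sqr ?nnegrE ?enorm_ge0 ?mulr_ge0 ?exprn_ge0 ?(ltW c0) //.
apply: le_trans h2; rewrite exprMn ler_wpM2l ?exprn_ge0 ?(ltW c0) //.
by rewrite -exprM ler_wiXn2l //; clear; lia.
Qed.

Variables (S : R -> set 'rV[R]_n) (t0 : R).
Hypothesis t0_gt0 : 0 < t0.
Hypothesis negative : forall t, 0 < t -> exists2 y, K y & peval (penalized t) y < 0.
Hypothesis S_def : forall j, (0 < j)%N -> definable (fun e => S (e 0%N) (rvof j n e)).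
Hypothesis S_min : forall t x, S t x ->
  K x /\ forall y, K y -> peval (penalized t) x <= peval (penalized t) y.
Hypothesis S_compact : forall t, 0 < t < t0 -> S t !=set0 /\ compact (S t).
(** The alternative in terms of [t] serves in high dimension, the one in terms of the value of [f]
    in the plane. *)
Hypothesis S_estimate : forall (x : R -> 'rV[R]_n) (x0 : 'rV[R]_n) d, 0 < d ->
  (forall t, 0 < t < d -> S t (x t) /\ 0 < peval f (x t)) ->
  (forall e, 0 < e -> exists2 r, 0 < r <= d & forall t, 0 < t < r ->
     forall i, `|x t ord0 i - x0 ord0 i| < e) ->
  exists C d', [/\ 0 < C, 0 < d' & forall t, 0 < t < d' -> forall i,
    `|x t ord0 i - x0 ord0 i| ^+ k <= C * t \/
    `|x t ord0 i - x0 ord0 i| ^+ k.+2 <= C * peval f (x t)].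

(** With [u = f(x t)] and [dl] a large coordinate of [x t - x0], [curve_bound] gives
    [u <= B t dl^2]. If [dl^k <= C t], take the [k]-th power. If [dl^(k+2) <= C u], take the power
    [k + 2] and divide by [u^2], which is positive. *)
Lemma minimizer_curve_bound : exists (x : R -> 'rV[R]_n) C d, [/\ 0 < C, 0 < d &
  forall t, 0 < t < d -> S t (x t) /\ peval f (x t) ^+ k <= C * t ^+ k.+2].
Proof.
have [x [D [s [d [/andP[d0 dt0] s1 xP]]]]] := curve_selection S_def t0_gt0 S_compact.
have xneg t : 0 < t < d -> [/\ K (x t), 0 < peval f (x t) &
    enorm (grad f (x t)) ^+ 2 <= 2 * t * peval f (x t)].
  move=> td; have [Sx _] := xP t td; have [Kx xmin] := S_min Sx.
  have tp : 0 < t by case/andP: td.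
  have [y Ky yneg] := negative tp.
  have := le_lt_trans (xmin y Ky) yneg; rewrite peval_penalized => h.
  have /andP[w0 w2] := w_bounds Kx.
  have g0 : 0 <= enorm (grad f (x t)) ^+ 2 := sqr_ge0 _.
  have fx : 0 < peval f (x t).
    rewrite lt_neqAle f_ge0 andbT; apply/eqP => fx0.
    by move: h; rewrite -fx0 mulr0 mulr0 subr0 ltNge g0.
  split=> //; have : t * (peval w (x t) * peval f (x t)) <= t * (2 * peval f (x t)).
    by rewrite ler_pM2l // ler_pM2r.
  by move=> *; lra.
have xQ t : 0 < t < d -> [/\ K (x t), 0 < peval f (x t),
    enorm (grad f (x t)) ^+ 2 <= 2 * t * peval f (x t) &
    forall i, is_derive t 1 (fun u => x u ord0 i) (D t ord0 i) /\ 0 <= s i * D t ord0 i].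
  by move=> td; have [? ? ?] := xneg t td; have [_] := xP t td.
have clK : closed K.
  exact: (closed_comp (fun x _ => @enorm_continuous _ _ z x) (@closed_le R r)).
have [x0 [xlim xb]] := curve_bound f_ge0 (@compact_eball _ _ z r) clK crit d0
  (ler0n R 2) s1 xQ.
have [|C [d' [C0 d'0 est]]] := S_estimate d0 _ xlim.
  by move=> t td; have [_ fx _] := xneg t td; have [Sx _] := xP t td.
pose B : R := n.+1%:R ^+ 2.
have B1 : 1 <= B by rewrite /B exprn_ege1 // ler1n.
have B0 : 0 < B by exact: lt_le_trans B1.
exists x, (B ^+ k.+2 * C ^+ 2), (Num.min d d'); split.
- by rewrite mulr_gt0 // exprn_gt0.
- by rewrite lt_min d0.
move=> t /andP[tp]; rewrite lt_min => /andP[td td'].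
have tdd : 0 < t < d by rewrite tp.
have tdd' : 0 < t < d' by rewrite tp.
split; first by have [] := xP t tdd.
have [_ fx _] := xneg t tdd; have := xb t tdd.
set u := peval f (x t) in fx *; set Sg := \sum_i _ => h4.
have Sg0 : 0 < Sg.
  rewrite lt_neqAle sumr_ge0 // andbT; apply/eqP => S0.
  by move: h4; rewrite -S0 expr0n /= mulr0; lra.
have [i iP] : exists i, Sg <= n.+1%:R * `|x t ord0 i - x0 ord0 i|.
  apply: contrapT => /forallNP ni.
  have lei i : n.+1%:R * `|x t ord0 i - x0 ord0 i| <= Sg.
    by rewrite ltW // ltNge; apply/negP.
  have := ler_sum (index_enum 'I_n) (fun i (_ : true) => lei i).
  rewrite -mulr_sumr -/Sg sumr_const card_ord -[leRHS]mulr_natr -natr1.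
  by move=> ?; lra.
set dl := `|_| in iP; have dl0 : 0 <= dl by exact: normr_ge0.
have ub : u <= B * t * dl ^+ 2.
  have : Sg ^+ 2 <= (n.+1%:R * dl) ^+ 2.
    apply: (lerXn2r _ _ _ iP); rewrite nnegrE; first exact: ltW.
    exact: mulr_ge0.
  rewrite exprMn -/B => h5.
  have : 2 * t * Sg ^+ 2 <= 2 * t * (B * dl ^+ 2) by rewrite ler_pM2l // mulr_gt0.
  have : 0 <= t * (B * dl ^+ 2).
    by apply: mulr_ge0; [exact: ltW|apply: mulr_ge0; [exact: ltW|exact: exprn_ge0]].
  by move=> *; lra.
clearbody B; have pw a : u ^+ a <= B ^+ a * t ^+ a * (dl ^+ a) ^+ 2.
  have -> : B ^+ a * t ^+ a * (dl ^+ a) ^+ 2 = (B * t * dl ^+ 2) ^+ a.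
    by rewrite !exprMn expr2.
  have u0 := le_trans (ltW fx) ub.
  by apply: lerXn2r => //; rewrite nnegrE // ltW.
have [h|h] := est t tdd' i; rewrite -/dl in h.
  have hsq : (dl ^+ k) ^+ 2 <= (C * t) ^+ 2.
    by rewrite ler_pXn2r // nnegrE ?exprn_ge0 // mulr_ge0 // ltW.
  apply: le_trans (pw k) _.
  apply: (@le_trans _ _ (B ^+ k * t ^+ k * (C * t) ^+ 2)).
    by rewrite ler_wpM2l // mulr_ge0 // exprn_ge0 // ltW.
  rewrite (_ : _ * (C * t) ^+ 2 = B ^+ k * (C ^+ 2 * t ^+ k.+2)); last first.
    by rewrite exprMn !exprS; ring.
  rewrite -[leRHS]mulrA; apply: ler_wpM2r; last by rewrite ler_weXn2l // ltnW.
  by apply: mulr_ge0; apply: exprn_ge0; exact: ltW.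
have hsq : (dl ^+ k.+2) ^+ 2 <= (C * u) ^+ 2.
  by rewrite ler_pXn2r // nnegrE ?exprn_ge0 // mulr_ge0 // ltW.
have : u ^+ k.+2 <= B ^+ k.+2 * t ^+ k.+2 * (C * u) ^+ 2.
  apply: le_trans (pw k.+2) _; apply: ler_wpM2l => //.
  by apply: mulr_ge0; apply: exprn_ge0; exact: ltW.
have -> : u ^+ k.+2 = u ^+ k * u ^+ 2 by rewrite -exprD addn2.
have -> : B ^+ k.+2 * t ^+ k.+2 * (C * u) ^+ 2 =
  B ^+ k.+2 * C ^+ 2 * t ^+ k.+2 * u ^+ 2 by rewrite exprMn; ring.
have u2 : 0 < u ^+ 2 by exact: exprn_gt0.
by rewrite (ler_pM2r u2).
Qed.

(* Comparing the value of [penalized f w t] at [x t] and at the given point, for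
   [t] a small multiple of [s ^+ k]. *)
Lemma gradient_inequality_curve : gradient_inequality.
Proof.
have [x [C [d [C0 d0 xP]]]] := minimizer_curve_bound.
(* Gives [f(x t) <= s^(k+2) / 8] for [t = q s^k]. As the weight is at most 2 at [x t] and at least
   1/2 at [y], the difference [1/2 - 2/8] leaves [|grad f y|^2 >= t s^(k+2) / 4]. *)
pose q := Num.min 1 (C * 8 ^+ k)^-1.
have q0 : 0 < q by rewrite lt_min ltr01 invr_gt0 mulr_gt0 // exprn_gt0.
have q1 : q <= 1 by rewrite /q ge_min lexx.
have qC : q ^+ k.+2 * C <= (8 ^+ k)^-1.
  have : q ^+ k.+2 <= q by rewrite exprS -[leRHS]mulr1 ler_pM2l // exprn_ile1 // ltW.
  have h1 : q <= (C * 8 ^+ k)^-1 by rewrite /q ge_min lexx orbT.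
  move=> h2; apply: (@le_trans _ _ ((C * 8 ^+ k)^-1 * C)).
    by rewrite ler_pM2r //; exact: le_trans h2 h1.
  by rewrite invfM mulrAC mulVf ?mul1r // gt_eqF.
pose m := Num.min 1 d.
have m0 : 0 < m by rewrite lt_min ltr01.
exists (q / 2), (m ^+ k.+2); split; [by rewrite divr_gt0|by rewrite exprn_gt0|].
move=> y s yr s_ge0 sf fm.
have [->|s_neq0] := eqVneq s 0; first by rewrite expr0n mulr0 enorm_ge0.
have s_gt0 : 0 < s by rewrite lt_neqAle eq_sym s_neq0.
have sm : s < m.
  rewrite ltNge; apply/negP => ms; move: fm; apply/negP; rewrite -leNgt -sf.
  by rewrite ler_pXn2r ?nnegrE // ltW.
move: (sm); rewrite lt_min => /andP[s_lt1 sd].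
pose t := q * s ^+ k.
have tp : 0 < t by rewrite mulr_gt0 // exprn_gt0.
have td : 0 < t < d.
  rewrite tp /=; apply: (le_lt_trans _ sd).
  have sk : s ^+ k <= s by rewrite -[leRHS]expr1; apply: ler_wiXn2l => //; exact: ltW.
  by apply: (le_trans _ sk); apply: ler_piMl => //; exact: exprn_ge0.
have [Sx xk] := xP t td; have [Kx xmin] := S_min Sx.
have Ky : K y by apply: le_trans yr _; have := r_gt0; lra.
have u8 : peval f (x t) <= s ^+ k.+2 / 8.
  rewrite -(ler_pXn2r k_gt0) ?nnegrE ?divr_ge0 ?exprn_ge0 //.
  apply: (le_trans xk).
  have -> : C * t ^+ k.+2 = (s ^+ k.+2) ^+ k * (q ^+ k.+2 * C).
    by rewrite /t exprMn (exprAC s); ring.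
  by rewrite expr_div_n; apply: ler_wpM2l => //; rewrite !exprn_ge0.
have := xmin y Ky; rewrite !peval_penalized -sf.
have /andP[w0 w2] := w_bounds Kx; have wy := w_half yr.
have g0 : 0 <= enorm (grad f (x t)) ^+ 2 := sqr_ge0 _.
have h1 : t * (peval w (x t) * peval f (x t)) <= t * (2 * (s ^+ k.+2 / 8)).
  by rewrite ler_pM2l // ler_pM.
have h2 : t * (1 / 2 * s ^+ k.+2) <= t * (peval w y * s ^+ k.+2).
  by rewrite ler_pM2l // ler_pM2r // exprn_gt0.
move=> h3; have h4 : t * s ^+ k.+2 / 4 <= enorm (grad f y) ^+ 2 by lra.
rewrite -ler_sqr ?nnegrE ?enorm_ge0 ?mulr_ge0 ?exprn_ge0 ?divr_ge0 ?(ltW q0) //.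
apply: le_trans h4; rewrite /t.
have -> : q * s ^+ k * s ^+ k.+2 / 4 = q * 1 * (s ^+ k.+1) ^+ 2 / 4.
  have E : s ^+ k * s ^+ k.+2 = (s ^+ k.+1) ^+ 2.
    by rewrite -exprD -exprM; congr (s ^+ _); clear; lia.
  by rewrite -[q * _ * _]mulrA E mulr1.
rewrite (_ : (q / 2 * s ^+ k.+1) ^+ 2 = q * q * (s ^+ k.+1) ^+ 2 / 4); last by field.
by rewrite ler_pM2r ?invr_gt0 // ler_pM2r ?ler_pM2l // !exprn_gt0.
Qed.
End GradientInequality.

Section ArgMin.
Variables (R : realType) (n : nat) (F G : mpoly.mpoly n R) (z : 'rV[R]_n) (r : R).
Hypothesis r_gt0 : 0 < r.

Definition argmin t : set 'rV[R]_n := [set x | ebal z r x /\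
  forall y, ebal z r y -> peval (F + t *: G) x <= peval (F + t *: G) y].

Lemma ebal_center : ebal z r z.
Proof. by rewrite /ebal /= subrr enorm0 ltW. Qed.

Lemma argmin_compact t : argmin t !=set0 /\ compact (argmin t).
Proof.
have K0 : ebal z r !=set0 by exists z; exact: ebal_center.
have [c Kc cmin] := compact_min K0 (@compact_eball _ _ z r)
  (@peval_continuous _ _ (F + t *: G)).
split; first by exists c.
have -> : argmin t = ebal z r `&` [set x | peval (F + t *: G) x <= peval (F + t *: G) c].
  apply/seteqP; split => x [Kx xmin]; split => //; first exact: xmin.
  by move=> y /cmin; apply: le_trans.
by apply: compact_closedI; [exact: compact_eball|exact: closed_peval_le].
Qed.

Lemma definable_argmin j : (0 < j)%N ->
  definable (fun e => argmin (e 0%N) (rvof j n e)).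
Proof.
move=> j0; apply: definable_and; first by apply: definable_eball; exact: ltW.
apply: (definable_ext (P := fun e => ~ exists y : 'rV[R]_n, enorm (y - z) <= r /\
    ~ (peval F (rvof j n e) + e 0%N * peval G (rvof j n e) <=
       peval F y + e 0%N * peval G y))).
  move=> e; split=> [h y Ky|h [y [Ky]]]; last first.
    by apply; have := h y Ky; rewrite !pevalD !pevalZ.
  by rewrite !pevalD !pevalZ; apply: contrapT => ny; apply: h; exists y.
apply/definable_not/(definable_ex_rv (k := (j + n)%N)).
  by move=> e y; rewrite rvof_setv_lt // setv_lt // addn_gt0 j0.
apply: definable_and; first by apply: definable_eball; exact: ltW.
apply/definable_not/definable_le; apply: definable_funD; try exact: definable_fun_peval;
  by apply: definable_funM; [exact: definable_fun_var|exact: definable_fun_peval].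
Qed.
End ArgMin.

(** * Gradient inequality by elimination with respect to [t] *)

Section HighDimension.
Variables (R : realType) (n D k : nat) (f : mpoly.mpoly n R) (z : 'rV[R]_n) (r : R).
Hypotheses (D_ge4 : (4 <= D)%N) (k_gt0 : (0 < k)%N).
Hypothesis k_large : ((2 * D - 3) ^ n <= k)%N.
Hypothesis size_f : (mpoly.msize f <= D.+1)%N.
Hypothesis f_ge0 : forall x, 0 <= peval f x.
Hypothesis r_gt0 : 0 < r.
Hypothesis crit : forall x, ebal z r x -> grad f x = 0 -> peval f x = 0.

(* Vanishes on the boundary sphere, which keeps the minimisers inside the ball. *)
Definition cap : mpoly.mpoly n R := mpoly.mpolyC n 1 - r ^- 2 *: sqdist z.

Lemma peval_cap x : peval cap x = 1 - (enorm (x - z) / r) ^+ 2.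
Proof. by rewrite pevalB pevalC pevalZ peval_sqdist expr_div_n mulrC. Qed.

Lemma msize_sqgrad : (mpoly.msize (sqgrad f) <= (2 * D.-1).+1)%N.
Proof.
apply: msize_sum_leq => i; apply: msizeXn_leq; apply: msize_mderiv.
by rewrite prednK //; clear -D_ge4; lia.
Qed.

Theorem gradient_inequality_high_dim : gradient_inequality k f z r.
Proof.
have capb x : ebal z r x -> 0 <= peval cap x <= 2.
  move=> xr; rewrite peval_cap.
  have h1 : 0 <= enorm (x - z) / r by rewrite divr_ge0 ?enorm_ge0 // ltW.
  have h2 : enorm (x - z) / r <= 1 by rewrite ler_pdivrMr // mul1r.
  by rewrite expr2; nra.
have caph x : enorm (x - z) <= r / 2 -> 1 / 2 <= peval cap x.
  move=> xr; rewrite peval_cap.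
  have h1 : 0 <= enorm (x - z) / r by rewrite divr_ge0 ?enorm_ge0 // ltW.
  have h2 : enorm (x - z) / r <= 1 / 2 by rewrite ler_pdivrMr // mul1r mulrC.
  by rewrite expr2; nra.
pose G := - (cap * f).
have [[t t0 tP]|nneg] := pselect (exists2 t, 0 < t &
    forall y, ebal z r y -> 0 <= peval (penalized f cap t) y).
  exact: (gradient_inequality_nonneg k r_gt0 caph t0 tP).
have neg t : 0 < t -> exists2 y, ebal z r y & peval (penalized f cap t) y < 0.
  move=> t0; apply: contrapT => ne; apply: nneg; exists t => // y Ky.
  by rewrite leNgt; apply/negP => yneg; apply: ne; exists y.
(* The degree of the derivatives of [sqgrad f]. Those of [cap * f] have degree at most [D + 1],
   which does not exceed it because [D >= 4]. *)
pose m := (2 * D - 3)%N.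
have m0 : (0 < m)%N by rewrite /m; clear -D_ge4; lia.
have sF i : (mpoly.msize (mpoly.mderiv i (sqgrad f)) <= m.+1)%N.
  apply: msize_mderiv; apply: leq_trans msize_sqgrad _.
  by rewrite /m; clear -D_ge4; lia.
have sG i : (mpoly.msize (mpoly.mderiv i G) <= m.+1)%N.
  apply: msize_mderiv; apply: msizeN_leq.
  apply: (@leq_trans (2 + D).+1); last by rewrite /m; clear -D_ge4; lia.
  apply: msizeM_leq => //; apply: msizeD_leq; first exact: msizeC_leq.
  by apply: msizeN_leq; apply: msizeZ_leq; exact: msize_sqdist.
have K0 : ebal z r !=set0 by exists z; exact: ebal_center.
have KB x : ebal z r x -> enorm x <= r + enorm z.
  by rewrite /ebal /= => Kx; have := enormD (x - z) z; rewrite subrK; lra.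
have [Q [QP Qmin]] := minimizer_elimination m0 sF sG K0 (@compact_eball _ _ z r) KB.
pose q t : mpoly.mpoly n R := \sum_(i < n) (\sum_(j < size (Q i))
  ((Q i)`_j).[t] *: mpoly.mpolyX R (mpoly.mnm1 i) ^+ j) ^+ 2.
have qE t x : peval (q t) x = \sum_i ((Q i).[(x ord0 i)%:P].[t]) ^+ 2.
  rewrite peval_sum; apply: eq_bigr => i _; rewrite pevalXn peval_sum; congr (_ ^+ 2).
  rewrite (horner_coef (Q i)) horner_sum; apply: eq_bigr => j _.
  by rewrite pevalZ pevalXn pevalX hornerM -rmorphXn /= hornerC.
(* Elimination only provides some minimiser satisfying the equations, so these are imposed, as one
   sum of squares, before a curve is selected. *)
pose S t : set 'rV[R]_n := argmin (sqgrad f) G z r t `&` [set x | peval (q t) x = 0].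
have Sroot t x i : S t x -> (Q i).[(x ord0 i)%:P].[t] = 0.
  move=> [_ /=]; rewrite qE => /eqP; rewrite psumr_eq0 => [|j _]; last exact: sqr_ge0.
  by move=> /allP /(_ i (mem_index_enum i)); rewrite sqrf_eq0 => /eqP.
apply: (@gradient_inequality_curve R n k f cap z r k_gt0 r_gt0 f_ge0 crit capb caph
  S 1 ltr01 neg).
- move=> j j0; apply: definable_and; first exact: definable_argmin.
  apply: (definable_ext (P := fun e =>
      \sum_i (Q i).[(e (j + i)%N)%:P].[e 0%N] ^+ 2 = 0)).
    move=> e /=; rewrite qE; suff -> : \sum_i (Q i).[(rvof j n e ord0 i)%:P].[e 0%N] ^+ 2 =
      \sum_i (Q i).[(e (j + i)%N)%:P].[e 0%N] ^+ 2 by [].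
    by apply: eq_bigr => i _; rewrite mxE.
  apply: definable_eq; last exact: definable_fun_cst.
  apply: definable_fun_sum => i; apply: definable_funX.
  by apply: definable_fun_horner2; exact: definable_fun_var.
- by move=> t x [].
- move=> t /andP[t0 _]; split; last first.
    by apply: compact_closedI; [exact: (argmin_compact _ _ _ r_gt0 _).2|exact: closed_peval_eq].
  have [|x [Kx xmin xQ]] := Qmin t.
    move=> x Kx xmin; have [y Ky yneg] := neg t t0.
    have xr : enorm (x - z) < r.
      rewrite lt_neqAle Kx andbT; apply/eqP => xr.
      have := le_lt_trans (xmin y Ky) yneg.
      rewrite -/(penalized f cap t) peval_penalized peval_cap xr divff ?gt_eqF //.
      by rewrite expr1n subrr mul0r mulr0 subr0 ltNge sqr_ge0.
    exists (r - enorm (x - z)); first by rewrite subr_gt0.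
    by move=> v; have := enorm_triangle x v z; rewrite /ebal /=; lra.
  exists x; split=> //=; rewrite qE big1 // => i _.
  by rewrite xQ expr0n.
move=> x x0 d d0 xS xlim.
have H i : exists Cd : R * R, [/\ 0 < Cd.1, 0 < Cd.2 & forall t, 0 < t < Cd.2 ->
    `|x t ord0 i - x0 ord0 i| ^+ k <= Cd.1 * t].
  have [Q0 sQ] := QP i.
  have [C [e [C0 e0 CP]]] := root_order (x0 ord0 i) Q0 sQ.
  have e1 : 0 < Num.min e 1 by rewrite lt_min e0 ltr01.
  have [r' /andP[r'0 r'd] r'P] := xlim _ e1.
  exists (C, Num.min r' e); split => //=; first by rewrite lt_min r'0.
  move=> t; rewrite lt_min => /and3P[t0 tr te].
  have tr' : 0 < t < r' by rewrite t0.
  have := r'P t tr' i; rewrite lt_min => /andP[xe x1].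
  have td : 0 < t < d by rewrite t0 (lt_le_trans tr).
  apply: (@le_trans _ _ (`|x t ord0 i - x0 ord0 i| ^+ (m ^ n))).
    by apply: ler_wiXn2l => //; exact: ltW.
  by apply: CP => //; [rewrite t0|apply: Sroot; exact: (xS t td).1].
have [Cd CdP] := choice H.
exists (1 + \sum_i (Cd i).1), (\big[Num.min/1]_i (Cd i).2); split.
- by rewrite ltr_pwDl // sumr_ge0 // => i _; case: (CdP i) => /ltW.
- by apply: lt_bigmin => // i _; case: (CdP i).
move=> t /andP[t0 td] i; left; have [_ _ h] := CdP i.
apply: le_trans (h t _) _; first by rewrite t0 (lt_le_trans td) // bigmin_le.
rewrite ler_pM2r // (bigD1 i) //=.
have : 0 <= \sum_(j < n | j != i) (Cd j).1.
  by rewrite sumr_ge0 // => j _; case: (CdP j) => /ltW.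
by lra.
Qed.
End HighDimension.

(** * Gradient inequality in the plane *)

Lemma linear_dependence (F : fieldType) (I J : finType) (M : I -> J -> F) :
  (#|J| < #|I|)%N -> exists v : I -> F,
    (exists i, v i != 0) /\ forall j, \sum_i v i * M i j = 0.
Proof.
move=> lt; pose A : 'M[F]_(#|I|, #|J|) := \matrix_(i, j) M (enum_val i) (enum_val j).
have kA : kermx A != 0.
  rewrite -mxrank_eq0 mxrank_ker -lt0n subn_gt0.
  exact: leq_ltn_trans (rank_leq_col A) lt.
have /rowV0Pn[v /sub_kermxP vA /rV0Pn[i vi]] := kA.
exists (fun i => v 0 (enum_rank i)); split; first by exists (enum_val i); rewrite enum_valK.
move=> j; have /rowP/(_ (enum_rank j)) := vA; rewrite !mxE => sE.
rewrite -[RHS]sE (reindex (@enum_val I I)) /=; last exact/onW_bij/enum_val_bij.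
by apply: eq_bigr => k _; rewrite enum_valK mxE enum_rankK.
Qed.

Section PlaneElimination.
Variables (R : realType).

(** A monomial of degree above [T - e] is determined by [T] minus its degree, which is less than
    [e], and by its first exponent, at most [T]. *)
Lemma card_bmultinom2 T e : (0 < e <= T)%N ->
  (#|{: mpoly.bmultinom 2 T.+1}| <= #|{: mpoly.bmultinom 2 (T - e).+1}| + e * T.+1)%N.
Proof.
case/andP=> e0 eT.
pose h (m : mpoly.bmultinom 2 T.+1) : (mpoly.bmultinom 2 (T - e).+1 + 'I_e * 'I_T.+1)%type :=
  match @idP (mpoly.mdeg (mpoly.bmnm m) < (T - e).+1)%N with
  | ReflectT lt => inl (mpoly.BMultinom lt)
  | ReflectF _ => inr (insubd (Ordinal e0) (T - mpoly.mdeg (mpoly.bmnm m))%N,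
      insubd ord0 (mpoly.bmnm m ord0))
  end.
have -> : (#|{: mpoly.bmultinom 2 (T - e).+1}| + e * T.+1 =
  #|{: mpoly.bmultinom 2 (T - e).+1 + 'I_e * 'I_T.+1}|)%N.
  by rewrite card_sum card_prod !card_ord.
apply: (leq_card h) => m1 m2; rewrite /h.
case: {-}_ / idP => lt1; case: {-}_ / idP => lt2 // [].
  by move=> E; apply/eqP; rewrite mpoly.bmeqP E.
move=> /(congr1 val); rewrite !val_insubd.
have d1 := mpoly.bmdeg m1; have d2 := mpoly.bmdeg m2.
move/negP: lt1 => lt1; move/negP: lt2 => lt2; rewrite -leqNgt in lt1.
rewrite -leqNgt in lt2; rewrite !ifT; [|by clear -e0 d2 lt2 eT; lia|by clear -e0 d1 lt1 eT; lia].
move=> dE /(congr1 val); rewrite !val_insubd.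
have dE' (m : mpoly.multinom 2) : mpoly.mdeg m = (m ord0 + m ord_max)%N.
  rewrite mpoly.mdegE big_ord_recl big_ord1; congr (_ + m _)%N; exact: val_inj.
rewrite !ifT; [|by move: d2; rewrite dE'; clear; lia|by move: d1; rewrite dE'; clear; lia].
move=> m0; apply/eqP; rewrite mpoly.bmeqP; apply/eqP/mpoly.mnmP => i.
have m1E : mpoly.bmnm m1 ord_max = mpoly.bmnm m2 ord_max.
  by move: dE d1 d2 m0; rewrite !dE'; clear; lia.
case: (unliftP ord0 i) => [j ->|-> //]; rewrite ord1.
by rewrite (_ : lift _ _ = ord_max) //; exact: val_inj.
Qed.

(* Among the [x_i^j f^a] with [j <= J], [a <= A] and the [E x^m] of degree at most [T] there
   are more polynomials than monomials of degree at most [T], hence a dependency. *)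
Lemma plane_elimination (f E : mpoly.mpoly 2 R) D e i : (0 < D)%N -> (0 < e)%N ->
  (mpoly.msize f <= D.+1)%N -> (mpoly.msize E <= e.+1)%N -> E != 0 ->
  exists P : {poly {poly R}}, [/\ P != 0, (size P <= (D * e).+1)%N &
    forall x, peval E x = 0 -> P.[(x ord0 i)%:P].[peval f x] = 0].
Proof.
(* The choice of [A] makes the count work: [e (T + 1) = A J + A], which is less than
   [(A + 1) (J + 1)]. *)
move=> D0 e0 sf sE E0; pose J := (D * e)%N; pose A := (e * J + e)%N.
pose T := (D * A + J)%N.
have eT : (0 < e <= T)%N by rewrite e0 /T /A; clear -D0; nia.
pose p (k : ('I_A.+1 * 'I_J.+1) + mpoly.bmultinom 2 (T - e).+1) : mpoly.mpoly 2 R :=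
  match k with
  | inl aj => f ^+ aj.1 * mpoly.mpolyX R (mpoly.mnm1 i) ^+ aj.2
  | inr m => E * mpoly.mpolyX R (mpoly.bmnm m)
  end.
have sp k : (mpoly.msize (p k) <= T.+1)%N.
  case: k => [[a j]|m] /=.
    apply: (@leq_trans (a * D + j * 1).+1).
      by apply: msizeM_leq; apply: msizeXn_leq => //; exact: msizeXU_leq.
    have := ltn_ord a; have := ltn_ord j; rewrite /T; move: (val a) (val j) => a' j'.
    by clear; nia.
  have md := mpoly.bmdeg m.
  apply: (@leq_trans (e + mpoly.mdeg (mpoly.bmnm m)).+1).
    by apply: msizeM_leq => //; rewrite mpoly.msizeX.
  by move: md eT; clear; lia.
pose M k (m : mpoly.bmultinom 2 T.+1) := mpoly.mcoeff (mpoly.bmnm m) (p k).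
have [|v [[k0 vk0] vM]] := @linear_dependence R _ _ M.
  rewrite card_sum card_prod !card_ord.
  apply: leq_ltn_trans (card_bmultinom2 eT) _.
  by rewrite addnC ltn_add2r /T /A; clear -e0; nia.
have sum0 : \sum_k v k *: p k = 0.
  apply/mpoly.mpolyP => m; rewrite mpoly.mcoeff0 (raddf_sum (mpoly.mcoeff m)) /=.
  have [mT|mT] := ltnP (mpoly.mdeg m) T.+1.
    rewrite -[RHS](vM (mpoly.BMultinom mT)); apply: eq_bigr => k _.
    by rewrite mpoly.mcoeffZ.
  rewrite big1 // => k _; rewrite mpoly.mcoeffZ mpoly.memN_msupp_eq0 ?mulr0 //.
  by apply: mpoly.msize_mdeg_ge; exact: leq_trans (sp k) mT.
rewrite big_sumType /= in sum0.
pose b := \sum_m v (inr m) *: mpoly.mpolyX R (mpoly.bmnm m).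
have sumb : \sum_m v (inr m) *: (E * mpoly.mpolyX R (mpoly.bmnm m)) = E * b.
  by rewrite mulr_sumr; apply: eq_bigr => m _; rewrite scalerAr.
pose c (j : nat) := \poly_(a < A.+1) v (inl (inord a, inord j)).
pose P := \poly_(j < J.+1) c j.
have PE (x : 'rV[R]_2) : P.[(x ord0 i)%:P].[peval f x] =
    peval (\sum_aj v (inl aj) *: (f ^+ aj.1 * mpoly.mpolyX R (mpoly.mnm1 i) ^+ aj.2)) x.
  have -> : \sum_aj v (inl aj) *: (f ^+ aj.1 * mpoly.mpolyX R (mpoly.mnm1 i) ^+ aj.2) =
    \sum_(j < J.+1) \sum_(a < A.+1)
      v (inl (a, j)) *: (f ^+ a * mpoly.mpolyX R (mpoly.mnm1 i) ^+ j).
    by rewrite exchange_big pair_bigA; apply: eq_bigr => -[].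
  rewrite peval_sum.
  rewrite horner_poly horner_sum; apply: eq_bigr => j _.
  rewrite hornerM -rmorphXn /= hornerC horner_poly mulr_suml peval_sum.
  apply: eq_bigr => a _; rewrite pevalZ pevalM !pevalXn pevalX !inord_val.
  by rewrite mulrA.
exists P; split; last 2 first.
- exact: size_poly.
- move=> x Ex; rewrite PE; have /(congr1 (fun q => peval q x)) := sum0.
  by rewrite sumb pevalD pevalM Ex mul0r addr0 => ->; exact: mpoly.meval0.
(* If all coefficients of the [f^a x_i^j] vanished, then [E * b = 0], hence [b = 0], and the
   dependency would be trivial. *)
apply/eqP => P0.
have c0 aj : v (inl aj) = 0.
  case: aj => a j; have := congr1 (fun q : {poly {poly R}} => (q`_j)`_a) P0.
  by rewrite /= coef0 coef0 coef_poly ltn_ord coef_poly ltn_ord !inord_val.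
move: sum0; rewrite big1 ?add0r => [|aj _]; last by rewrite c0 scale0r.
rewrite sumb => /eqP; rewrite mulf_eq0 (negbTE E0) /= => /eqP b0.
case: k0 vk0 => [aj|m]; first by rewrite c0 eqxx.
have := congr1 (mpoly.mcoeff (mpoly.bmnm m)) b0.
rewrite mpoly.mcoeff0 (raddf_sum (mpoly.mcoeff _)) /= (bigD1 m) //= mpoly.mcoeffZ.
rewrite mpoly.mcoeffX eqxx mulr1 big1 ?addr0 => [->|m' m'm]; first by rewrite eqxx.
rewrite mpoly.mcoeffZ mpoly.mcoeffX (_ : _ == _ = false) ?mulr0 //.
by apply/negbTE; rewrite -mpoly.bmeqP.
Qed.
End PlaneElimination.

Lemma peval_constant (R : realType) n (p : mpoly.mpoly n R) :
  (forall x, grad p x = 0) -> forall x y, peval p x = peval p y.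
Proof.
move=> p0 x y; pose X (t : R) : 'rV[R]_n := x + t *: (y - x).
have dX (t : R) i : is_derive t (1 : R) (fun u => X u ord0 i) ((y - x) ord0 i).
  rewrite (_ : (fun u => _) = cst (x ord0 i) + (fun u => u * (y - x) ord0 i)); last first.
    by apply/funext => u; rewrite /X !mxE.
  rewrite -[X in is_derive _ _ _ X]add0r; apply: is_deriveD.
  rewrite (_ : (fun u => _) = (y - x) ord0 i \*: (@id R)).
    by apply: is_derive_eq; rewrite [LHS]mulr1.
  by apply/funext => u; rewrite mulrC.
have h (t : R) : is_derive t (1 : R) (fun u => peval p (X u)) 0.
  have := is_derive_peval p (dX t); rewrite p0.
  by rewrite -(scale0r (0 : 'rV[R]_n)) edotZl mul0r.
have := @is_derive_0_is_cst R (fun u => peval p (X u)) 0 1 h; rewrite /X scale0r addr0 scale1r.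
by rewrite addrC subrK.
Qed.

Section Plane.
Variables (R : realType) (D k : nat) (f : mpoly.mpoly 2 R) (z : 'rV[R]_2) (r : R).
Hypotheses (D_ge4 : (4 <= D)%N) (k_gt0 : (0 < k)%N).
Hypothesis k_eq : k.+2 = (D * (3 * D - 3))%N.
Hypothesis size_f : (mpoly.msize f <= D.+1)%N.
Hypothesis f_ge0 : forall x, 0 <= peval f x.
Hypotheses (fz : peval f z = 0) (r_gt0 : 0 < r).
Hypothesis crit : forall x, ebal z r x -> grad f x = 0 -> peval f x = 0.

Definition jac (p q : mpoly.mpoly 2 R) : mpoly.mpoly 2 R :=
  mpoly.mderiv ord0 p * mpoly.mderiv ord_max q - mpoly.mderiv ord_max p * mpoly.mderiv ord0 q.

Lemma jac_eq0 p q t x : grad p x = t *: grad q x -> peval (jac p q) x = 0.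
Proof.
move=> E; have e i : peval (mpoly.mderiv i p) x = t * peval (mpoly.mderiv i q) x.
  by have /rowP/(_ i) := E; rewrite !mxE.
by rewrite pevalB !pevalM !e mulrAC subrr.
Qed.

Lemma jacM p q w : jac p (w * q) = w * jac p q + q * jac p w.
Proof. by rewrite /jac !mpoly.mderivM; ring. Qed.

Lemma ebal_coord x i : ebal z r x -> `|x ord0 i - z ord0 i| <= r.
Proof. by apply: le_trans; have := enorm_coord (x - z) i; rewrite !mxE. Qed.

(* If the constant weight makes the Jacobian vanish identically, a linear one does not. *)
Lemma weight_exists : f != 0 -> (exists i, mpoly.mderiv i (sqgrad f) != 0) ->
  exists w, [/\ (mpoly.msize w <= 2)%N,
    forall x, ebal z r x -> 1 / 2 <= peval w x <= 2 & jac (sqgrad f) (w * f) != 0].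
Proof.
move=> f0 [i Gi]; have [J0|J0] := eqVneq (jac (sqgrad f) f) 0; last first.
  exists (mpoly.mpolyC 2 1); split; [exact: msizeC_leq|move=> x _; rewrite pevalC; lra|].
  by rewrite mpoly.mpolyC1 mul1r.
(* [w] varies only with the coordinate other than [i], so [jac (sqgrad f) w] is the nonzero [i]-th
   derivative of [sqgrad f] up to sign and the factor [1 / (2 r)]; this factor keeps [w] within 1/2
   of 1 on the ball. *)
pose j : 'I_2 := rev_ord i.
pose w : mpoly.mpoly 2 R := mpoly.mpolyC 2 1 +
  (2 * r)^-1 *: (mpoly.mpolyX R (mpoly.mnm1 j) - mpoly.mpolyC 2 (z ord0 j)).
have wi a : mpoly.mderiv a w = (2 * r)^-1 *: mpoly.mpolyC 2 (a == j)%:R.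
  rewrite mpoly.mderivD mpoly.mderivC add0r mpoly.mderivZ mpoly.mderivB mderivXU.
  by rewrite mpoly.mderivC subr0.
have r2 : (2 * r)^-1 != 0 :> R by rewrite invr_eq0 mulf_neq0 // gt_eqF.
exists w; split.
- apply: msizeD_leq; first exact: msizeC_leq.
  apply/msizeZ_leq/msizeD_leq; first exact: msizeXU_leq.
  by apply: msizeN_leq; exact: msizeC_leq.
- move=> x Kx; rewrite /w pevalD pevalC pevalZ pevalB pevalX pevalC.
  have := ebal_coord j Kx; rewrite ler_norml => /andP[h1 h2].
  have h3 : (2 * r)^-1 * (x ord0 j - z ord0 j) <= 1 / 2.
    by rewrite mulrC ler_pdivrMr ?mulr_gt0 //; lra.
  have h4 : - (1 / 2) <= (2 * r)^-1 * (x ord0 j - z ord0 j).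
    by rewrite lerNl -mulrN mulrC ler_pdivrMr ?mulr_gt0 //; lra.
  by apply/andP; split; lra.
rewrite jacM J0 mulr0 add0r mulf_neq0 //.
have cases : i = ord0 \/ i = ord_max.
  by case: (unliftP ord0 i) => [a ->|->]; [right; rewrite ord1; exact: val_inj|left].
rewrite /jac !wi; case: cases => iE.
  have -> : j = ord_max by rewrite /j iE; exact: val_inj.
  rewrite eqxx (_ : ord0 == ord_max = false) // mpoly.mpolyC0 scaler0 mulr0 subr0.
  by rewrite mpoly.mpolyC1 mulrC -scalerAl mul1r scaler_eq0 negb_or r2 -iE.
have -> : j = ord0 by rewrite /j iE; exact: val_inj.
rewrite eqxx (_ : ord_max == ord0 = false) // mpoly.mpolyC0 scaler0 mulr0 sub0r.
by rewrite oppr_eq0 mpoly.mpolyC1 mulrC -scalerAl mul1r scaler_eq0 negb_or r2 -iE.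
Qed.

(** At an interior minimiser the gradients of [sqgrad f] and [w * f] are parallel, and any other
    lies on the sphere. By definability one of the two equations serves for all small [t], so a
    weight of degree at most 1 suffices and the degree of [E] stays at most [(2 D - 3) + D]. *)
Lemma plane_minimizers w : (mpoly.msize w <= 2)%N -> jac (sqgrad f) (w * f) != 0 ->
  exists E t0, [/\ E != 0, (mpoly.msize E <= (3 * D - 3).+1)%N, 0 < t0 &
    forall t, 0 < t < t0 ->
      exists x, argmin (sqgrad f) (- (w * f)) z r t x /\ peval E x = 0].
Proof.
move=> sw J0; set A := argmin _ _ _ _; pose E0 := jac (sqgrad f) (w * f).
pose E1 := sqdist z - mpoly.mpolyC 2 (r ^+ 2).
have sG i : (mpoly.msize (mpoly.mderiv i (sqgrad f)) <= (2 * D - 3).+1)%N.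
  apply: msize_mderiv; apply: leq_trans (msize_sqgrad D_ge4 size_f) _.
  by clear -D_ge4; lia.
have swf i : (mpoly.msize (mpoly.mderiv i (w * f)) <= D.+1)%N.
  by apply: msize_mderiv; rewrite -[D.+2]/(1 + D).+1; exact: msizeM_leq.
have sE0 : (mpoly.msize E0 <= (3 * D - 3).+1)%N.
  have -> : (3 * D - 3 = 2 * D - 3 + D)%N by clear -D_ge4; lia.
  by apply: msizeD_leq; [|apply: msizeN_leq]; apply: msizeM_leq.
have sE1 : (mpoly.msize E1 <= (3 * D - 3).+1)%N.
  apply: (@leq_trans 3); last by clear -D_ge4; lia.
  by apply: msizeD_leq; [exact: msize_sqdist|apply: msizeN_leq; exact: msizeC_leq].
have E1_neq0 : E1 != 0.
  apply/eqP => /(congr1 (fun p => peval p z)).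
  rewrite pevalB peval_sqdist subrr enorm0 pevalC expr0n sub0r peval0 => /eqP.
  by rewrite oppr_eq0 sqrf_eq0 gt_eqF.
have dich t x : A t x -> peval E0 x = 0 \/ peval E1 x = 0.
  move=> [Kx xmin]; have [xr|xr] := ltP (enorm (x - z)) r; last first.
    right; rewrite pevalB peval_sqdist pevalC; move: Kx; rewrite /ebal /= => Kx.
    by have -> : enorm (x - z) = r; [apply/eqP; rewrite eq_le Kx|rewrite subrr].
  left; have e0 : 0 < r - enorm (x - z) by rewrite subr_gt0.
  have : grad (sqgrad f + t *: (- (w * f))) x = 0.
    apply: (grad_eq0_of_min e0) => y yx; apply: xmin.
    by have := enorm_triangle x y z; rewrite /ebal /=; lra.
  rewrite gradD gradZ gradN scalerN => /eqP; rewrite subr_eq0 => /eqP h.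
  exact: jac_eq0 h.
have dA : definable (fun e => exists x, A (e 0%N) x /\ peval E0 x = 0).
  apply: (definable_ex_rv (k := 1)); first by move=> e y; rewrite setv_lt.
  apply: definable_and; first exact: definable_argmin.
  by apply: definable_eq; [exact: definable_fun_peval|exact: definable_fun_cst].
have [d d0 [dP|dP]] :=
  definable_eventually (P := fun t => exists x, A t x /\ peval E0 x = 0) dA.
  by exists E0, d; split.
exists E1, d; split=> // t td; have [[x Ax] _] := argmin_compact (sqgrad f) (- (w * f)) z r_gt0 t.
exists x; split=> //; have [E0x|//] := dich _ _ Ax.
by case: (dP t td); exists x.
Qed.

Theorem gradient_inequality_plane : gradient_inequality k f z r.
Proof.
have [gK|gK] := pselect (forall x, ebal z r x -> grad f x = 0).
  apply: (@gradient_inequality_nonneg R 2 k f (mpoly.mpolyC 2 1) z r r_gt0 _ 1 ltr01).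
    by move=> x _; rewrite pevalC; lra.
  by move=> y Ky; rewrite peval_penalized gK // enorm0 crit ?gK // !mulr0 expr0n subrr.
have {gK} [x1 Kx1 gx1] : exists2 x, ebal z r x & grad f x != 0.
  by apply: contrapT => h; apply: gK => x Kx; apply/eqP/negPn/negP => gx; apply: h; exists x.
have f0 : f != 0.
  apply: contraNneq gx1 => ->; apply/eqP/rowP => i; rewrite !mxE mpoly.mderiv0.
  exact: peval0.
(* A constant [sqgrad f] would equal its value at the minimum [z], which is 0. *)
have Gi : exists i, mpoly.mderiv i (sqgrad f) != 0.
  apply: contrapT => /forallNP Gi; have G0 x : grad (sqgrad f) x = 0.
    apply/rowP => i; rewrite !mxE; have /negP/negPn/eqP-> := Gi i.
    exact: peval0.
  move: gx1; rewrite (_ : grad f x1 = 0) ?eqxx //; apply/grad_eq0_sqgrad.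
  rewrite (peval_constant G0 x1 z); apply/grad_eq0_sqgrad.
  by apply: (grad_eq0_of_min ltr01) => y _; rewrite fz.
have [w [sw wb Jw]] := weight_exists f0 Gi.
have wb' x : ebal z r x -> 0 <= peval w x <= 2 by move=> /wb; lra.
have wh x : enorm (x - z) <= r / 2 -> 1 / 2 <= peval w x.
  move=> xr; have Kx : ebal z r x by rewrite /ebal /=; have := r_gt0; lra.
  by have /andP[] := wb x Kx.
have [[t t0 tP]|nneg] := pselect (exists2 t, 0 < t &
    forall y, ebal z r y -> 0 <= peval (penalized f w t) y).
  exact: (gradient_inequality_nonneg k r_gt0 wh t0 tP).
have neg t : 0 < t -> exists2 y, ebal z r y & peval (penalized f w t) y < 0.
  move=> t0; apply: contrapT => ne; apply: nneg; exists t => // y Ky.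
  by rewrite leNgt; apply/negP => yneg; apply: ne; exists y.
have [E [t0 [E0 sE t0_gt0 EP]]] := plane_minimizers sw Jw.
have D0 : (0 < D)%N by clear -D_ge4; lia.
have e0 : (0 < 3 * D - 3)%N by clear -D_ge4; lia.
have [P PP] := choice (fun i => plane_elimination i D0 e0 size_f sE E0).
pose S t : set 'rV[R]_2 := argmin (sqgrad f) (- (w * f)) z r t `&` [set x | peval E x = 0].
apply: (@gradient_inequality_curve R 2 k f w z r k_gt0 r_gt0 f_ge0 crit wb' wh S t0
  t0_gt0 neg).
- move=> j j0; apply: definable_and; first exact: definable_argmin.
  by apply: definable_eq; [exact: definable_fun_peval|exact: definable_fun_cst].
- by move=> t x [].
- move=> t td; split; first by have [x ?] := EP t td; exists x.
  by apply: compact_closedI; [exact: (argmin_compact _ _ _ r_gt0 _).2|exact: closed_peval_eq].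
move=> x x0 d d0 xS xlim.
have near0 (p : mpoly.mpoly 2 R) e : 0 < e -> exists2 r', 0 < r' <= d & forall t, 0 < t < r' ->
    `|peval p (x t) - peval p x0| < e.
  move=> e_gt0.
  have /nbhs_enorm[e1 e1_gt0 e1P] := @peval_continuous _ _ p x0 _ (nbhsx_ballx (peval p x0) _ e_gt0).
  have [|r' r'd r'P] := xlim (e1 / 3); first by rewrite divr_gt0.
  exists r' => // t tr'; have := e1P (x t); rewrite -ball_normE /= distrC; apply.
  apply: (@le_lt_trans _ _ (e1 / 3 * 2%:R)); last by lra.
  by apply: enorm_le_coord => i; rewrite !mxE ltW //; exact: r'P.
have bnd t : 0 < t < d -> peval (sqgrad f) (x t) <= 2 * t * peval f (x t).
  move=> td; have [[[Kx xmin] _] fx] := xS t td.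
  have tp : 0 < t by case/andP: td.
  have [y Ky yneg] := neg t tp.
  have := le_lt_trans (xmin y Ky) yneg; rewrite peval_penalized peval_sqgrad.
  have /andP[w0 w2] := wb' _ Kx.
  have : t * (peval w (x t) * peval f (x t)) <= t * (2 * peval f (x t)).
    by rewrite ler_pM2l // ler_pM2r.
  by move=> *; lra.
have Gx0 : peval (sqgrad f) x0 = 0.
  apply/eqP; rewrite eq_le; apply/andP; split; last by rewrite peval_sqgrad sqr_ge0.
  rewrite leNgt; apply/negP => g0.
  have [|r1 /andP[r10 r1d] r1P] := near0 (sqgrad f) (peval (sqgrad f) x0 / 2).
    by rewrite divr_gt0.
  have [r2 /andP[r20 r2d] r2P] := near0 f 1 ltr01.
  pose B := 2 * (peval f x0 + 1); have B0 : 0 < B by have := f_ge0 x0; rewrite /B; lra.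
  pose t := Num.min (Num.min r1 r2) (peval (sqgrad f) x0 / B) / 2.
  have t_gt0 : 0 < t by rewrite divr_gt0 // !lt_min r10 r20 divr_gt0.
  have tm : 2 * t <= Num.min (Num.min r1 r2) (peval (sqgrad f) x0 / B).
    by rewrite /t mulrC divfK.
  move: tm; rewrite !le_min => /andP[/andP[tr1 tr2] tB].
  have h1 := r1P t; have h2 := r2P t; have h3 := bnd t.
  have {}h1 : `|peval (sqgrad f) (x t) - peval (sqgrad f) x0| < peval (sqgrad f) x0 / 2.
    by apply: h1; rewrite t_gt0; lra.
  have {}h2 : `|peval f (x t) - peval f x0| < 1 by apply: h2; rewrite t_gt0; lra.
  have {}h3 : peval (sqgrad f) (x t) <= 2 * t * peval f (x t).
    by apply: h3; rewrite t_gt0; lra.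
  move: h1 h2; rewrite !ltr_norml => /andP[h1 _] /andP[_ h2].
  have h4 : 2 * t * peval f (x t) <= 2 * t * (peval f x0 + 1).
    by rewrite ler_pM2l; [lra|rewrite mulr_gt0].
  move: tB; rewrite ler_pdivlMr // => tB.
  have : 2 * t * B = 2 * (2 * t * (peval f x0 + 1)) by rewrite /B; ring.
  by lra.
have Kx0 : ebal z r x0.
  rewrite /ebal /=; apply/ler_addgt0Pr => e e_gt0.
  have [|r' /andP[r'0 r'd] r'P] := xlim (e / 3); first by rewrite divr_gt0.
  have td : 0 < r' / 2 < r' by lra.
  have td' : 0 < r' / 2 < d by lra.
  have [[[Kx _] _] _] := xS _ td'.
  have : enorm (x0 - x (r' / 2)) <= e / 3 * 2%:R.
    by apply: enorm_le_coord => i; rewrite !mxE distrC ltW //; exact: r'P.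
  have := enorm_triangle (x (r' / 2)) x0 z.
  by move: Kx; rewrite /ebal /=; lra.
(* Thus [f (x t)] tends to 0 and can replace [t] as the small parameter in [root_order]. *)
have fx0 : peval f x0 = 0 by apply: crit => //; exact/grad_eq0_sqgrad.
have H i : exists Cd : R * R, [/\ 0 < Cd.1, 0 < Cd.2 & forall t, 0 < t < Cd.2 ->
    `|x t ord0 i - x0 ord0 i| ^+ k.+2 <= Cd.1 * peval f (x t)].
  have [P0 sP PE] := PP i.
  have [C [e [C0 e_gt0 CP]]] := root_order (x0 ord0 i) P0 sP.
  have [r1 /andP[r10 r1d] r1P] := xlim _ e_gt0.
  have [r2 /andP[r20 r2d] r2P] := near0 f e e_gt0.
  exists (C, Num.min r1 r2); split => //=; first by rewrite lt_min r10.
  move=> t; rewrite lt_min => /and3P[t_gt0 tr1 tr2].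
  have td : 0 < t < d by rewrite t_gt0 (lt_le_trans tr1).
  have [[_ Ex] fx] := xS t td; rewrite k_eq; apply: CP.
  - rewrite fx /=; have := r2P t; rewrite fx0 subr0 ger0_norm //; apply.
    by rewrite t_gt0.
  - by apply: r1P; rewrite t_gt0.
  - exact: PE.
have [Cd CdP] := choice H.
exists (1 + \sum_i (Cd i).1), (\big[Num.min/d]_i (Cd i).2); split.
- by rewrite ltr_pwDl // sumr_ge0 // => i _; case: (CdP i) => /ltW.
- by apply: lt_bigmin => // i _; case: (CdP i).
move=> t /andP[t_gt0 td] i; right; have [_ _ h] := CdP i.
apply: le_trans (h t _) _; first by rewrite t_gt0 (lt_le_trans td) // bigmin_le.
have td' : 0 < t < d by rewrite t_gt0 (lt_le_trans td) // bigmin_le_id.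
have [_ fx] := xS t td'; rewrite ler_pM2r // (bigD1 i) //=.
have : 0 <= \sum_(j < 2 | j != i) (Cd j).1.
  by rewrite sumr_ge0 // => j _; case: (CdP j) => /ltW.
by lra.
Qed.
End Plane.

(** The elimination degree in [n + 3] variables fits below the exponent minus 2. The analogue in two
    variables, [(2 D - 3)^2 + 2 <= D (3 D - 3)], fails from [D = 8] on. *)
Lemma expn_gap n D : (4 <= D)%N ->
  ((2 * D - 3) ^ n.+3 + 2 <= D * (3 * D - 3) ^ n.+2)%N.
Proof.
move=> D4; have -> : (2 * D - 3 = 2 * (D - 4) + 5)%N by lia.
have -> : (3 * D - 3 = 3 * (D - 4) + 9)%N by lia.
have {2}-> : (D = (D - 4) + 4)%N by lia.
move: (D - 4)%N => a; elim: n => [|n ih].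
  by rewrite !expnS !expn0; nia.
rewrite (expnS (2 * a + 5)) (expnS (3 * a + 9) n.+2) mulnCA.
apply: leq_trans (leq_mul (leqnn _) ih); move: (expn _ n.+3) => u; clear; nia.
Qed.

(** * Lojasiewicz inequality for the distance to the zeros *)

Section LojasiewiczDistance.
Variables (R : realType) (n D : nat) (f : mpoly.mpoly n R) (z : 'rV[R]_n).
Hypotheses (n_gt0 : (0 < n)%N) (D_ge4 : (4 <= D)%N).
Hypothesis size_f : (mpoly.msize f <= D.+1)%N.
Hypothesis f_ge0 : forall x, 0 <= peval f x.
Hypothesis fz : peval f z = 0.

Lemma dist_of_gradient k r : 0 < r -> gradient_inequality k f z r ->
  exists c rho, [/\ 0 < c, 0 < rho & forall a, enorm (a - z) < rho ->
    c * dist a [set x | peval f x = 0] ^+ k.+2 <= peval f a].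
Proof.
move=> r0 [c [eps [c0 eps0 cP]]].
have /nbhs_enorm[e e0 eP] := @peval_continuous _ _ f z _ (nbhsx_ballx (peval f z) _ eps0).
have r'0 : 0 < Num.min (r / 2) (e / 2) by rewrite lt_min !divr_gt0.
apply: (@distance_lower_bound R n k.+1 f z c _ f_ge0 fz c0 r'0) => x s.
rewrite le_min => /andP[xr xe] s0 sE; apply: cP => //.
have := eP x; rewrite -ball_normE /= fz sub0r normrN ger0_norm //; apply.
by apply: le_lt_trans xe _; lra.
Qed.
End LojasiewiczDistance.

Lemma peval_univariate (R : realType) (f : mpoly.mpoly 1 R) :
  exists p : {poly R}, forall x, peval f x = p.[x ord0 ord0].
Proof.
elim/mpoly_ring_ind: f => [c|i|p q [P PE] [Q QE]|p q [P PE] [Q QE]].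
- by exists c%:P => x; rewrite pevalC hornerC.
- by exists 'X => x; rewrite pevalX hornerX (ord1 i).
- by exists (P + Q) => x; rewrite pevalD PE QE hornerD.
- by exists (P * Q) => x; rewrite pevalM PE QE hornerM.
Qed.

Lemma poly_root_isolated (R : realType) (p : {poly R}) a : p != 0 ->
  exists2 d, 0 < d & forall b, `|b - a| <= d -> p.[b] = 0 -> b = a.
Proof.
move=> p0; have [m] := multiplicity_XsubC p a; rewrite p0 /= => -[q qa ->].
have [|d d0 dP] := @sgr_near R q a; first by move: qa; rewrite /root.
exists (d / 2); first by rewrite divr_gt0.
move=> b bd; rewrite hornerM horner_exp hornerXsubC => /eqP; rewrite mulf_eq0.
have bd' : `|b - a| < d by lra.
rewrite -sgr_eq0 (dP b bd') sgr_eq0 -/(root q a) (negbTE qa) /=.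
by rewrite expf_eq0 => /andP[_]; rewrite subr_eq0 => /eqP.
Qed.

(** In one variable the zeros of a nonzero [f] are isolated, and the exponent [(D - 1) + 1] of an
    isolated zero is the required [D]. *)
Theorem lojasiewicz_distance (R : realType) n D (f : mpoly.mpoly n R) z :
  (0 < n)%N -> (4 <= D)%N -> (mpoly.msize f <= D.+1)%N ->
  (forall x, 0 <= peval f x) -> peval f z = 0 ->
  exists c rho, [/\ 0 < c, 0 < rho & forall a, enorm (a - z) < rho ->
    c * dist a [set x | peval f x = 0] ^+ (D * (3 * D - 3) ^ n.-1) <= peval f a].
Proof.
case: n f z => // -[|[|n]] f z _ D4 sf f0 fz.
- have [p pE] := peval_univariate f; rewrite muln1.
  have [p0|p0] := eqVneq p 0.
    exists 1, 1; split=> // a _; rewrite [peval f a]pE p0 horner0 mul1r.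
    rewrite (_ : dist _ _ = 0) ?expr0n ?gtn_eqF //; first by clear -D4; lia.
    apply/eqP; rewrite eq_le dist_ge0 andbT.
    apply: le_trans (dist_le _ (_ : peval f a = 0)) _; first by rewrite pE p0 horner0.
    by rewrite subrr enorm0.
  have [d d0 dP] := poly_root_isolated (z ord0 ord0) p0.
  have m0 : (0 < D - 1)%N by clear -D4; lia.
  have sf' : (mpoly.msize f <= (D - 1).+2)%N by clear -sf D4; lia.
  have [|c [rho [c0 rho0 cP]]] :=
    @isolated_zero_lower_bound R 1 (D - 1)%N f z m0 sf' f0 fz d d0.
    move=> x xz fx; apply/rowP => i; rewrite ord1; apply: dP; last by rewrite -pE.
    by apply: le_trans xz; have := enorm_coord (x - z) ord0; rewrite !mxE.
  exists c, rho; split=> // a /cP; apply: le_trans.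
  have -> : ((D - 1) ^ 1).+1 = D by clear -D4; rewrite expn1; lia.
  rewrite ler_pM2l // lerXn2r ?nnegrE ?dist_ge0 ?enorm_ge0 //.
  exact: dist_le.
- have [r r0 crit] := critical_values fz f0; rewrite expn1.
  have kE : (D * (3 * D - 3) - 2).+2 = (D * (3 * D - 3))%N by clear -D4; nia.
  rewrite -kE; apply: (dist_of_gradient f0 fz r0).
  by apply: (gradient_inequality_plane D4 _ kE) => //; clear -D4; nia.
have [r r0 crit] := critical_values fz f0.
have gap := expn_gap n D4.
have kE : (D * (3 * D - 3) ^ n.+2 - 2).+2 = (D * (3 * D - 3) ^ n.+2)%N.
  by clear -gap; lia.
have e0 : (0 < (2 * D - 3) ^ n.+3)%N by rewrite expn_gt0; clear -D4; lia.
rewrite -[n.+3.-1]/n.+2 -kE; apply: (dist_of_gradient f0 fz r0).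
by apply: (gradient_inequality_high_dim D4) => //; clear -gap e0; lia.
Qed.

(** * Decomposition of closed semialgebraic sets *)

Section DefinableLowerBound.
Variable R : realType.

(** The annihilator of [xi] is read as an equation for [t] with parameter [xi t], and [root_order]
    is applied at 0 with the roles exchanged. Where [xi t] is not small the bound is immediate. *)
Lemma definable_lower_bound (xi : R -> R) : definable1 xi -> (forall t, 0 < t -> 0 < xi t) ->
  exists C K d, [/\ 0 < C, 0 < d & forall t, 0 < t < d -> t ^+ K <= C * xi t].
Proof.
move=> /definable_annihilator[p p0 pP] xi0.
have S0 : swapXY p != 0 by rewrite swapXY_eq0.
have [C [d [C0 d0 CP]]] := root_order 0 S0 (leqnSn _).
exists (C + d^-1), (size (swapXY p)), (Num.min 1 d); split.
- by rewrite addr_gt0 // invr_gt0.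
- by rewrite lt_min ltr01.
move=> t /andP[t0]; rewrite lt_min => /andP[t1 td]; have x0 := xi0 t t0.
rewrite mulrDl; have [xd|xd] := ltP (xi t) d.
  apply: (@le_trans _ _ (C * xi t)); last by rewrite lerDl mulr_ge0 ?invr_ge0 ?ltW.
  have := CP (xi t) t; rewrite x0 subr0 gtr0_norm //; apply => //.
  have := pP t; rewrite -horner2_swapXY // => <-.
apply: (@le_trans _ _ 1); first by rewrite exprn_ile1 ?ltW.
apply: (@le_trans _ _ (d^-1 * xi t)); last by rewrite lerDr mulr_ge0 ?ltW.
by rewrite mulrC ler_pdivlMr // mul1r.
Qed.
End DefinableLowerBound.

(** * Lojasiewicz inequality on an unbounded closed set *)

Section Finiteness.
Variables (R : realType) (n : nat).
Implicit Types (x : 'rV[R]_n) (p f g : mpoly.mpoly n R) (gs hs : seq (mpoly.mpoly n R)).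

(** A polynomial substitute for the size of [x]: its powers dominate every polynomial on the whole
    space. *)
Definition growth : mpoly.mpoly n R := mpoly.mpolyC n 1 + sqdist 0.

Lemma peval_growth x : peval growth x = 1 + enorm x ^+ 2.
Proof. by rewrite pevalD pevalC peval_sqdist subr0. Qed.

Lemma growth_ge1 x : 1 <= peval growth x.
Proof. by rewrite peval_growth lerDl sqr_ge0. Qed.

Lemma enorm_le_growth x : enorm x <= peval growth x.
Proof. by rewrite peval_growth; have := sqr_ge0 (enorm x - 1); rewrite sqrrB; nra. Qed.

Lemma peval_le_growth p : exists B b, 0 <= B /\
  forall x, `|peval p x| <= B * peval growth x ^+ b.
Proof.
elim/mpoly_ring_ind: p => [c|i|p q [B [b [B0 BP]]] [B' [b' [B'0 BP']]]|
    p q [B [b [B0 BP]]] [B' [b' [B'0 BP']]]].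
- by exists `|c|, 0%N; split=> // x; rewrite pevalC expr0 mulr1.
- exists 1, 1%N; split=> // x; rewrite pevalX mul1r expr1.
  exact: le_trans (enorm_coord x i) (enorm_le_growth x).
- exists (B + B'), (b + b')%N; split=> [|x]; first exact: addr_ge0.
  rewrite pevalD mulrDl (le_trans (ler_normD _ _)) // lerD //.
    by apply: le_trans (BP x) _; rewrite ler_wpM2l // ler_weXn2l ?growth_ge1 // leq_addr.
  by apply: le_trans (BP' x) _; rewrite ler_wpM2l // ler_weXn2l ?growth_ge1 // leq_addl.
exists (B * B'), (b + b')%N; split=> [|x]; first exact: mulr_ge0.
by rewrite pevalM normrM exprD mulrACA ler_pM.
Qed.

Lemma definable_semialgebraic (X : set 'rV[R]_n) j : semialgebraic X ->
  definable (fun e => X (rvof j n e)).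
Proof.
elim=> {X} [p|A B _ dA _ dB|A B _ dA _ dB|A _ dA].
- by apply: definable_lt; [exact: definable_fun_cst|exact: definable_fun_peval].
- exact: definable_or.
- exact: definable_and.
- exact: definable_not.
Qed.

Lemma definable_all_ge0 gs j :
  definable (fun e => all (fun g => 0 <= peval g (rvof j n e)) gs).
Proof.
elim: gs => [|g gs ih] /=; first exact: definable_const.
apply: (definable_ext (P := fun e => 0 <= peval g (rvof j n e) /\
    all (fun g => 0 <= peval g (rvof j n e)) gs)) => [e|]; first by split=> [[-> ->]|/andP].
by apply: definable_and => //; apply: definable_le;
  [exact: definable_fun_cst|exact: definable_fun_peval].
Qed.

Lemma closed_all_ge0 gs : closed [set x | all (fun g => 0 <= peval g x) gs].
Proof.
elim: gs => [|g gs ih] /=.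
  rewrite (_ : [set _ | _] = setT); first exact: closedT.
  by apply/seteqP; split.
rewrite (_ : [set _ | _] = [set x | peval (- g) x <= 0] `&`
  [set x | all (fun g => 0 <= peval g x) gs]).
  by apply: closedI => //; exact: closed_peval_le.
by apply/seteqP; split=> x /=; rewrite pevalN oppr_le0 => /andP.
Qed.

(* On [F s] the minimum of [f ^+ 2] is a positive definable function of [s], hence at
   least a power of [s]; any [x] belongs to [F s] for [s] a multiple of [g x / growth x ^+ b.+1]. *)
Lemma lojasiewicz_closed (X : set 'rV[R]_n) f gs : closed X -> semialgebraic X ->
  let g := \prod_(g <- gs) g in
  (forall x, X x -> all (fun g => 0 < peval g x) gs -> peval f x != 0) ->
  exists c C K M, [/\ 0 < c, 0 < C & forall x, X x -> all (fun g => 0 < peval g x) gs ->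
    c * peval g x ^+ K <= C * peval f x ^+ 2 * peval growth x ^+ M].
Proof.
move=> cX sX g fX.
have gprod x : peval g x = \prod_(g <- gs) peval g x by rewrite /g peval_prod.
pose F (s : R) : set 'rV[R]_n := [set x | X x /\ s * peval growth x <= 1 /\
  all (fun g => 0 <= peval g x) gs /\ s <= peval g x].
have F0 s x : 0 < s -> F s x -> peval f x != 0.
  move=> s0 [Xx [_ [gx sg]]]; apply: fX => //; apply/allP => q qgs.
  rewrite lt_neqAle (allP gx) // andbT; apply/eqP => q0.
  move: (lt_le_trans s0 sg); rewrite gprod (big_rem q) //= -q0 mul0r ltxx //.
have Fcompact s : 0 < s -> compact (F s).
  move=> s0; have -> : F s = ebal 0 s^-1 `&` (X `&` ([set x | peval (s *: growth) x <= 1] `&`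
      ([set x | all (fun g => 0 <= peval g x) gs] `&` [set x | peval (- g) x <= - s]))).
    apply/seteqP; split=> x; rewrite /F /= pevalZ pevalN lerN2; last by move=> [_ [? [? []]]].
    move=> [Xx [sx [gx sg]]]; split=> //; rewrite /ebal /= subr0.
    apply: le_trans (enorm_le_growth x) _.
    by rewrite -[s^-1]mul1r ler_pdivlMr // mulrC.
  apply: compact_closedI; first exact: (@compact_eball _ _ 0 s^-1).
  by apply: closedI => //; apply: closedI; [|apply: closedI];
    [exact: closed_peval_le|exact: closed_all_ge0|exact: closed_peval_le].
pose isM (s y : R) x := F s x /\ (y = peval f x ^+ 2 /\
  ~ exists x', F s x' /\ peval f x' ^+ 2 < y).
(* The value 1 where [F s] is empty makes the minimum a total positive function. *)
pose G (s y : R) := (exists x, isM s y x) \/ (~ (exists y' x, isM s y' x) /\ y = 1).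
have Gex s : exists y, G s y.
  have [[y [x H]]|nex] := pselect (exists y x, isM s y x); last by exists 1; right.
  by exists y; left; exists x.
have [xi xiP] := choice Gex.
have Gu s y y' : G s y -> G s y' -> y = y'.
  move=> [[x [Fx [yx ymin]]]|[nex ->]] [[x' [Fx' [yx' ymin']]]|[nex' ->]] //.
  - apply/eqP; rewrite eq_le; apply/andP; split; rewrite leNgt; apply/negP => lt.
      by apply: ymin; exists x'; rewrite -yx'.
    by apply: ymin'; exists x; rewrite -yx.
  - by case: nex'; exists y, x.
  - by case: nex; exists y', x'.
have dF k : (1 < k)%N -> definable (fun e => F (e 0%N) (rvof k n e)).
  move=> k1; apply: definable_and; first exact: definable_semialgebraic.
  apply: definable_and.
    apply: definable_le; last exact: definable_fun_cst.
    by apply: definable_funM; [exact: definable_fun_var|exact: definable_fun_peval].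
  apply: definable_and; first exact: definable_all_ge0.
  by apply: definable_le; [exact: definable_fun_var|exact: definable_fun_peval].
have dM k y : (1 < k)%N -> (y < k)%N ->
    definable (fun e => isM (e 0%N) (e y) (rvof k n e)).
  move=> k1 yk; apply: definable_and; first exact: dF.
  apply: definable_and.
    apply: definable_eq; first exact: definable_fun_var.
    by apply: definable_funX; exact: definable_fun_peval.
  apply: definable_not; apply: (definable_ex_rv (k := k)).
    by move=> e x; rewrite !setv_lt // (ltn_trans _ k1).
  apply: definable_and; first exact: dF.
  apply: definable_lt; last exact: definable_fun_var.
  by apply: definable_funX; exact: definable_fun_peval.
have dEM y : (y < 3)%N -> definable (fun e => exists x, isM (e 0%N) (e y) x).
  move=> y3; apply: (definable_ex_rv (k := 3)); last exact: dM.
  by move=> e x; rewrite !setv_lt.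
have dxi : definable1 xi.
  apply: (definable_ext (P := fun e => (exists x, isM (e 0%N) (e 1%N) x) \/
      (~ qex 2 (fun e => exists x, isM (e 0%N) (e 2%N) x) e /\ e 1%N = 1))).
    move=> e; rewrite -/(G (e 0%N) (e 1%N)); split=> [h|->]; last exact: xiP.
    exact: Gu h (xiP _).
  apply: definable_or; first exact: dEM.
  apply: definable_and; last first.
    by apply: definable_eq; [exact: definable_fun_var|exact: definable_fun_cst].
  by apply: definable_not; apply: definable_ex; exact: dEM.
have xi0 s : 0 < s -> 0 < xi s.
  move=> s0; case: (xiP s) => [[x [Fx [-> _]]]|[_ ->]] //.
  by rewrite exprn_even_gt0 //= (F0 s).
have xile s x : 0 < s -> F s x -> xi s <= peval f x ^+ 2.
  move=> s0 Fx; case: (xiP s) => [[x' [Fx' [xiE xmin]]]|[nex _]].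
    by rewrite leNgt; apply/negP => lt; apply: xmin; exists x.
  have [|x' Fx' xmin] := compact_min (f := peval (f ^+ 2)) _ (Fcompact s s0)
    (@peval_continuous _ _ _); first by exists x.
  case: nex; exists (peval f x' ^+ 2), x'; split=> //; split=> // -[x2 [Fx2]].
  by rewrite ltNge -!pevalXn xmin.
have [C [K [d [C0 d0 CP]]]] := definable_lower_bound dxi xi0.
have [B0 [b [B00 BP]]] := peval_le_growth g; pose B := B0 + 1.
have B_gt0 : 0 < B by rewrite ltr_wpDl.
(* With this [c] the value [s] below is less than [d] and satisfies the two inequalities that define
   [F s]. *)
pose c := Num.min 1 (d / 2) / B.
have c0 : 0 < c by rewrite divr_gt0 // lt_min ltr01 divr_gt0.
have cB : c * B = Num.min 1 (d / 2) by rewrite /c divfK // gt_eqF.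
exists (c ^+ K), C, K, (b.+1 * K)%N; split=> //; first by rewrite exprn_gt0.
move=> x Xx gx; have ph1 := growth_ge1 x; set ph := peval growth x in ph1 *.
have g0 : 0 < peval g x.
  by rewrite gprod big_seq; apply: prodr_gt0 => q qgs; exact: (allP gx).
have gB : peval g x <= B * ph ^+ b.
  apply: le_trans (ler_norm _) _; apply: le_trans (BP x) _.
  by rewrite ler_wpM2r ?exprn_ge0 // ?lerDl //; lra.
have ph0 : 0 < ph by lra.
pose s := c * peval g x / ph ^+ b.+1.
have s0 : 0 < s by rewrite divr_gt0 ?exprn_gt0 // mulr_gt0.
have sph : s * ph <= c * B.
  rewrite /s exprSr invfM mulrA divfK ?gt_eqF // ler_pdivrMr ?exprn_gt0 //.
  rewrite -[c * B * _]mulrA ler_pM2l //.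
have cB1 : c * B <= 1 by rewrite cB ge_min lexx.
have ssph : s <= s * ph by rewrite ler_peMr // ltW.
have Fx : F s x.
  split=> //; split; first exact: le_trans sph cB1.
  split; first by apply: sub_all gx => q /ltW.
  rewrite /s ler_pdivrMr ?exprn_gt0 //; rewrite mulrC ler_pM2l //.
  apply: (@le_trans _ _ 1); last exact: exprn_ege1.
  apply: le_trans cB1; rewrite ler_peMr ?(ltW c0) // /B lerDr //.
have sd : 0 < s < d.
  rewrite s0; apply: (@le_lt_trans _ _ (d / 2)); last by lra.
  by apply: le_trans ssph _; apply: le_trans sph _; rewrite cB ge_min lexx orbT.
have h := le_trans (CP s sd) (ler_wpM2l (ltW C0) (xile s x s0 Fx)).
move: h; rewrite /s expr_div_n exprMn -exprM ler_pdivrMr ?exprn_gt0 //.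
Qed.
End Finiteness.

(** * Finiteness theorem and existence of decompositions *)

Section Decomposition.
Variables (R : realType) (n : nat).
Implicit Types (x : 'rV[R]_n) (p : mpoly.mpoly n R) (X : set 'rV[R]_n).
Local Notation poly := (mpoly.mpoly n R).

Definition cell (c : seq poly * seq poly) x :=
  all (fun h => peval h x == 0) c.1 && all (fun g => 0 < peval g x) c.2.

Definition cell_union (A : set 'rV[R]_n) := exists cs, forall x, A x <-> has (cell ^~ x) cs.

Lemma cell_unionU A B : cell_union A -> cell_union B -> cell_union (A `|` B).
Proof.
move=> [cs csP] [ds dsP]; exists (cs ++ ds) => x; rewrite has_cat.
split=> [[/csP ->|/dsP ->]|/orP[/csP|/dsP]] //; by [rewrite orbT|left|right].
Qed.

Lemma cell_unionI A B : cell_union A -> cell_union B -> cell_union (A `&` B).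
Proof.
move=> [cs csP] [ds dsP].
exists [seq (c.1 ++ d.1, c.2 ++ d.2) | c <- cs, d <- ds] => x.
split.
  move=> [/csP/hasP[c cc cx] /dsP/hasP[d dd dx]]; apply/hasP.
  exists (c.1 ++ d.1, c.2 ++ d.2); first by apply/allpairsP; exists (c, d).
  by move: cx dx; rewrite /cell /= !all_cat => /andP[-> ->] /andP[-> ->].
move=> /hasP[_ /allpairsP[[c d] /= [cc dd ->]]]; rewrite /cell /= !all_cat.
move=> /andP[/andP[c1 d1] /andP[c2 d2]].
by split; [apply/csP|apply/dsP]; apply/hasP; [exists c|exists d] => //; apply/andP.
Qed.

Lemma semialgebraic_cells X : semialgebraic X -> cell_union X /\ cell_union (~` X).
Proof.
elim=> {X} [p|A B _ [A1 A2] _ [B1 B2]|A B _ [A1 A2] _ [B1 B2]|A _ [A1 A2]].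
- split; first by exists [:: ([::], [:: p])] => x; rewrite /= /cell /= andbT orbF.
  exists [:: ([:: p], [::]); ([::], [:: - p])] => x.
  rewrite /= /cell /= !andbT orbF pevalN oppr_gt0 -le_eqVlt leNgt.
  by split=> /negP.
- by split; [exact: cell_unionU|rewrite setCU; exact: cell_unionI].
- by split; [exact: cell_unionI|rewrite setCI; exact: cell_unionU].
- by rewrite setCK.
Qed.

Definition open_basic (hs : seq poly) x := all (fun h => 0 < peval h x) hs.

Lemma cell_open_basic X c : closed X -> semialgebraic X ->
  (forall x, cell c x -> ~ X x) ->
  exists hs, (forall x, cell c x -> open_basic hs x) /\ (forall x, open_basic hs x -> ~ X x).
Proof.
case: c => es gs cX sX cU; pose f := \sum_(h <- es) h ^+ 2.
have fE x : (peval f x == 0) = all (fun h => peval h x == 0) es.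
  rewrite /f peval_sum psumr_eq0 => [|h _]; last by rewrite pevalXn sqr_ge0.
  by apply: eq_all => h; rewrite /= pevalXn sqrf_eq0.
have [|a [C [K [M [a0 C0 LP]]]]] := lojasiewicz_closed (f := f) (gs := gs) cX sX.
  move=> x Xx gx; apply/negP; rewrite fE => fx.
  by apply: (cU x _ Xx); rewrite /cell /= fx.
pose g := \prod_(g <- gs) g.
pose h := a *: g ^+ K - C *: (f ^+ 2 * growth R n ^+ M).
have hE x : peval h x = a * peval g x ^+ K - C * peval f x ^+ 2 * peval (growth R n) x ^+ M.
  by rewrite pevalB !pevalZ pevalM !pevalXn mulrA.
exists (h :: gs); split=> x.
  move=> /andP[/= fx gx]; rewrite /open_basic /= gx andbT hE.
  move: fx; rewrite -fE => /eqP ->; rewrite expr0n mulr0 mul0r subr0.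
  rewrite mulr_gt0 // exprn_gt0 // /g peval_prod big_seq.
  by apply: prodr_gt0 => q qgs; exact: (allP gx).
move=> /andP[hx gx] Xx; have := LP x Xx gx; rewrite -subr_le0 -/g.
by move: hx; rewrite hE ltNge => /negbTE ->.
Qed.

Lemma complement_open_basics X : closed X -> semialgebraic X ->
  exists hss, forall x, ~ X x <-> has (open_basic ^~ x) hss.
Proof.
move=> cX sX; have [_ [cs csP]] := semialgebraic_cells sX.
suff [hss [H1 H2]] : exists hss, (forall x, has (cell ^~ x) cs -> has (open_basic ^~ x) hss) /\
    forall x, has (open_basic ^~ x) hss -> ~ X x.
  by exists hss => x; split=> [/csP/H1|/H2].
have : forall c, c \in cs -> forall x, cell c x -> ~ X x.
  by move=> c cc x cx; apply/csP/hasP; exists c.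
elim: cs {csP} => [_|c cs ih csX]; first by exists [::].
have [hs [h1 h2]] := cell_open_basic cX sX (csX c (mem_head c cs)).
have [|hss [H1 H2]] := ih; first by move=> d dcs; apply: csX; rewrite in_cons dcs orbT.
exists (hs :: hss); split=> x /= /orP[].
- by move=> /h1 ->.
- by move=> /H1 ->; rewrite orbT.
- exact: h2.
- exact: H2.
Qed.

Lemma distribute (hss : seq (seq poly)) : exists gss : seq (seq poly), forall x,
  all (fun hs => has (fun h => peval h x <= 0) hs) hss =
  has (fun gs => all (fun g => 0 <= peval g x) gs) gss.
Proof.
elim: hss => [|hs hss [gss gP]]; first by exists [:: [::]].
exists [seq (- h) :: gs | h <- hs, gs <- gss] => x /=; rewrite gP.
apply/andP/hasP => [[/hasP[h hhs hx] /hasP[gs ggs gx]]|[_ /allpairsP[[h gs] /= [hhs ggs ->]]]].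
  exists ((- h) :: gs); first by apply/allpairsP; exists (h, gs).
  by rewrite /= pevalN oppr_ge0 hx.
rewrite /= pevalN oppr_ge0 => /andP[hx gx].
by split; apply/hasP; [exists h|exists gs].
Qed.

Lemma minimal_exists (D : description R n) :
  exists D', basic_set D' = basic_set D /\ minimal_description D'.
Proof.
pose P k := `[<exists D', basic_set D' = basic_set D /\ size (ineqs D') = k>].
have exP : exists k, P k by exists (size (ineqs D)); apply/asboolP; exists D.
case: (ex_minnP exP) => k /asboolP[D' [D'D <-]] kmin.
exists D'; split=> // D2 D2E; apply: kmin; apply/asboolP; exists D2; split=> //.
by rewrite D2E.
Qed.

(** Needed since [ineq_number] and [kappa] fall back to 0 when there is no decomposition. The
    complement of [X] is a finite union of open basic sets; taking complements and distributing
    gives closed ones, each then described minimally. *)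
Lemma decomposition_exists X : closed X -> semialgebraic X ->
  exists k (D : 'I_k -> description R n), decomposition X D.
Proof.
move=> cX sX; have [hss hP] := complement_open_basics cX sX.
have [gss gP] := distribute hss.
pose D0 (i : 'I_(size gss)) := Description (nth [::] gss i) [::].
have [D DP] := choice (fun i => minimal_exists (D0 i)).
exists (size gss), D; split=> [i|]; first by have [] := DP i.
apply/seteqP; split=> x.
  move=> Xx; have : has (fun gs => all (fun g => 0 <= peval g x) gs) gss.
    rewrite -gP; apply/allP => hs hhs; apply: contrapT => nh.
    suff /hP : has (open_basic ^~ x) hss by [].
    apply/hasP; exists hs => //; apply/allP => h hh; rewrite ltNge.
    by apply/negP => hx; apply: nh; apply/hasP; exists h.
  move=> /(has_nthP [::])[i ilt gx]; exists (Ordinal ilt).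
  by rewrite (DP _).1 /basic_set /= andbT.
move=> [i]; rewrite (DP i).1 /basic_set /= andbT => gx; apply: contrapT => /hP nX.
have : has (fun gs => all (fun g => 0 <= peval g x) gs) gss.
  by apply/hasP; exists (nth [::] gss i) => //; exact: mem_nth.
rewrite -gP => /allP h; move: nX => /hasP[hs /h /hasP[q qhs qx]] /allP /(_ q qhs).
by rewrite ltNge qx.
Qed.

Lemma nat_min_mem (A : set nat) : A !=set0 -> A (nat_min A).
Proof.
move=> [a Aa]; have exP : exists k, `[<A k>] by exists a; apply/asboolP.
case: (ex_minnP exP) => k /asboolP Ak kmin.
have : [set m | A m /\ forall j, A j -> (m <= j)%N] (nat_min A).
  by apply: xgetPex; exists k; split=> // j Aj; apply: kmin; exact/asboolP.
by case.
Qed.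

(** A decomposition attaining [ineq_number] shows that the set defining [kappa] is nonempty, so
    [kappa] is attained in turn. *)
Theorem optimal_decomposition X : closed X -> semialgebraic X ->
  exists k (D : 'I_k -> description R n), [/\ X = [set x | exists i, basic_set (D i) x],
    forall i, (size (ineqs (D i)) <= ineq_number X)%N &
    forall i p, p \in ineqs (D i) ++ eqns (D i) -> (mpoly.msize p <= (kappa X).+1)%N].
Proof.
move=> cX sX; have [k [D dD]] := decomposition_exists cX sX.
have [|k1 [D1 [dD1 r1]]] := nat_min_mem (A := [set m | exists (k : nat)
    (D : 'I_k -> description R n),
    decomposition X D /\ m = (\max_(i < k) size (ineqs (D i)))%N]).
  by exists (\max_(i < k) size (ineqs (D i)))%N, k, D.
rewrite -/(ineq_number X) in r1.
have [|k2 [D2 [dD2 s2 d2]]] := nat_min_mem (A := [set m | exists (k : nat)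
    (D : 'I_k -> description R n), [/\ decomposition X D,
        forall i, (size (ineqs (D i)) <= ineq_number X)%N &
        m = (\max_(i < k) \max_(p <- ineqs (D i) ++ eqns (D i)) pdeg p)%N]]).
  exists (\max_(i < k1) \max_(p <- ineqs (D1 i) ++ eqns (D1 i)) pdeg p)%N, k1, D1.
  by split=> // i; rewrite r1; exact: (leq_bigmax i).
exists k2, D2; split=> // [|i p pD]; first by case: dD2.
have : (pdeg p <= kappa X)%N.
  rewrite [kappa X]d2; apply: leq_trans (leq_bigmax i); exact: leq_bigmax_seq.
by rewrite /pdeg; case: (mpoly.msize p).
Qed.
End Decomposition.

(** * Lifting to the zeros of a polynomial *)

Section Lift.
Variables (R : realType) (N q : nat).
Implicit Types (p : mpoly.mpoly N R) (w : 'rV[R]_(N + q)).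

Definition lift_mnm (m : mpoly.multinom N) : mpoly.multinom (N + q) :=
  mpoly.Multinom [tuple (if fintype.split k is inl i then m i else 0%N) | k < N + q].

Definition lift_mpoly p : mpoly.mpoly (N + q) R :=
  \sum_(m <- mpoly.msupp p) mpoly.mcoeff m p *: mpoly.mpolyX R (lift_mnm m).

Lemma lift_mnm_lshift m i : lift_mnm m (lshift q i) = m i.
Proof. by rewrite mpoly.mnmE (unsplitK (inl i)). Qed.

Lemma lift_mnm_rshift m i : lift_mnm m (rshift N i) = 0%N.
Proof. by rewrite mpoly.mnmE (unsplitK (inr i)). Qed.

Lemma peval_lift p w : peval (lift_mpoly p) w = peval p (lsubmx w).
Proof.
rewrite [in RHS](mpoly.mpolyE p) !peval_sum; apply: eq_bigr => m _.
rewrite !pevalZ /peval !mpoly.mevalX big_split_ord /= [X in _ * (_ * X)]big1 ?mulr1.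
  by congr (_ * _); apply: eq_bigr => i _; rewrite mxE lift_mnm_lshift.
by move=> i _; rewrite lift_mnm_rshift expr0.
Qed.

Lemma msize_lift p a : (mpoly.msize p <= a)%N -> (mpoly.msize (lift_mpoly p) <= a)%N.
Proof.
move=> pa; rewrite /lift_mpoly big_seq; apply: (big_ind (fun g => mpoly.msize g <= a)%N).
- by rewrite mpoly.msize0.
- by move=> f g; exact: msizeD_leq.
move=> m mp; apply: msizeZ_leq; rewrite mpoly.msizeX (leq_trans _ pa) //.
apply: leq_trans (mpoly.msize_mdeg_lt mp); rewrite ltnS !mpoly.mdegE big_split_ord /=.
rewrite [X in (_ + X)%N]big1 ?addn0 => [|i _]; last by rewrite lift_mnm_rshift.
by rewrite leq_eqVlt; apply/orP; left; apply/eqP/eq_bigr => i _; rewrite lift_mnm_lshift.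
Qed.

Lemma enorm_lsubmx w : enorm (lsubmx w) <= enorm w.
Proof.
rewrite -ler_sqr ?nnegrE ?enorm_ge0 // !sqr_enorm big_split_ord /=.
under eq_bigr do rewrite mxE.
by rewrite lerDl sumr_ge0 // => i _; exact: sqr_ge0.
Qed.

Variables (d : nat) (D : description R N).
Hypothesis d_ge2 : (2 <= d)%N.
Hypothesis size_D : forall p, p \in ineqs D ++ eqns D -> (mpoly.msize p <= d.+1)%N.
Variable e : 'I_(size (ineqs D)) -> 'I_(N + q).
Local Notation g k := (nth 0 (ineqs D) k).

(* Its zeros [w] are the points of the basic set together with square roots of the
   values of the inequalities. *)
Definition slack : mpoly.mpoly (N + q) R :=
  \sum_(k < size (ineqs D)) (lift_mpoly (g k) - mpoly.mpolyX R (mpoly.mnm1 (e k)) ^+ 2) ^+ 2 +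
  \sum_(k < size (eqns D)) lift_mpoly (nth 0 (eqns D) k) ^+ 2.

Lemma peval_slack w : peval slack w =
  \sum_(k < size (ineqs D)) (peval (g k) (lsubmx w) - w ord0 (e k) ^+ 2) ^+ 2 +
  \sum_(k < size (eqns D)) peval (nth 0 (eqns D) k) (lsubmx w) ^+ 2.
Proof.
rewrite pevalD !peval_sum; congr (_ + _); apply: eq_bigr => k _.
  by rewrite pevalXn pevalB peval_lift pevalXn pevalX.
by rewrite pevalXn peval_lift.
Qed.

Lemma slack_ge0 w : 0 <= peval slack w.
Proof. by rewrite peval_slack addr_ge0 // sumr_ge0 // => k _; exact: sqr_ge0. Qed.

Lemma msize_slack : (mpoly.msize slack <= (2 * d).+1)%N.
Proof.
apply: msizeD_leq; apply: msize_sum_leq => k; apply: msizeXn_leq.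
  apply: msizeD_leq.
    by apply: msize_lift; apply: size_D; rewrite mem_cat mem_nth.
  (* The squared slack variable has degree 2, within the bound because [d >= 2]. Degree 1 is left to
     the polyhedra. *)
  apply: msizeN_leq; apply: (@leq_trans (2 * 1).+1); last by clear -d_ge2; lia.
  by apply: msizeXn_leq; exact: msizeXU_leq.
by apply: msize_lift; apply: size_D; rewrite mem_cat mem_nth ?orbT.
Qed.

Lemma slack_eq0 w : peval slack w = 0 -> basic_set D (lsubmx w) /\
  forall k : 'I_(size (ineqs D)), peval (g k) (lsubmx w) = w ord0 (e k) ^+ 2.
Proof.
rewrite peval_slack => /eqP; rewrite paddr_eq0 ?sumr_ge0 // => [|k _|k _]; try exact: sqr_ge0.
rewrite !psumr_eq0 => [|k _|k _]; try exact: sqr_ge0.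
move=> /andP[/allP gw /allP hw].
have gE (k : 'I_(size (ineqs D))) : peval (g k) (lsubmx w) = w ord0 (e k) ^+ 2.
  by have := gw k (mem_index_enum k); rewrite sqrf_eq0 subr_eq0 => /eqP.
split=> //; apply/andP; split; apply/(all_nthP 0) => k klt.
  by rewrite (gE (Ordinal klt)) sqr_ge0.
by have := hw (Ordinal klt) (mem_index_enum _); rewrite sqrf_eq0.
Qed.

(** When [w] carries square roots of the values at [y], each term of [slack] is the square of a
    difference of values of one polynomial at [lsubmx w] and at [y]. *)
Lemma slack_lipschitz : exists2 C, 0 <= C & forall w y,
  enorm (lsubmx w) <= 1 -> enorm y <= 1 -> basic_set D y ->
  (forall k : 'I_(size (ineqs D)), w ord0 (e k) ^+ 2 = peval (g k) y) ->
  peval slack w <= C * enorm (lsubmx w - y) ^+ 2.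
Proof.
have H p : exists C, 0 <= C /\ forall x y, enorm x <= 1 -> enorm y <= 1 ->
    (peval p x - peval p y) ^+ 2 <= C ^+ 2 * enorm (x - y) ^+ 2.
  have [C C0 CP] := peval_lipschitz p 1; exists C; split=> // x y x1 y1.
  rewrite -exprMn -real_normK ?num_real // lerXn2r ?nnegrE ?mulr_ge0 ?enorm_ge0 //.
  by have [] := CP y x y1 x1.
have [C CP] := choice H.
exists (\sum_(k < size (ineqs D)) C (g k) ^+ 2 +
    \sum_(k < size (eqns D)) C (nth 0 (eqns D) k) ^+ 2).
  by rewrite addr_ge0 // sumr_ge0 // => k _; exact: sqr_ge0.
move=> w y w1 y1 /andP[_ /allP hy] gy; rewrite peval_slack mulrDl !mulr_suml.
apply: lerD; apply: ler_sum => k _; first by rewrite gy; exact: (CP _).2.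
have := (CP (nth 0 (eqns D) k)).2 _ _ w1 y1.
by have /eqP-> := hy _ (mem_nth 0 (ltn_ord k)); rewrite subr0.
Qed.
End Lift.

Lemma rVB_coord (R : realType) m (u v : 'rV[R]_m) k : (u - v) ord0 k = u ord0 k - v ord0 k.
Proof. by rewrite mxE [X in _ + X]mxE. Qed.

Section Pieces.
Variables (R : realType) (N d : nat) (D1 D2 : description R N).
Hypotheses (N_gt0 : (0 < N)%N) (d_ge2 : (2 <= d)%N).
Hypothesis size_D1 : forall p, p \in ineqs D1 ++ eqns D1 -> (mpoly.msize p <= d.+1)%N.
Hypothesis size_D2 : forall p, p \in ineqs D2 ++ eqns D2 -> (mpoly.msize p <= d.+1)%N.
Hypotheses (D1_0 : basic_set D1 0) (D2_0 : basic_set D2 0).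

Local Notation r1 := (size (ineqs D1)).
Local Notation r2 := (size (ineqs D2)).
Local Notation n := (N + (r1 + r2))%N.
Local Notation g1 k := (nth 0 (ineqs D1) k).
Local Notation g2 k := (nth 0 (ineqs D2) k).
Local Notation AB := (basic_set D1 `&` basic_set D2).

Let e1 (k : 'I_r1) : 'I_n := rshift N (lshift r2 k).
Let e2 (k : 'I_r2) : 'I_n := rshift N (rshift r1 k).
Let f := slack e1 + slack e2.
(** The base point is [x] for both pieces: the first [slack] vanishes at [w x y], and the second
    measures the failure of [x] to lie in the second piece, up to a multiple of [|x - y|^2]. *)
Let w (x y : 'rV[R]_N) : 'rV[R]_n := row_mx x
  (row_mx (\row_k Num.sqrt (peval (g1 k) x)) (\row_k Num.sqrt (peval (g2 k) y))).

Let w1 x y k : w x y ord0 (e1 k) = Num.sqrt (peval (g1 k) x).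
Proof. by rewrite row_mxEr row_mxEl mxE. Qed.

Let w2 x y k : w x y ord0 (e2 k) = Num.sqrt (peval (g2 k) y).
Proof. by rewrite !row_mxEr mxE. Qed.

Let f_ge0 z : 0 <= peval f z.
Proof. by rewrite pevalD addr_ge0 // slack_ge0. Qed.

Let f_upper : exists2 C, 0 < C & forall x y, enorm x <= 1 -> enorm y <= 1 ->
  basic_set D1 x -> basic_set D2 y -> peval f (w x y) <= C * enorm (x - y) ^+ 2.
Proof.
have [C1 C10 P1] := slack_lipschitz e1; have [C2 C20 P2] := slack_lipschitz e2.
exists (C1 + C2 + 1) => [|x y x1 y1 Dx Dy]; first by rewrite ltr_wpDl // addr_ge0.
have := P1 (w x y) x; rewrite row_mxKl subrr enorm0 expr0n mulr0 => {}P1.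
have := P2 (w x y) y; rewrite row_mxKl => {}P2.
rewrite pevalD; apply: (@le_trans _ _ (0 + C2 * enorm (x - y) ^+ 2)).
  apply: lerD.
    apply: P1 => // k; rewrite w1 sqr_sqrtr //.
    by case/andP: Dx => /allP gx _; apply: gx; exact: mem_nth.
  apply: P2 => // k; rewrite w2 sqr_sqrtr //.
  by case/andP: Dy => /allP gy _; apply: gy; exact: mem_nth.
by rewrite add0r ler_wpM2r ?sqr_ge0 //; lra.
Qed.

Let f_w0 : peval f (w 0 0) = 0.
Proof.
have [C C0 CP] := f_upper; apply/eqP; rewrite eq_le f_ge0 andbT.
by have := CP 0 0; rewrite enorm0 subrr enorm0 expr0n mulr0; apply.
Qed.

Let w_near e : 0 < e -> exists2 r, 0 < r & forall x y, enorm x < r -> enorm y < r ->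
  enorm (w x y - w 0 0) < e.
Proof.
move=> e0; pose e' := e / n.+1%:R; have e'0 : 0 < e' by rewrite divr_gt0.
have sq (p : mpoly.mpoly N R) : exists2 r, 0 < r & forall x, enorm x < r ->
    `|Num.sqrt (peval p x) - Num.sqrt (peval p 0)| < e'.
  have cs : {for 0, continuous (fun x => Num.sqrt (peval p x))}.
    by apply: continuous_comp; [exact: peval_continuous|exact: sqrt_continuous].
  have /nbhs_enorm[r r0 rP] := cs _ (nbhsx_ballx (Num.sqrt (peval p 0)) _ e'0).
  by exists r => // x; have := rP x; rewrite subr0 -ball_normE /= distrC.
have H k : exists r, 0 < r /\ forall x y, enorm x < r -> enorm y < r ->
    `|w x y ord0 k - w 0 0 ord0 k| < e'.
  case: (split_ordP k) => [i ->|j ->].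
    exists e'; split=> // x y xe _; rewrite !row_mxEl mxE subr0.
    exact: le_lt_trans (enorm_coord x i) xe.
  case: (split_ordP j) => [i ->|i ->].
    by have [r r0 rP] := sq (g1 i); exists r; split=> // x y xr _; rewrite !w1; exact: rP.
  by have [r r0 rP] := sq (g2 i); exists r; split=> // x y _ yr; rewrite !w2; exact: rP.
have [r rP] := choice H.
exists (\big[Num.min/1]_k r k) => [|x y xr yr].
  by apply: lt_bigmin => // k _; case: (rP k).
apply: (@le_lt_trans _ _ (e' * n%:R)).
  apply: enorm_le_coord => k; rewrite rVB_coord ltW //; apply: (rP k).2.
    by apply: lt_le_trans xr _; exact: bigmin_le.
  by apply: lt_le_trans yr _; exact: bigmin_le.
by rewrite /e' mulrAC ltr_pdivrMr // ltr_pM2l // ltr_nat.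
Qed.

Let f_zero z : peval f z = 0 -> AB (lsubmx z) /\
  ((forall k : 'I_r1, peval (g1 k) (lsubmx z) = z ord0 (e1 k) ^+ 2) /\
   (forall k : 'I_r2, peval (g2 k) (lsubmx z) = z ord0 (e2 k) ^+ 2)).
Proof.
rewrite pevalD => /eqP; rewrite paddr_eq0 ?slack_ge0 // => /andP[/eqP/slack_eq0[A1 P1]].
by move=> /eqP/slack_eq0[A2 P2]; split.
Qed.

Let msize_f : (mpoly.msize f <= (2 * d).+1)%N.
Proof. by apply: msizeD_leq; exact: msize_slack. Qed.

Lemma square_root_bound (c C b s t : R) L : 0 < c -> 0 < C -> 0 <= b -> 0 <= t ->
  c * b ^+ (2 * L) <= C * t ^+ 2 -> Num.sqrt (c / C) * b ^+ L <= t.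
Proof.
move=> c0 C0 b0 t0 h; rewrite -ler_sqr ?nnegrE ?mulr_ge0 ?sqrtr_ge0 ?exprn_ge0 //.
rewrite exprMn sqr_sqrtr ?divr_ge0 ?(ltW c0) ?(ltW C0) // -exprM [(L * 2)%N]mulnC.
by rewrite mulrAC ler_pdivrMr // [t ^+ 2 * C]mulrC.
Qed.

Theorem piece_distance : exists c rho, [/\ 0 < c, 0 < rho & forall x y,
  enorm x < rho -> enorm y < rho -> basic_set D1 x -> basic_set D2 y ->
  c * dist x AB ^+ (d * (6 * d - 3) ^ (n - 1)) <= enorm (x - y)].
Proof.
have n0 : (0 < n)%N by rewrite addn_gt0 N_gt0.
have D4 : (4 <= 2 * d)%N by clear -d_ge2; lia.
have [c [rho [c0 rho0 cP]]] := lojasiewicz_distance n0 D4 msize_f f_ge0 f_w0.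
have [C C0 CP] := f_upper; have [r r0 rP] := w_near rho0.
exists (Num.sqrt (c / C)), (Num.min r 1); split.
- by rewrite sqrtr_gt0 divr_gt0.
- by rewrite lt_min r0 ltr01.
move=> x y; rewrite !lt_min => /andP[xr x1] /andP[yr y1] Dx Dy.
(* For [D = 2 d] the exponent of the distance is twice the claimed one, and the upper bound on [f]
   is quadratic, so a square root is taken. *)
apply: square_root_bound => //; [exact: dist_ge0|exact: enorm_ge0|].
apply: le_trans (CP x y (ltW x1) (ltW y1) Dx Dy).
apply: le_trans (cP _ (rP x y xr yr)); rewrite ler_pM2l // mulnA subn1.
have -> : (3 * (2 * d) - 3 = 6 * d - 3)%N by clear; lia.
apply: lerXn2r; rewrite ?nnegrE ?dist_ge0 //.
apply: lb_le_inf; first by exists (enorm (w x y - w 0 0)), (w 0 0).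
move=> _ [z /= fz <-]; apply: le_trans (enorm_lsubmx _).
rewrite linearB /= row_mxKl; apply: dist_le; exact: (f_zero fz).1.
Qed.

Theorem piece_isolated e : 0 < e -> (forall x, enorm x <= e -> AB x -> x = 0) ->
  exists c rho, [/\ 0 < c, 0 < rho & forall x y,
  enorm x < rho -> enorm y < rho -> basic_set D1 x -> basic_set D2 y ->
  c * enorm x ^+ (((2 * d - 1) ^ n + 1) %/ 2) <= enorm (x - y)].
Proof.
move=> e0 AB0.
have m0 : (0 < 2 * d - 1)%N by clear -d_ge2; lia.
have msize_f' : (mpoly.msize f <= (2 * d - 1).+2)%N.
  by apply: leq_trans msize_f _; clear -d_ge2; lia.
(* The zeros of [f] above the origin differ from [w 0 0] in the signs of square roots. A radius at
   most every positive root rules out the other signs. *)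
pose r := Num.min e (\big[Num.min/1]_k (if 0 < w 0 0 ord0 k then w 0 0 ord0 k else 1)).
have r0 : 0 < r by rewrite lt_min e0; apply: lt_bigmin => // k _; case: ifP.
have iso z : enorm (z - w 0 0) <= r -> peval f z = 0 -> z = w 0 0.
  rewrite le_min => /andP[ze zr] /f_zero[ABz [z1 z2]].
  have lz : lsubmx z = 0.
    apply: AB0 => //; apply: le_trans ze; apply: le_trans (enorm_lsubmx _).
    by rewrite linearB /= row_mxKl subr0.
  have root k : z ord0 k ^+ 2 = w 0 0 ord0 k ^+ 2 -> 0 <= w 0 0 ord0 k ->
      z ord0 k = w 0 0 ord0 k.
    move=> /eqP; rewrite eqf_sqr => /orP[/eqP //|/eqP zw]; rewrite le_eqVlt.
    move=> /orP[/eqP w0|w0]; first by rewrite zw -w0 oppr0.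
    have zk : enorm (z - w 0 0) <= if 0 < w 0 0 ord0 k then w 0 0 ord0 k else 1.
      by apply: le_trans zr _; exact: bigmin_le.
    have := le_trans (enorm_coord (z - w 0 0) k) zk.
    by rewrite w0 rVB_coord zw -opprD normrN ger0_norm ?addr_ge0 ?(ltW w0) //; lra.
  apply/rowP => k; case: (split_ordP k) => [i ->|j ->].
    have := congr1 (fun v : 'rV[R]_N => v ord0 i) lz; rewrite mxE => ->.
    by rewrite row_mxEl.
  case: (split_ordP j) => [i ->|i ->]; apply: root.
  - rewrite -(z1 i) lz w1 sqr_sqrtr //.
    by case/andP: D1_0 => /allP gx _; apply: gx; exact: mem_nth.
  - by rewrite w1 sqrtr_ge0.
  - rewrite -(z2 i) lz w2 sqr_sqrtr //.
    by case/andP: D2_0 => /allP gx _; apply: gx; exact: mem_nth.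
  - by rewrite w2 sqrtr_ge0.
have [c [rho [c0 rho0 cP]]] := isolated_zero_lower_bound m0 msize_f' f_ge0 f_w0 r0 iso.
have [C C0 CP] := f_upper; have [r' r'0 rP] := w_near rho0.
exists (Num.sqrt (c / C)), (Num.min r' 1); split.
- by rewrite sqrtr_gt0 divr_gt0.
- by rewrite lt_min r'0 ltr01.
move=> x y; rewrite !lt_min => /andP[xr x1] /andP[yr y1] Dx Dy.
apply: square_root_bound => //; [exact: enorm_ge0|exact: enorm_ge0|].
apply: le_trans (CP x y (ltW x1) (ltW y1) Dx Dy).
apply: le_trans (cP _ (rP x y xr yr)); rewrite ler_pM2l //.
(* [(2 d - 1)^n] is odd, so the division by 2 is exact. *)
have -> : (2 * (((2 * d - 1) ^ n + 1) %/ 2) = ((2 * d - 1) ^ n).+1)%N.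
  have o : odd ((2 * d - 1) ^ n) by rewrite oddX; apply/orP; right; clear -d_ge2; lia.
  by move: o; move: ((2 * d - 1) ^ n)%N => a; clear; lia.
apply: lerXn2r; rewrite ?nnegrE ?enorm_ge0 //.
apply: le_trans (enorm_lsubmx _); rewrite linearB /= !row_mxKl subr0 //.
Qed.
End Pieces.

(** * Polyhedra *)

Lemma peval_affine (R : realType) n (q : mpoly.mpoly n R) x v : (mpoly.msize q <= 2)%N ->
  peval q (x + v) = peval q x + edot (grad q 0) v.
Proof.
move=> sq.
pose l : mpoly.mpoly n R := \sum_i grad q 0 ord0 i *: mpoly.mpolyX R (mpoly.mnm1 i).
have lE y : peval l y = edot (grad q 0) y.
  by rewrite peval_sum; apply: eq_bigr => i _; rewrite pevalZ pevalX.
have g0 y : grad (q - l) y = 0.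
  have const i : peval (mpoly.mderiv i q) y = peval (mpoly.mderiv i q) 0.
    have := mpoly.msize1_polyC (@msize_mderiv R n q i 0 sq).
    by move=> ->; rewrite !pevalC.
  rewrite gradD gradN grad_sum; apply/eqP; rewrite subr_eq0; apply/eqP/rowP => i.
  rewrite mxE const summxE (bigD1 i) //= gradZ !mxE mderivXU eqxx pevalC mulr1.
  rewrite big1 ?addr0 // => j ji; rewrite gradZ !mxE mderivXU eq_sym (negbTE ji).
  by rewrite pevalC mulr0.
have := peval_constant g0 (x + v) x; rewrite !pevalB !lE edotDr.
by move=> h; lra.
Qed.

Section Polyhedra.
Variables (R : realType) (n : nat).

(* [u] lies in the polar of the cone cut out by the [p j], which meets the cone only at 0. *)
Lemma cone_bound m (p : 'I_m -> 'rV[R]_n) (J : {set 'I_m}) :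
  exists c, 0 < c /\ forall u, enorm u = 1 ->
    (forall v, (forall j, j \in J -> 0 <= edot (p j) v) -> edot u v <= 0) ->
    exists2 j, j \in J & edot (p j) u <= - c.
Proof.
pose T := [set v | forall j, j \in J -> 0 <= edot (p j) v].
pose K := [set u : 'rV[R]_n | enorm u = 1 /\ forall v, T v -> edot u v <= 0].
apply: contrapT => ne.
have H (k : nat) : exists u, K u /\ forall j, j \in J -> - k.+1%:R^-1 < edot (p j) u.
  apply: contrapT => nu; apply: ne; exists k.+1%:R^-1; split; first by rewrite invr_gt0.
  move=> u u1 uT; apply: contrapT => nj; apply: nu; exists u; split=> // j jJ.
  by rewrite ltNge; apply/negP => le; apply: nj; exists j.
have [u uP] := choice H.
have cK : compact K.
  have -> : K = [set x | enorm (x - 0) <= 1] `&` ([set x | enorm (x - 0) = 1] `&`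
      \bigcap_(v in T) [set x | peval (\sum_i v ord0 i *: mpoly.mpolyX R (mpoly.mnm1 i)) x <= 0]).
    have E (v x : 'rV[R]_n) :
        peval (\sum_i v ord0 i *: mpoly.mpolyX R (mpoly.mnm1 i)) x = edot x v.
      by rewrite peval_sum edotC; apply: eq_bigr => i _; rewrite pevalZ pevalX.
    apply/seteqP; split=> x.
      move=> [x1 xT]; split=> /=; first by rewrite subr0 x1.
      by split=> [|v Tv]; [rewrite subr0|rewrite /= E; exact: xT].
    by move=> [_ [/= x1 xT]]; split=> [|v /xT]; [rewrite -x1 subr0|rewrite /= E].
  apply: compact_closedI; first exact: (@compact_eball _ _ 0 1).
  apply: closedI.
    exact: (closed_comp (fun x _ => @enorm_continuous _ _ 0 x) (@closed_eq R 1)).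
  by apply: closed_bigI => v _; exact: closed_peval_le.
have [x [x1 xT] xP] := cluster_sequence cK (fun j => (uP j).1).
(* The cluster point lies in the cone as well as in its polar, so [|x|^2 <= 0], against
   [|x| = 1]. *)
have Tx : T x.
  move=> j jJ; rewrite leNgt; apply/negP => neg.
  pose eta := - edot (p j) x / 2; have eta0 : 0 < eta by rewrite /eta; lra.
  have [k0] := ltr_add_invr eta0; rewrite add0r => k0P.
  pose e := eta / (enorm (p j) + 1).
  have pj : 0 < enorm (p j) + 1 by rewrite ltr_wpDl ?enorm_ge0.
  have e0 : 0 < e by rewrite divr_gt0.
  have [k k0k ke] := xP k0 e e0.
  have h1 := (uP k).2 j jJ.
  have h2 : k.+1%:R^-1 <= k0.+1%:R^-1 :> R by rewrite lef_pV2 ?posrE // ler_nat.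
  have h3 := cauchy_schwarz (p j) (u k - x); rewrite edotDr edotNr in h3.
  have h4 : enorm (p j) * enorm (u k - x) <= eta.
    apply: (@le_trans _ _ ((enorm (p j) + 1) * e)).
      by apply: ler_pM; rewrite ?enorm_ge0 ?lerDl // ltW.
    by rewrite /e mulrC divfK // gt_eqF.
  have h5 := le_trans (le_trans (ler_norm _) h3) h4.
  have h7 : - eta < edot (p j) (u k).
    by apply: le_lt_trans h1; rewrite lerN2; exact: le_trans h2 (ltW k0P).
  by move: h5 h7; rewrite /eta; lra.
by have := xT x Tx; rewrite -sqr_enorm_edot x1 expr1n; lra.
Qed.

Implicit Type qs : seq (mpoly.mpoly n R).
Definition polyhedron qs : set 'rV[R]_n := [set x | all (fun q => 0 <= peval q x) qs].

(** Hoffman's error bound. If [a] is the point nearest to [x], then [x - a] lies in the polar of the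
    cone of constraints active at [a], and by [cone_bound] one of these is violated at [x] by a
    multiple of [|x - a|]. The constant is a minimum over all possible active sets. *)
Lemma polyhedron_distance qs : polyhedron qs 0 ->
  (forall q, q \in qs -> (mpoly.msize q <= 2)%N) ->
  exists2 c, 0 < c & forall x, ~ polyhedron qs x ->
    exists2 q, q \in qs & c * dist x (polyhedron qs) <= - peval q x.
Proof.
move=> P0 sqs; pose Q (j : 'I_(size qs)) := nth 0 qs j.
have Qqs j : Q j \in qs by exact: mem_nth.
have [c cP] := choice (cone_bound (fun j => grad (Q j) 0)).
exists (\big[Num.min/1]_J c J) => [|x nx].
  by apply: lt_bigmin => // J _; case: (cP J).
have cPx : compact ([set y | enorm (y - x) <= enorm x] `&` polyhedron qs).
  by apply: compact_closedI; [exact: (@compact_eball _ _ x (enorm x))|exact: closed_all_ge0].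
have [|a [ax Pa] amin] := compact_min _ cPx (@enorm_continuous _ _ x).
  by exists 0; split=> //=; rewrite sub0r enormN.
have {}amin y : polyhedron qs y -> enorm (a - x) <= enorm (y - x).
  move=> Py; have [yx|yx] := leP (enorm (y - x)) (enorm x); first exact: amin.
  by apply: le_trans ax _; exact: ltW.
pose r := enorm (x - a).
have r0 : 0 < r.
  rewrite lt_neqAle enorm_ge0 andbT eq_sym; apply/eqP => /enorm_eq0/eqP.
  by rewrite subr_eq0 => /eqP xa; apply: nx; rewrite xa.
pose J := [set j | peval (Q j) a == 0]%SET.
have [j jJ jc] : exists2 j, j \in J & edot (grad (Q j) 0) (r^-1 *: (x - a)) <= - c J.
  apply: (cP J).2 => [|v Tv].
    by rewrite enormZ ger0_norm ?invr_ge0 ?enorm_ge0 // mulVf // gt_eqF.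
  rewrite edotZl pmulr_rle0 ?invr_gt0 // leNgt; apply/negP => xv.
  (* Small steps along [v] stay in the polyhedron: active constraints do not decrease, and the
     others are positive at [a]. *)
  have step j : exists e, 0 < e /\ forall t, 0 < t < e -> 0 <= peval (Q j) (a + t *: v).
    have qa : 0 <= peval (Q j) a by exact: (allP Pa).
    have [qa0|qa0] := eqVneq (peval (Q j) a) 0.
      exists 1; split=> // t /andP[t0 _]; rewrite peval_affine ?sqs // qa0 add0r edotZr.
      by apply: mulr_ge0; [exact: ltW|apply: Tv; rewrite inE qa0].
    have qpos : 0 < peval (Q j) a by rewrite lt_neqAle eq_sym qa0.
    have b0 : 0 < `|edot (grad (Q j) 0) v| + 1 by rewrite ltr_wpDl.
    exists (peval (Q j) a / (`|edot (grad (Q j) 0) v| + 1)); split; first exact: divr_gt0.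
    move=> t /andP[t0]; rewrite ltr_pdivlMr // => tq.
    rewrite peval_affine ?sqs // edotZr.
    have := ler_norm (- (t * edot (grad (Q j) 0) v)).
    by rewrite normrN normrM gtr0_norm //; lra.
  have [e eP] := choice step.
  (* A step of length factor [t < s] would bring [a] closer to [x]. *)
  pose s := edot (x - a) v / (enorm v ^+ 2 + 1).
  have v1 : 0 < enorm v ^+ 2 + 1 by rewrite ltr_wpDl ?sqr_ge0.
  have s0 : 0 < s by exact: divr_gt0.
  pose t := Num.min s (\big[Num.min/1]_j e j) / 2.
  have m0 : 0 < Num.min s (\big[Num.min/1]_j e j).
    by rewrite lt_min s0; apply: lt_bigmin => // i _; case: (eP i).
  have t0 : 0 < t by rewrite divr_gt0.
  have : t < Num.min s (\big[Num.min/1]_j e j) by rewrite /t; lra.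
  rewrite lt_min => /andP[ts te].
  have := amin (a + t *: v); rewrite -ler_sqr ?nnegrE ?enorm_ge0 // => h.
  have {}h : enorm (a - x) ^+ 2 <= enorm (a + t *: v - x) ^+ 2.
    apply: h; apply/(all_nthP 0) => i ilt; apply: ((eP (Ordinal ilt)).2 t).
    by rewrite t0 (lt_le_trans te) //; exact: (bigmin_le (I := 'I_(size qs))).
  have E : a + t *: v - x = - ((x - a) - t *: v).
    by rewrite opprB [RHS]addrC opprB addrAC.
  move: h; rewrite E enormN enormB !sqr_enorm_edot.
  rewrite !(edotDl, edotDr, edotNl, edotNr, edotZl, edotZr).
  rewrite -(sqr_enorm_edot v) (edotC v x) (edotC v a) => h.
  move: ts; rewrite ltr_pdivlMr // edotDl edotNl mulrDr mulr1 => ts.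
  have v2 := sqr_ge0 (enorm v).
  have xv' : 0 < edot x v - edot a v by move: xv; rewrite edotDl edotNl.
  have : t * (t * enorm v ^+ 2) <= t * (edot x v - edot a v).
    by rewrite ler_pM2l //; lra.
  have := mulr_gt0 t0 xv'.
  by lra.
exists (Q j); rewrite // -{2}[x](subrK a) addrC peval_affine ?sqs //.
move: jJ; rewrite inE => /eqP ->; rewrite add0r.
move: jc; rewrite edotZr mulrC ler_pdivrMr // => jc.
have h : dist x (polyhedron qs) <= r by exact: dist_le.
have c0 : 0 < c J by case: (cP J).
apply: (@le_trans _ _ (c J * r)); last by rewrite lerNr; move: jc; rewrite mulNr.
apply: ler_pM => //; last exact: bigmin_le.
  by apply: ltW; apply: lt_bigmin => // I _; case: (cP I).
exact: dist_ge0.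
Qed.

Definition constraints (D : description R n) :=
  ineqs D ++ eqns D ++ [seq - h | h <- eqns D].

Lemma basic_set_polyhedron D : basic_set D = polyhedron (constraints D).
Proof.
apply/seteqP; split=> x; rewrite /basic_set /polyhedron /constraints /= !all_cat all_map.
  move=> /andP[-> /allP hx] /=; apply/andP; split; apply/allP => h /hx /eqP E /=.
    by rewrite E.
  by rewrite pevalN E oppr0.
move=> /and3P[-> /allP h1 /allP h2] /=; apply/allP => h hh.
by rewrite eq_le h1 // andbT -oppr_ge0 -pevalN; exact: h2.
Qed.

(** A constraint violated at [x] belongs to the second piece, so it holds at [y], and the violation
    is at most the norm of its gradient times [|x - y|]. *)
Lemma piece_distance_linear (D1 D2 : description R n) :
  basic_set D1 0 -> basic_set D2 0 ->
  (forall p, p \in ineqs D1 ++ eqns D1 -> (mpoly.msize p <= 2)%N) ->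
  (forall p, p \in ineqs D2 ++ eqns D2 -> (mpoly.msize p <= 2)%N) ->
  exists2 c, 0 < c & forall x y, basic_set D1 x -> basic_set D2 y ->
    c * dist x (basic_set D1 `&` basic_set D2) <= enorm (x - y).
Proof.
move=> D10 D20 s1 s2.
have sc D : (forall p, p \in ineqs D ++ eqns D -> (mpoly.msize p <= 2)%N) ->
    forall p, p \in constraints D -> (mpoly.msize p <= 2)%N.
  move=> sD p; rewrite /constraints catA mem_cat => /orP[/sD //|/mapP[h hD ->]].
  by apply: msizeN_leq; apply: sD; rewrite mem_cat hD orbT.
have AB : basic_set D1 `&` basic_set D2 = polyhedron (constraints D1 ++ constraints D2).
  rewrite !basic_set_polyhedron; apply/seteqP; split=> x; rewrite /polyhedron /= all_cat.
    by move=> [-> ->].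
  by move=> /andP.
rewrite {}AB; set P := polyhedron _.
have [|p|c c0 cP] := @polyhedron_distance (constraints D1 ++ constraints D2).
- rewrite /polyhedron /= all_cat; apply/andP.
  by split; [move: D10|move: D20]; rewrite basic_set_polyhedron.
- by rewrite mem_cat => /orP[] /sc; apply.
pose C := 1 + \sum_(q <- constraints D2) enorm (grad q 0).
have C0 : 0 < C by rewrite ltr_pwDl // sumr_ge0 // => q _; exact: enorm_ge0.
exists (c / C) => [|x y D1x D2y]; first exact: divr_gt0.
rewrite mulrAC ler_pdivrMr //; have [Px|nPx] := pselect (P x).
  have : dist x P <= 0 by apply: le_trans (dist_le x Px) _; rewrite subrr enorm0.
  move=> d0; apply: (@le_trans _ _ 0); first by rewrite pmulr_rle0.
  by rewrite mulr_ge0 ?enorm_ge0 // ltW.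
have [q qD qx] := cP x nPx; apply: (le_trans qx).
move: qD; rewrite mem_cat => /orP[q1|q2].
  move: D1x; rewrite basic_set_polyhedron => /allP/(_ q q1) q0.
  by apply: (@le_trans _ _ 0); [rewrite oppr_le0|rewrite mulr_ge0 ?enorm_ge0 // ltW].
move: D2y; rewrite basic_set_polyhedron => /allP/(_ q q2) q0.
have := peval_affine y (x - y) (sc D2 s2 q q2); rewrite addrC subrK => ->.
have := ler_norm (- edot (grad q 0) (x - y)); rewrite normrN.
have := cauchy_schwarz (grad q 0) (x - y).
have : enorm (grad q 0) * enorm (x - y) <= enorm (x - y) * C.
  rewrite mulrC ler_wpM2l ?enorm_ge0 // /C (big_rem q) //=.
  have : 0 <= \sum_(y <- rem q (constraints D2)) enorm (grad y 0).
    by rewrite sumr_ge0 // => ? _; exact: enorm_ge0.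
  by lra.
by lra.
Qed.
End Polyhedra.

(** * From the pieces to the sets *)

Lemma dist_triangle (R : realType) N (x y : 'rV[R]_N) (S : set 'rV[R]_N) : S !=set0 ->
  dist x S <= enorm (x - y) + dist y S.
Proof.
move=> [s Ss]; rewrite -lerBlDl; apply: lb_le_inf; first by exists (enorm (y - s)), s.
move=> _ [a Sa <-]; rewrite lerBlDl.
exact: le_trans (dist_le x Sa) (enorm_triangle y x a).
Qed.

Lemma exprD_le (R : realType) (a b : R) L : 0 <= a -> 0 <= b ->
  (a + b) ^+ L <= 2 ^+ L * (a ^+ L + b ^+ L).
Proof.
move=> a0 b0; pose m := Num.max a b; have m0 : 0 <= m by rewrite le_max a0.
have am : a <= m by rewrite le_max lexx.
have bm : b <= m by rewrite le_max lexx orbT.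
apply: (@le_trans _ _ ((2 * m) ^+ L)).
  by apply: lerXn2r; rewrite ?nnegrE ?addr_ge0 ?mulr_ge0 //; lra.
rewrite exprMn ler_wpM2l ?exprn_ge0 // /m.
have aL : 0 <= a ^+ L by exact: exprn_ge0.
have bL : 0 <= b ^+ L by exact: exprn_ge0.
by have [_|_] := leP a b; lra.
Qed.

Section Combine.
Variables (R : realType) (N L k1 k2 : nat) (X Y : set 'rV[R]_N).
Variables (D1 : 'I_k1 -> description R N) (D2 : 'I_k2 -> description R N).
(** [phi] will be the distance to the intersection, then the Euclidean norm, so both inequalities of
    the theorem share this argument. *)
Variable phi : 'rV[R]_N -> R.
Hypotheses (XE : X = [set x | exists i, basic_set (D1 i) x]).
Hypotheses (YE : Y = [set x | exists i, basic_set (D2 i) x]).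
Hypotheses (X0 : X 0) (Y0 : Y 0) (L_gt0 : (0 < L)%N).
Hypothesis phi_ge0 : forall x, 0 <= phi x.
Hypothesis phi_le : forall x, phi x <= enorm x.
Hypothesis phi_triangle : forall x y, phi x <= enorm (x - y) + phi y.
Hypothesis pieces : forall i j, basic_set (D1 i) 0 -> basic_set (D2 j) 0 ->
  exists l c rho, [/\ (l <= L)%N, 0 < c, 0 < rho & forall x y,
    enorm x < rho -> enorm y < rho -> basic_set (D1 i) x -> basic_set (D2 j) y ->
    c * phi x ^+ l <= enorm (x - y)].

(** Pieces are closed, so one that misses 0 misses a neighbourhood of 0. *)
Let away (D : description R N) : ~ basic_set D 0 ->
  exists2 rho, 0 < rho & forall x, enorm x < rho -> ~ basic_set D x.
Proof.
rewrite basic_set_polyhedron => nD.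
have : open (~` polyhedron (constraints D)) by rewrite openC; exact: closed_all_ge0.
move=> /(_ 0 nD) /nbhs_enorm[e e0 eP]; exists e => // x xe.
by apply: eP; rewrite subr0.
Qed.

Let near_pair : exists c rho, [/\ 0 < c, 0 < rho, rho <= 1 & forall x y,
  enorm x < rho -> enorm y < rho -> X x -> Y y -> c * phi x ^+ L <= enorm (x - y)].
Proof.
have H (ij : 'I_k1 * 'I_k2) : exists cr : R * R, [/\ 0 < cr.1, 0 < cr.2 & forall x y,
    enorm x < cr.2 -> enorm y < cr.2 -> enorm x < 1 ->
    basic_set (D1 ij.1) x -> basic_set (D2 ij.2) y -> cr.1 * phi x ^+ L <= enorm (x - y)].
  case: ij => i j /=.
  have [Di0|/away[rho rho0 rhoP]] := pselect (basic_set (D1 i) 0); last first.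
    by exists (1, rho); split=> // x y /rhoP.
  have [Dj0|/away[rho rho0 rhoP]] := pselect (basic_set (D2 j) 0); last first.
    by exists (1, rho); split=> // x y _ /rhoP.
  have [l [c [rho [lL c0 rho0 P]]]] := pieces Di0 Dj0.
  exists (c, rho); split=> // x y xr yr x1 Dx Dy; apply: le_trans (P x y xr yr Dx Dy).
  rewrite ler_pM2l //; apply: ler_wiXn2l => //.
  by apply: le_trans (phi_le x) _; exact: ltW.
have [cr crP] := choice H.
exists (\big[Num.min/1]_ij (cr ij).1), (\big[Num.min/1]_ij (cr ij).2); split.
- by apply: lt_bigmin => // ij _; case: (crP ij).
- by apply: lt_bigmin => // ij _; case: (crP ij).
- exact: bigmin_le_id.
move=> x y xr yr; rewrite XE YE => -[i Dx] [j Dy].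
have [c0 _ P] := crP (i, j).
apply: le_trans (P x y _ _ _ Dx Dy).
- by rewrite ler_wpM2r ?exprn_ge0 //; exact: bigmin_le.
- by apply: lt_le_trans xr _; exact: bigmin_le.
- by apply: lt_le_trans yr _; exact: bigmin_le.
- by apply: lt_le_trans xr _; exact: bigmin_le_id.
Qed.

Lemma combine_pieces : exists (U : set 'rV[R]_N) (C : R),
  [/\ nbhs (0 : 'rV[R]_N) U, 0 < C &
      forall x, U x -> C * phi x ^+ L <= dist x X + dist x Y].
Proof.
have [c [rho [c0 rho0 rho1 P]]] := near_pair.
(* For [a], [b] near 0 and [s = |x - a| + |x - b| <= 1]: [phi(x)^L <= (s + phi a)^L <= 2^L (s^L +
   phi(a)^L) <= 2^L (1 + 1/c) s]. For [s >= rho / 2] the bound [phi x <= |x| < rho / 2] is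
   enough. *)
pose K := 2 ^+ L * (1 + c^-1).
have K0 : 0 < K by rewrite mulr_gt0 ?exprn_gt0 // addr_gt0 // invr_gt0.
exists [set x | enorm x < rho / 2], (Num.min 1 K^-1); split.
- by apply/nbhs_enorm; exists (rho / 2) => [|y]; [rewrite divr_gt0|rewrite /= subr0].
- by rewrite lt_min ltr01 invr_gt0.
move=> x /= xr; pose s a b := enorm (x - a) + enorm (x - b).
suff main a b : X a -> Y b -> Num.min 1 K^-1 * phi x ^+ L <= s a b.
  rewrite -lerBlDl; apply: lb_le_inf; first by exists (enorm (x - 0)), 0.
  move=> _ [b Yb <-]; rewrite lerBlDl -lerBlDr.
  apply: lb_le_inf; first by exists (enorm (x - 0)), 0.
  by move=> _ [a Xa <-]; rewrite lerBlDr; exact: main.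
move=> Xa Yb; have sa0 := enorm_ge0 (x - a); have sb0 := enorm_ge0 (x - b).
have pL : 0 <= phi x ^+ L by exact: exprn_ge0.
have pow t : 0 <= t -> t <= 1 -> t ^+ L <= t.
  by move=> t0 t1; rewrite -[leRHS]expr1; apply: ler_wiXn2l.
have [sr|sr] := leP (rho / 2) (s a b).
  apply: (@le_trans _ _ (phi x ^+ L)).
    by rewrite -[leRHS]mul1r ler_wpM2r // ge_min lexx.
  have p1 := phi_le x; have p2 : phi x ^+ L <= phi x by apply: pow => //; lra.
  by lra.
have ar : enorm a < rho.
  have := enorm_triangle x a 0; rewrite !subr0 [enorm (a - x)]enormB.
  by move: sr; rewrite /s; lra.
have br : enorm b < rho.
  have := enorm_triangle x b 0; rewrite !subr0 [enorm (b - x)]enormB.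
  by move: sr; rewrite /s; lra.
have ab : enorm (a - b) <= s a b.
  by have := enorm_triangle x a b; rewrite [enorm (a - x)]enormB.
have h := le_trans (P a b ar br Xa Yb) ab.
have s0 : 0 <= s a b by exact: addr_ge0.
have xs : phi x <= s a b + phi a by have := phi_triangle x a; rewrite /s; lra.
apply: (@le_trans _ _ (K^-1 * phi x ^+ L)); first by rewrite ler_wpM2r // ge_min lexx orbT.
rewrite mulrC ler_pdivrMr //.
apply: (@le_trans _ _ ((s a b + phi a) ^+ L)).
  by apply: lerXn2r; rewrite ?nnegrE ?addr_ge0.
apply: le_trans (exprD_le L s0 (phi_ge0 a)) _.
rewrite /K mulrCA ler_wpM2l ?exprn_ge0 // mulrDr mulr1 lerD //.
  by apply: pow => //; lra.
by rewrite ler_pdivlMr // mulrC.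
Qed.
End Combine.

Theorem theorem1p1 (R : realType) (N : nat) (X Y : set 'rV[R]_N)
  (clX : closed X) (saX : semialgebraic X)
  (clY : closed Y) (saY : semialgebraic Y)
  (XY0 : (X `&` Y) 0) :
  let r := (ineq_number X + ineq_number Y)%N in
  let d := maxn (kappa X) (kappa Y) in
  (1 <= d)%N ->
  (exists (U : set 'rV[R]_N) (C : R),
     [/\ nbhs (0 : 'rV[R]_N) U, 0 < C &
         forall x, U x ->
           C * dist x (X `&` Y) ^+ (d * (6 * d - 3) ^ (N + r - 1))
             <= dist x X + dist x Y]) /\
  (isolated (X `&` Y) 0 ->
   exists (U : set 'rV[R]_N) (C : R),
     [/\ nbhs (0 : 'rV[R]_N) U, 0 < C &
         forall x, U x ->
           C * enorm x ^+ (((2 * d - 1) ^ (N + r) + 1) %/ 2)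
             <= dist x X + dist x Y]).
Proof.
move=> r d d1; set L1 := (d * _)%N; set L2 := (_ %/ 2)%N.
have L1_gt0 : (0 < L1)%N by rewrite muln_gt0 d1 expn_gt0; apply/orP; left; clear -d1; lia.
have L2_gt0 : (0 < L2)%N.
  rewrite divn_gt0 // addn1 ltnS expn_gt0; apply/orP; left; clear -d1; lia.
(* For [N = 0] the space is a single point and the left-hand sides vanish; [piece_distance] asks for
   a positive number of variables. *)
have [N0|N_gt0] := posnP N.
  have z (x : 'rV[R]_N) : x = 0.
    by apply/rowP => i; have := ltn_ord i; rewrite {2}N0.
  have trivial (phi : 'rV[R]_N -> R) L : phi 0 = 0 -> (0 < L)%N ->
      exists (U : set 'rV[R]_N) (C : R), [/\ nbhs (0 : 'rV[R]_N) U, 0 < C &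
        forall x, U x -> C * phi x ^+ L <= dist x X + dist x Y].
    move=> phi0 L0; exists setT, 1; split=> //; first exact: filterT.
    by move=> x _; rewrite (z x) phi0 expr0n gtn_eqF // mulr0 addr_ge0 // dist_ge0.
  split=> [|_]; apply: trivial => //; last exact: enorm0.
  apply/eqP; rewrite eq_le dist_ge0 andbT.
  by apply: le_trans (dist_le 0 XY0) _; rewrite subrr enorm0.
have [k1 [D1 [XE r1 s1]]] := optimal_decomposition clX saX.
have [k2 [D2 [YE r2 s2]]] := optimal_decomposition clY saY.
have {}s1 i p : p \in ineqs (D1 i) ++ eqns (D1 i) -> (mpoly.msize p <= d.+1)%N.
  by move=> /s1 h; apply: leq_trans h _; rewrite ltnS leq_maxl.
have {}s2 j p : p \in ineqs (D2 j) ++ eqns (D2 j) -> (mpoly.msize p <= d.+1)%N.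
  by move=> /s2 h; apply: leq_trans h _; rewrite ltnS leq_maxr.
have t1 : d = 1%N -> forall i p, p \in ineqs (D1 i) ++ eqns (D1 i) -> (mpoly.msize p <= 2)%N.
  by move=> dE i p /s1; rewrite dE.
have t2 : d = 1%N -> forall j p, p \in ineqs (D2 j) ++ eqns (D2 j) -> (mpoly.msize p <= 2)%N.
  by move=> dE j p /s2; rewrite dE.
have sub i j : basic_set (D1 i) `&` basic_set (D2 j) `<=` X `&` Y.
  by move=> x [Dx Dy]; split; [rewrite XE; exists i|rewrite YE; exists j].
(* Pieces with fewer inequalities need fewer slack variables and give smaller exponents. *)
have n_le i j : (N + (size (ineqs (D1 i)) + size (ineqs (D2 j))) <= N + r)%N.
  by rewrite leq_add2l leq_add.
have [X0 Y0] := XY0.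
split=> [|[_ [V /nbhs_enorm[e e0 eV] VXY]]].
  apply: (combine_pieces XE YE X0 Y0 L1_gt0) => [x|x|x y|i j Di0 Dj0].
  - exact: dist_ge0.
  - by have := dist_le x XY0; rewrite subr0.
  - by apply: dist_triangle; exists 0.
  have le_dist x : dist x (X `&` Y) <= dist x (basic_set (D1 i) `&` basic_set (D2 j)).
    by apply: dist_sub; [exists 0|exact: sub].
  have [d2|d_lt2] := leqP 2 d.
    have [c [rho [c0 rho0 P]]] := piece_distance N_gt0 d2 (s1 i) (s2 j) Di0 Dj0.
    exists (d * (6 * d - 3) ^ (N + (size (ineqs (D1 i)) + size (ineqs (D2 j))) - 1))%N, c, rho.
    split=> // [|x y xr yr Dx Dy].
      rewrite leq_mul2l leq_pexp2l ?orbT ?leq_sub2r //; by clear -d1; lia.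
    apply: le_trans (P x y xr yr Dx Dy); rewrite ler_pM2l //.
    by apply: lerXn2r; rewrite ?nnegrE ?dist_ge0.
  (* For polyhedra the exponent 1 is available, and it is at most [L1]. *)
  have dE : d = 1%N by clear -d1 d_lt2; lia.
  have [c c0 P] := piece_distance_linear Di0 Dj0 (t1 dE i) (t2 dE j).
  exists 1%N, c, 1; split=> // x y _ _ Dx Dy; apply: le_trans (P x y Dx Dy).
  by rewrite ler_pM2l // expr1.
have iso x : enorm x < e -> (X `&` Y) x -> x = 0.
  move=> xe xXY; suff : [set 0] x by [].
  by rewrite -VXY; split=> //; apply: eV; rewrite subr0.
apply: (combine_pieces XE YE X0 Y0 L2_gt0) => [x|x|x y|i j Di0 Dj0].
- exact: enorm_ge0.
- exact: lexx.
- by have := enormD (x - y) y; rewrite subrK.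
have [d2|d_lt2] := leqP 2 d.
  have e20 : 0 < e / 2 by rewrite divr_gt0.
  have [|c [rho [c0 rho0 P]]] := piece_isolated d2 (s1 i) (s2 j) Di0 Dj0 e20.
    by move=> x xe /sub; apply: iso; lra.
  exists (((2 * d - 1) ^ (N + (size (ineqs (D1 i)) + size (ineqs (D2 j)))) + 1) %/ 2)%N, c, rho.
  split=> //; rewrite leq_div2r // leq_add2r leq_pexp2l //; by clear -d1; lia.
have dE : d = 1%N by clear -d1 d_lt2; lia.
have [c c0 P] := piece_distance_linear Di0 Dj0 (t1 dE i) (t2 dE j).
exists 1%N, c, (e / 2); split=> // [|x y xe _ Dx Dy]; first by rewrite divr_gt0.
apply: le_trans (P x y Dx Dy); rewrite ler_pM2l // expr1.
apply: lb_le_inf; first by exists (enorm (x - 0)), 0.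
(* A common point [a] of the pieces is either 0 or of norm at least [e]; in the latter case its
   distance from [x] exceeds [e / 2 > |x|]. *)
move=> _ [a AB <-]; have [ae|ae] := ltP (enorm a) e.
  by rewrite (iso a ae (sub _ _ _ AB)) subr0.
by have := enorm_triangle x a 0; rewrite !subr0 [enorm (a - x)]enormB; lra.
Qed.
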